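(* Let $A_k=\begin{bmatrix}a_k&b_k\\c_k&d_k\end{bmatrix}\in\mathbb{R}^{2\times2}$ with $\det(A_k)=1$ and $b_k\neq0$, for $k=1,2$. Let $\phi\in L^2(\mathbb{R}^2,\mathbb{H})\setminus\{0\}$ be a window function. Then for every $f\in L^2(\mathbb{R}^2,\mathbb{H})$ whose QWLCT satisfies $G^{A_1,A_2}_{\phi}\{f\}(\cdot,\mathbf{u})\in L^2(\mathbb{R}^2,\mathbb{H})$ (for each $\mathbf{u}\in\mathbb{R}^2$, as a function of $\mathbf{w}$), and for $k=1,2$, $$\left(\int_{\mathbb{R}^2}\int_{\mathbb{R}^2}\omega_k^2\,|G^{A_1,A_2}_{\phi}f(\mathbf{w},\mathbf{u})|^2\,d\mathbf{w}\,d\mathbf{u}\right)^{\frac12}\left(\int_{\mathbb{R}^2}x_k^2\,|f(\mathbf{x})|^2\,d\mathbf{x}\right)^{\frac12}\geq\frac{b_k}{2}\,\|f\|^2_{L^2(\mathbb{R}^2)}\,\|\phi\|_{L^2(\mathbb{R}^2)}.$$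
   Context: $\mathbb{H}$ denotes the quaternions $q=[q]_0+\mathbf{i}[q]_1+\mathbf{j}[q]_2+\mathbf{k}[q]_3$, $[q]_l\in\mathbb{R}$, with $\mathbf{i}^2=\mathbf{j}^2=\mathbf{k}^2=-1$, $\mathbf{i}\mathbf{j}=-\mathbf{j}\mathbf{i}=\mathbf{k}$, $\mathbf{j}\mathbf{k}=-\mathbf{k}\mathbf{j}=\mathbf{i}$, $\mathbf{k}\mathbf{i}=-\mathbf{i}\mathbf{k}=\mathbf{j}$; conjugate $\overline{q}=[q]_0-\mathbf{i}[q]_1-\mathbf{j}[q]_2-\mathbf{k}[q]_3$ and norm $|q|=\sqrt{q\overline{q}}$. $L^2(\mathbb{R}^2,\mathbb{H})$ is the space of functions $f:\mathbb{R}^2\to\mathbb{H}$ with $\|f\|^2=\|f\|^2_{L^2(\mathbb{R}^2)}=\int_{\mathbb{R}^2}|f(\mathbf{x})|^2\,d\mathbf{x}<\infty$. For $\mathbf{x}=(x_1,x_2)$, $\mathbf{w}=(\omega_1,\omega_2)$, $\mathbf{u}=(u_1,u_2)$ in $\mathbb{R}^2$, the kernels are $$K_{A_1}^{\mathbf{i}}(x_1,\omega_1)=\frac{1}{\sqrt{2\pi b_1}}e^{\mathbf{i}\left(\frac{a_1}{2b_1}x_1^2-\frac{x_1\omega_1}{b_1}+\frac{d_1}{2b_1}\omega_1^2-\frac{\pi}{4}\right)},\qquad K_{A_2}^{\mathbf{j}}(x_2,\omega_2)=\frac{1}{\sqrt{2\pi b_2}}e^{\mathbf{j}\left(\frac{a_2}{2b_2}x_2^2-\frac{x_2\omega_2}{b_2}+\frac{d_2}{2b_2}\omega_2^2-\frac{\pi}{4}\right)},$$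 where for negative $b_1$ (resp. $b_2$) the square root is taken in $\mathbb{R}+\mathbf{i}\mathbb{R}$ as $\mathbf{i}\sqrt{2\pi|b_1|}$ (resp. in $\mathbb{R}+\mathbf{j}\mathbb{R}$ as $\mathbf{j}\sqrt{2\pi|b_2|}$). The two-sided quaternion windowed linear canonical transform (QWLCT) of $f$ with respect to the window $\phi$ is $$G^{A_1,A_2}_{\phi}f(\mathbf{w},\mathbf{u})=G^{A_1,A_2}_{\phi}\{f\}(\mathbf{w},\mathbf{u})=\int_{\mathbb{R}^2}K_{A_1}^{\mathbf{i}}(x_1,\omega_1)\,f(\mathbf{x})\,\overline{\phi(\mathbf{x}-\mathbf{u})}\,K_{A_2}^{\mathbf{j}}(x_2,\omega_2)\,d\mathbf{x}.$$ Integrals of nonnegative functions are allowed to be $+\infty$. *)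

(* Defs.v *)
From HB Require Import structures.
From mathcomp Require Import all_boot all_order all_algebra.
From mathcomp Require Import all_classical all_reals all_analysis.
From mathcomp Require Import ring.

Set Implicit Arguments.
Unset Strict Implicit.
Unset Printing Implicit Defensive.

Import Order.TTheory GRing.Theory Num.Theory.
Import numFieldNormedType.Exports.

Local Open Scope ring_scope.

(* [Quat a b c d] is a + i b + j c + k d. *)
Record quaternion (R : Type) := Quat { qre : R; qi : R; qj : R; qk : R }.

Section QuaternionAlgebra.
Variable R : realFieldType.
Local Notation H := (quaternion R).
Implicit Types p q r : H.

Definition quat_tuple (q : H) : R * R * R * R := (qre q, qi q, qj q, qk q).
Definition tuple_quat (t : R * R * R * R) : H :=
  let: (a, b, c, d) := t in Quat a b c d.

Lemma quat_tupleK : cancel quat_tuple tuple_quat.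
Proof. by case. Qed.

HB.instance Definition _ := Choice.copy H (can_type quat_tupleK).

Definition qadd p q :=
  Quat (qre p + qre q) (qi p + qi q) (qj p + qj q) (qk p + qk q).
Definition qopp q := Quat (- qre q) (- qi q) (- qj q) (- qk q).

Lemma qaddA : associative qadd.
Proof. by move=> p q r; rewrite /qadd /= !addrA. Qed.
Lemma qaddC : commutative qadd.
Proof. by move=> p q; rewrite /qadd; congr Quat; rewrite addrC. Qed.
Lemma qadd0 : left_id (Quat 0 0 0 0) qadd.
Proof. by case=> a b c d; rewrite /qadd /= !add0r. Qed.
Lemma qaddN : left_inverse (Quat 0 0 0 0) qopp qadd.
Proof. by case=> a b c d; rewrite /qadd /= !addNr. Qed.

HB.instance Definition _ := GRing.isZmodule.Build H qaddA qaddC qadd0 qaddN.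

Definition qmul p q :=
  Quat (qre p * qre q - qi p * qi q - qj p * qj q - qk p * qk q)
       (qre p * qi q + qi p * qre q + qj p * qk q - qk p * qj q)
       (qre p * qj q - qi p * qk q + qj p * qre q + qk p * qi q)
       (qre p * qk q + qi p * qj q - qj p * qi q + qk p * qre q).

Lemma qmulA : associative qmul.
Proof. by move=> p q r; rewrite /qmul /qadd /=; congr Quat; ring. Qed.
Lemma qmul1 : left_id (Quat 1 0 0 0) qmul.
Proof. by case=> a b c d; rewrite /qmul /qadd /=; congr Quat; ring. Qed.
Lemma qmulr1 : right_id (Quat 1 0 0 0) qmul.
Proof. by case=> a b c d; rewrite /qmul /qadd /=; congr Quat; ring. Qed.
Lemma qmulDl : left_distributive qmul qadd.
Proof. by move=> p q r; rewrite /qmul /qadd /=; congr Quat; ring. Qed.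
Lemma qmulDr : right_distributive qmul qadd.
Proof. by move=> p q r; rewrite /qmul /qadd /=; congr Quat; ring. Qed.
Lemma qone_neq0 : Quat 1 0 0 0 != 0 :> H.
Proof. by apply/eqP => -[] /eqP; rewrite oner_eq0. Qed.

HB.instance Definition _ := GRing.Zmodule_isNzRing.Build H
  qmulA qmul1 qmulr1 qmulDl qmulDr qone_neq0.

Definition qconj q : H := Quat (qre q) (- qi q) (- qj q) (- qk q).

Definition qreal (a : R) : H := Quat a 0 0 0.

Lemma mulq_conj q :
  q * qconj q = qreal (qre q ^+ 2 + qi q ^+ 2 + qj q ^+ 2 + qk q ^+ 2).
Proof. by case: q => a b c d; congr Quat => /=; ring. Qed.

Lemma mulqC_conj q : qconj q * q = q * qconj q.
Proof. by case: q => a b c d; congr Quat => /=; ring. Qed.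

Lemma qrealC (a : R) q : qreal a * q = q * qreal a.
Proof. by case: q => b c d e; congr Quat => /=; ring. Qed.

Definition qinv q : H := qconj q * qreal (qre (q * qconj q))^-1.

Lemma qsqr_neq0 q : q != 0 -> qre (q * qconj q) != 0.
Proof.
apply: contraNneq; rewrite mulq_conj /=; case: q => a b c d /= => /eqP.
rewrite !paddr_eq0 ?addr_ge0 ?sqr_ge0// !sqrf_eq0.
by case/andP=> /andP[/andP[/eqP-> /eqP->] /eqP->] /eqP->.
Qed.

Lemma qmulrV q : q != 0 -> q * qinv q = 1.
Proof.
move=> q0; have := qsqr_neq0 q0.
rewrite /qinv mulrA mulq_conj /=; set s := (X in qreal X) => s0.
by congr Quat => /=; rewrite ?(mulr0, mul0r, subr0, addr0) ?mulfV.
Qed.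

Lemma qmulVr q : q != 0 -> qinv q * q = 1.
Proof.
move=> q0; rewrite -(qmulrV q0) /qinv.
by rewrite -[LHS]mulrA qrealC mulrA mulqC_conj [RHS]mulrA.
Qed.

Lemma qunitP p q : q * p = 1 /\ p * q = 1 -> p != 0.
Proof.
by case=> _ h; apply/eqP => p0; move/eqP: h; rewrite p0 mul0r eq_sym oner_eq0.
Qed.

Lemma qinv0 : {in [predC [pred q : H | q != 0]], qinv =1 id}.
Proof.
move=> q /negPn/eqP->; rewrite /qinv.
have -> : qconj (0 : H) = 0 by rewrite /qconj !oppr0.
by rewrite mul0r.
Qed.

HB.instance Definition _ := GRing.NzRing_hasMulInverse.Build H
  (unit_subdef := [pred q : H | q != 0]) qmulVr qmulrV qunitP qinv0.

End QuaternionAlgebra.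

(* R^2; [measurableTypeR R] is R with its Borel sigma-algebra, the domain of
   [lebesgue_measure]. *)
Notation plane R := (measurableTypeR R * measurableTypeR R)%type.

Section QWLCT.
Variable R : realType.
Local Notation H := (quaternion R).
Local Open Scope classical_set_scope.
Local Open Scope ereal_scope.

(* |q| = sqrt (q q^conj), where q q^conj is a real scalar by [mulq_conj] *)
Definition qnorm (q : H) : R := Num.sqrt (qre (q * qconj q)%R).

Definition lebesgue2 : set (plane R) -> \bar R :=
  @lebesgue_measure R \x @lebesgue_measure R.

HB.instance Definition _ := Measure.on lebesgue2.

Lemma lebesgue2_sigma_finite : sigma_finite setT lebesgue2.
Proof.
have /sigma_finiteP[F [TF ndF Foo]] := sigma_finiteT (@lebesgue_measure R).
exists (fun n => F n `*` F n).
  rewrite -setXTT TF predeqE => -[x y]; split.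
    move=> [/= [n _ Fnx] [k _ Fky]]; exists (maxn n k) => //; split.
    - by move: x Fnx; exact/subsetPset/ndF/leq_maxl.
    - by move: y Fky; exact/subsetPset/ndF/leq_maxr.
  by move=> [n _ []/= ? ?]; split; exists n.
move=> k; have [? ?] := Foo k.
split; first exact: measurableX.
by rewrite /lebesgue2 product_measure1E// lte_mul_pinfty// ge0_fin_numE.
Qed.

HB.instance Definition _ :=
  Measure_isSigmaFinite.Build _ _ _ lebesgue2 lebesgue2_sigma_finite.

Definition qmeasurable (f : plane R -> H) : Prop :=
  [/\ measurable_fun setT (fun x => qre (f x)),
      measurable_fun setT (fun x => qi (f x)),
      measurable_fun setT (fun x => qj (f x)) &
      measurable_fun setT (fun x => qk (f x))].

Definition qintegral (f : plane R -> H) : H :=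
  Quat (Rintegral lebesgue2 setT (fun x => qre (f x)))
       (Rintegral lebesgue2 setT (fun x => qi (f x)))
       (Rintegral lebesgue2 setT (fun x => qj (f x)))
       (Rintegral lebesgue2 setT (fun x => qk (f x))).

Definition L2norm (f : plane R -> H) : \bar R :=
  sqrte (\int[lebesgue2]_x ((qnorm (f x)) ^+ 2)%:E).

(* Elements of L^2 are represented by (Borel) measurable functions; equality in
   L^2 is equality almost everywhere. *)
Definition inL2 (f : plane R -> H) : Prop :=
  qmeasurable f /\ \int[lebesgue2]_x ((qnorm (f x)) ^+ 2)%:E < +oo.

Local Open Scope ring_scope.

Definition expi (t : R) : H := Quat (cos t) (sin t) 0 0.
Definition expj (t : R) : H := Quat (cos t) 0 (sin t) 0.

(* Square roots of real numbers, taken in R + iR and R + jR respectively. *)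
Definition sqrti (t : R) : H :=
  if 0 <= t then Quat (Num.sqrt t) 0 0 0 else Quat 0 (Num.sqrt `|t|) 0 0.
Definition sqrtj (t : R) : H :=
  if 0 <= t then Quat (Num.sqrt t) 0 0 0 else Quat 0 0 (Num.sqrt `|t|) 0.

(* For A = [a b; c d], the entries are a = A 0 0, b = A 0 1, d = A 1 1. *)
Definition lct_phase (A : 'M[R]_2) (x w : R) : R :=
  A 0 0 / (2 * A 0 1) * x ^+ 2 - x * w / A 0 1
  + A 1 1 / (2 * A 0 1) * w ^+ 2 - pi / 4.

Definition kerneli (A : 'M[R]_2) (x w : R) : H :=
  (sqrti (2 * pi * A 0 1))^-1 * expi (lct_phase A x w).
Definition kernelj (A : 'M[R]_2) (x w : R) : H :=
  (sqrtj (2 * pi * A 0 1))^-1 * expj (lct_phase A x w).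

Definition qwlct (A1 A2 : 'M[R]_2) (phi f : plane R -> H) (w u : plane R) : H :=
  qintegral (fun x => kerneli A1 x.1 w.1 * f x
    * qconj (phi ((x.1 : R) - u.1, (x.2 : R) - u.2)) * kernelj A2 x.2 w.2).

(* The indices 1, 2 of the coordinates are the elements 0, 1 of 'I_2. *)
Definition coord2 (k : 'I_2) (x : plane R) : R := if k == 0 then x.1 else x.2.

End QWLCT.

(* Main.v *)
From HB Require Import structures.
Require Import Defs.
From mathcomp Require Import all_boot all_order all_algebra.
From mathcomp Require Import all_classical all_reals all_analysis.
From mathcomp Require Import measurable_realfun ring lra.

(** Writing [n = |g|^2] with [g x = f x * conj (phi (x - u))], the inequality is
    Heisenberg's uncertainty principle for [g], integrated over the position [u] of
    the window.  The kernels are chirps times Fourier kernels, so for fixed [u] the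
    transform is, up to factors that do not depend on [x], the two-sided Fourier
    transform at the frequencies [w_k / b_k] of [g] multiplied by chirps of modulus
    one ([qwlct_integrand], [nsq_chirped]).

    A product of square roots does not survive integration in [u].  The principle is
    therefore proved in the linear form
      [N <= lam * X + lam^-1 * W] for all [lam > 0],
    where [N], [X], [W] are, up to constants, the mass, the spatial second moment and
    the spectral second moment.  This form is additive: it can be summed over real components and
    integrated over slices of the plane ([partial_transform_ineq], [qft_ineq]) and
    over [u] ([window_uncertainty]).  After the last integration Tonelli's theorem and
    translation invariance turn [N] and [X] into products with the squared norm of
    [phi], and only then is [lam] chosen to recover the product ([optimize_ereal]).
    The choice needs [X] and [W] nonzero; [X = 0] forces [f = 0] almost everywhere, and
    [W = 0] forces, by Plancherel, [g = 0] almost everywhere for almost every [u]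
    ([window_spectrum_eq0]).
    For nonpositive [b_k] the lower bound is nonpositive.

    On the line the principle ([heisenberg_real]) avoids derivatives:
      [t * N = \int x * (n x - n (x + t))]
    is bounded through the weighted inequality of the two means by second moments of
    [n] and by [\int |g x - g (x + t)|^2].  Plancherel bounds the latter, up to
    a constant, by the integral of [2 * (1 - cos (beta * t * w)) * |g^ w|^2], at most [t^2 * beta^2 * W];
    dividing by [t] and letting [t] tend to [0] gives the claim.

    Only the inequality [\int |g|^2 <= c * \int |g^|^2] of Plancherel's theorem is
    needed ([scalar_plancherel]).  For integrable [D], the means of [D] over intervals
    of radius [r] and the Fourier transform of [D] damped by a cardinal sine have
    proportional L^2 norms, because both squared norms are quadratic forms in [D] with
    the same kernel, a triangle function of [x - y] ([integral_box2],
    [Rintegral_sincf2_cos]).  Letting [r] tend to [0], Lebesgue's differentiation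
    theorem and Fatou's lemma give the inequality.

    In the plane, write a quaternion as [(a + i b) + (c + i d) j].  The left factor
    [e^(-i b1 x1 w1)] acts as a complex Fourier transform in [x1] on the pairs [(a, b)]
    and [(c, d)]; the right factor [e^(-j b2 x2 w2)] then acts in [x2] on the pair of
    real parts and on the pair of imaginary parts so obtained ([nsq_qft]).
    For the first coordinate the principle is applied in [x1] and Plancherel in [x2];
    for the second, the anti-automorphism of the quaternions that exchanges [i] and
    [j], combined with the exchange of coordinates, reduces to the first
    ([qft_uncertainty]). *)

Import Order.TTheory GRing.Theory Num.Theory.
Import numFieldNormedType.Exports.
Set Implicit Arguments. Unset Strict Implicit. Unset Printing Implicit Defensive.
Local Open Scope classical_set_scope.
Local Open Scope ring_scope.

(** * Invariance of Lebesgue measure *)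

Section LebesgueInvariance.
Context {R : realType}.
Local Notation mu := (@lebesgue_measure R).
Local Open Scope ereal_scope.

Lemma lebesgue_measure_translate (c : R) (A : set R) : measurable A ->
  pushforward mu ((fun x => x + c)%R : _ -> measurableTypeR R) A = mu A.
Proof.
have mf : measurable_fun setT ((fun x => x + c)%R : measurableTypeR R -> measurableTypeR R).
  by apply: measurable_funD => //; exact: measurable_cst.
move=> mA; apply/esym/lebesgue_measure_unique => //= _ [[a b]] _ <-.
rewrite /pushforward.
rewrite (_ : _ @^-1` _ = [set` `](a - c)%R, (b - c)%R]]); last first.
  by apply/seteqP; split => x /=; rewrite !in_itv/= ltrBlDr lerBrDr.
by rewrite !lebesgue_measure_itv/= !lte_fin ltrD2r !EFinB/= -!EFinB opprD opprK addrACA addNr addr0.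
Qed.

Lemma ge0_integral_translate (c : R) (f : R -> \bar R) :
  measurable_fun setT f -> (forall x, 0 <= f x) ->
  \int[mu]_x f (x + c)%R = \int[mu]_x f x.
Proof.
move=> mf f0.
have mt : measurable_fun setT ((fun x => x + c)%R : measurableTypeR R -> measurableTypeR R).
  by apply: measurable_funD => //; exact: measurable_cst.
rewrite -[LHS]/(\int[mu]_(x in (fun x => x + c)%R @^-1` setT) (f \o (fun x => x + c)%R) x).
rewrite -(ge0_integral_pushforward mt)//.
by apply: eq_measure_integral => //= A mA _; exact: lebesgue_measure_translate.
Qed.

Lemma ge0_integral_reflect (f : R -> \bar R) :
  measurable_fun setT f -> (forall x, 0 <= f x) ->
  \int[mu]_x f (- x)%R = \int[mu]_x f x.
Proof.
move=> mf f0.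
have mt : measurable_fun setT ((fun x => - x)%R : measurableTypeR R -> measurableTypeR R).
  exact: oppr_measurable.
rewrite -[LHS]/(\int[mu]_(x in (fun x => - x)%R @^-1` setT) (f \o (fun x => - x)%R) x).
rewrite -(ge0_integral_pushforward mt)//.
by apply: eq_measure_integral => //= A mA _; exact: lebesgue_measureN.
Qed.

Lemma integral_translate (c : R) (f : R -> \bar R) :
  measurable_fun setT f -> \int[mu]_x f (x + c)%R = \int[mu]_x f x.
Proof.
move=> mf; rewrite integralE [RHS]integralE.
under eq_integral do rewrite (funepos_comp f)/=.
under [X in _ - X = _]eq_integral do rewrite (funeneg_comp f)/=.
congr (_ - _); apply: ge0_integral_translate => //.
- exact: measurable_funepos.
- exact: measurable_funeneg.
Qed.

Lemma integrable_translate (c : R) (f : R -> \bar R) :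
  mu.-integrable setT f -> mu.-integrable setT (fun x => f (x + c)%R).
Proof.
move=> /integrableP[mf foo]; apply/integrableP; split.
  apply: (measurableT_comp mf).
  by apply: measurable_funD => //; exact: measurable_cst.
rewrite (ge0_integral_translate c (f := fun x => `|f x|))//.
exact: measurableT_comp.
Qed.

End LebesgueInvariance.

(** * The integral of [(1 - cos (a w)) / w^2] *)

Section FejerIntegral.
Context {R : realType}.
Local Notation mu := (@lebesgue_measure R).

Lemma norm_cos_le1 (x : R) : `|cos x| <= 1.
Proof. by rewrite ler_norml cos_geN1 cos_le1. Qed.

Lemma norm_sin_le1 (x : R) : `|sin x| <= 1.
Proof. by rewrite ler_norml sin_geN1 sin_le1. Qed.

Lemma cvgy_bounded_expRNM (s M : R) (g : R -> R) : 0 < s ->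
  (forall x, 0 <= x -> `|g x| <= M) ->
  g x * expR (- (s * x)) @[x --> +oo] --> (0 : R).
Proof.
move=> s0 gM.
have e0 : expR (- (s * x)) @[x --> +oo] --> (0 : R).
  apply: (cvg_comp (fun x => s * x) _ _ (@cvgr_expR R)).
  exact/gt0_cvgMry.
apply: (@squeeze_cvgr _ _ _ _ (fun x => - M * expR (- (s * x)))
                               (fun x => M * expR (- (s * x)))).
- near=> x; rewrite -!(mulrC (expR _)) !ler_pM2l ?expR_gt0// -ler_norml gM//.
- by rewrite -(mulr0 (- M)); apply: cvgM => //; exact: cvg_cst.
- by rewrite -(mulr0 M); apply: cvgM => //; exact: cvg_cst.
Unshelve. all: by end_near. Qed.

Lemma derivable_continuous (f : R -> R) :
  (forall x : R, derivable f x 1) -> continuous f.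
Proof. by move=> df x; apply/differentiable_continuous/derivable1_diffP. Qed.

(** Derivability of the primitive on the whole line supplies the boundary conditions of
    the fundamental theorem of calculus on the half-line. *)
Lemma integral0y_FTC (f F : R -> R) (l : R) :
  (forall x, 0 <= x -> 0 <= f x) -> continuous f ->
  (forall x : R, is_derive x 1 F (f x)) -> F x @[x --> +oo] --> l ->
  (\int[mu]_(x in `[0%R, +oo[) (f x)%:E = (l - F 0)%:E)%E.
Proof.
move=> f0 cf dF Fl; rewrite (ge0_continuous_FTC2y f0 _ Fl) ?EFinB//.
- exact: continuous_subspaceT.
- apply/cvg_at_right_filter/differentiable_continuous.
  by apply/derivable1_diffP.
- by move=> x _; rewrite derive1E; exact: derive_val.
Qed.

(** Writes [1 / w^2] as an integral of exponentials; it converts the oscillating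
    integral of [(1 - cos (a w)) / w^2] into the two absolutely convergent ones below. *)
Lemma integral0y_expRM (w : R) : 0 < w ->
  (\int[mu]_(s in `[0%R, +oo[) (s * expR (- (w * s)))%:E = ((w ^+ 2)^-1)%:E)%E.
Proof.
move=> w0.
pose F (s : R) : R := - (s / w + (w ^+ 2)^-1) * expR (- (w * s)).
have dF (x : R) : is_derive x 1 F (x * expR (- (w * x))).
  apply: is_derive_eq; rewrite /GRing.scale/= !mulr1 !mulr0.
  by field; rewrite gt_eqF.
rewrite (integral0y_FTC (l := 0) _ _ dF).
- by rewrite /F sub0r mul0r add0r mulr0 oppr0 expR0 mulr1 opprK.
- by move=> x x0; rewrite mulr_ge0 ?expR_ge0.
- by apply: derivable_continuous => x; exact: ex_derive.
- have -> : F =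
    (fun s => (- (s / w + (w ^+ 2)^-1) * expR (- (w / 2 * s))) * expR (- (w / 2 * s))).
    apply/funext => s; rewrite -mulrA -expRD; congr (_ * expR _); lra.
  apply: (@cvgy_bounded_expRNM _ (2 / w ^+ 2 + (w ^+ 2)^-1)); first by rewrite divr_gt0.
  move=> x x0; rewrite normrM normrN (ger0_norm (expR_ge0 _)) ger0_norm; last first.
    by rewrite addr_ge0 ?divr_ge0 ?invr_ge0 ?sqr_ge0// ltW.
  rewrite expRN ler_pdivrMr ?expR_gt0//.
  apply: (@le_trans _ _ ((2 / w ^+ 2 + (w ^+ 2)^-1) * (1 + w / 2 * x))); last first.
    by rewrite ler_wpM2l ?expR_ge1Dx// addr_ge0 ?divr_ge0 ?invr_ge0 ?sqr_ge0.
  rewrite -subr_ge0.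
  have -> : (2 / w ^+ 2 + (w ^+ 2)^-1) * (1 + w / 2 * x) - (x / w + (w ^+ 2)^-1) =
    2 / w ^+ 2 + x / w / 2 by field; rewrite gt_eqF.
  by rewrite addr_ge0 ?divr_ge0 ?sqr_ge0// ltW.
Qed.

Lemma integral0y_1Bcos_expR (a s : R) : 0 < s ->
  (\int[mu]_(w in `[0%R, +oo[) ((1 - cos (a * w)) * expR (- (s * w)))%:E =
    (a ^+ 2 / (s * (s ^+ 2 + a ^+ 2)))%:E)%E.
Proof.
move=> s0.
have d0 : s ^+ 2 + a ^+ 2 != 0 by rewrite gt_eqF// ltr_wpDr ?sqr_ge0 ?exprn_gt0.
pose g (w : R) : R := (s * cos (a * w) - a * sin (a * w)) / (s ^+ 2 + a ^+ 2) - s^-1.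
have dF (x : R) : is_derive x 1 (fun w => g w * expR (- (s * w)))
    ((1 - cos (a * x)) * expR (- (s * x))).
  rewrite /g; apply: is_derive_eq.
  rewrite /GRing.scale/= !mulr1 !mulr0.
  by field; rewrite d0 gt_eqF.
rewrite (integral0y_FTC (l := 0) _ _ dF).
- rewrite /g !mulr0 oppr0 expR0 cos0 sin0 !mulr1 mulr0 subr0; congr (_%:E).
  by field; rewrite d0 gt_eqF.
- by move=> x x0; rewrite mulr_ge0 ?expR_ge0// subr_ge0 cos_le1.
- by apply: derivable_continuous => x; exact: ex_derive.
- apply: (@cvgy_bounded_expRNM _ ((s + `|a|) / (s ^+ 2 + a ^+ 2) + s^-1)) => //.
  move=> x x0; rewrite /g (le_trans (ler_normB _ _))// lerD//; last first.
    by rewrite ger0_norm// invr_ge0 ltW.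
  rewrite normrM ler_pM//; last by rewrite ger0_norm// invr_ge0 addr_ge0 ?sqr_ge0.
  rewrite (le_trans (ler_normB _ _))// !normrM lerD//.
    by rewrite (gtr0_norm s0) ler_piMr ?(ltW s0)// norm_cos_le1.
  by rewrite ler_piMr// norm_sin_le1.
Qed.

Lemma integral0y_Lorentz (a : R) : 0 < a ->
  (\int[mu]_(s in `[0%R, +oo[) (a ^+ 2 / (s ^+ 2 + a ^+ 2))%:E = (a * (pi / 2))%:E)%E.
Proof.
move=> a0.
have d0 x : x ^+ 2 + a ^+ 2 != 0 by rewrite gt_eqF// ltr_wpDl ?sqr_ge0 ?exprn_gt0.
have dF (x : R) : is_derive x 1 (fun x => a * atan (x / a))
    (a ^+ 2 / (x ^+ 2 + a ^+ 2)).
  apply: is_derive_eq.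
  rewrite /GRing.scale/= !mulr0 !mulr1 add0r.
  by field; rewrite d0 gt_eqF.
rewrite (integral0y_FTC (l := a * (pi / 2)) _ _ dF).
- by rewrite mul0r atan0 mulr0 subr0.
- by move=> x _; rewrite divr_ge0 ?addr_ge0 ?sqr_ge0.
- apply: derivable_continuous => x; have := d0 x => {}d0; exact: ex_derive.
- apply: cvgM; first exact: cvg_cst.
  apply: (cvg_comp (fun x => x / a) _ _ (@cvgy_atan R)).
  by apply: gt0_cvgMly => //; rewrite invr_gt0.
Qed.
End FejerIntegral.

Section MeasurableComposition.
Context d (T : measurableType d) (R : realType).
Implicit Types (D : set T) (f : T -> R).

Lemma measurable_fun_cos D f :
  measurable_fun D f -> measurable_fun D (fun x => cos (f x)).
Proof.
apply: measurableT_comp; apply: continuous_measurable_fun.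
exact: continuous_cos.
Qed.

Lemma measurable_fun_sin D f :
  measurable_fun D f -> measurable_fun D (fun x => sin (f x)).
Proof.
apply: measurableT_comp; apply: continuous_measurable_fun.
exact: continuous_sin.
Qed.

Lemma measurable_fun_expR D f :
  measurable_fun D f -> measurable_fun D (fun x => expR (f x)).
Proof. by apply: measurableT_comp; exact: measurable_expR. Qed.

Lemma measurable_fun_norm D f :
  measurable_fun D f -> measurable_fun D (fun x => `|f x|).
Proof. by apply: measurableT_comp; exact: normr_measurable. Qed.

Lemma measurable_fun_inv D f :
  measurable_fun D f -> measurable_fun D (fun x => (f x)^-1).
Proof.
apply: measurableT_comp.
apply: (eq_measurable_fun (fun x : R => x * powR (x ^+ 2) (-1))).
  move=> x _; rewrite powR_inv1 ?sqr_ge0//.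
  have [->|x0] := eqVneq x 0; first by rewrite mul0r invr0.
  by field.
apply: measurable_funM => //.
apply: (@measurableT_comp _ _ _ _ _ _ (fun x => powR x (-1)) _
  (fun x : R => x ^+ 2)); [exact: measurable_powR|exact: exprn_measurable].
Qed.

End MeasurableComposition.

Ltac meas := lazymatch goal with
  | |- measurable_fun _ (fun x => x) => exact: measurable_id
  | |- measurable_fun _ (fun x => fst x) => exact: measurable_fst
  | |- measurable_fun _ (fun x => snd x) => exact: measurable_snd
  | |- measurable_fun _ (fun x => (@?f x * @?g x)%R) => apply: measurable_funM; meas
  | |- measurable_fun _ (fun x => (- @?f x)%R) => apply: measurable_funN; meas
  | |- measurable_fun _ (fun x => (@?f x + @?g x)%R) => apply: measurable_funD; meas
  | |- measurable_fun _ (fun x => (@?f x ^+ _)%R) => apply: measurable_funX; meas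
  | |- measurable_fun _ (fun x => cos _) => apply: measurable_fun_cos; meas
  | |- measurable_fun _ (fun x => sin _) => apply: measurable_fun_sin; meas
  | |- measurable_fun _ (fun x => expR _) => apply: measurable_fun_expR; meas
  | |- measurable_fun _ (fun x => Num.norm _) => apply: measurable_fun_norm; meas
  | |- measurable_fun _ (fun x => (_^-1)%R) => apply: measurable_fun_inv; meas
  | |- measurable_fun _ (fun x => fst (@?f x)) => apply: (measurableT_comp measurable_fst); meas
  | |- measurable_fun _ (fun x => snd (@?f x)) => apply: (measurableT_comp measurable_snd); meas
  | |- _ => first [assumption | exact: measurable_cst | by []]
  end.

Lemma ge0_integralZl_real d (T : measurableType d) (R : realType)
    (m : {measure set T -> \bar R}) (D : set T) (k : R) (f : T -> R) :
  measurable D -> measurable_fun D f -> (forall x, 0 <= f x) -> 0 <= k ->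
  (\int[m]_(x in D) (k * f x)%:E = k%:E * \int[m]_(x in D) (f x)%:E)%E.
Proof.
move=> mD mf f0 k0; under eq_integral do rewrite EFinM.
rewrite ge0_integralZl//; first exact/measurable_EFinP.
by move=> x _; rewrite lee_fin.
Qed.

Section OneMinusCosIntegral.
Context {R : realType}.
Local Notation mu := (@lebesgue_measure R).

Lemma ge0_even_integralT (f : R -> R) (l : R) : (forall x, 0 <= f x)%R ->
  continuous f -> (forall x, f (- x) = f x) ->
  (\int[mu]_(x in `[0%R, +oo[) (f x)%:E = l%:E)%E ->
  (\int[mu]_x (f x)%:E = (2 * l)%:E)%E.
Proof.
move=> f0 cf ef fl; rewrite ge0_symfun_integralT//.
  by rewrite -set_itvcy fl.
by move=> x /=; rewrite ef.
Qed.

Let K (a : R) (z : plane R) : R :=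
  (1 - cos (a * z.1)) * (`|z.2| * expR (- (`|z.1| * `|z.2|))).

Let K_ge0 a z : 0 <= K a z.
Proof. by rewrite mulr_ge0 ?subr_ge0 ?cos_le1// mulr_ge0 ?expR_ge0. Qed.

Let measurable_K a : measurable_fun setT (K a).
Proof. by rewrite /K; meas. Qed.

(** Tonelli's theorem for [(1 - cos (a w)) * s * e^(- |w| s)]: integrating first in [s]
    gives [(1 - cos (a w)) / w^2], integrating first in [w] gives the rational function
    [a^2 / (s^2 + a^2)], whose integral is an arctangent.  Absolute values extend the
    kernel evenly, so that both integrals run over the whole line. *)
Lemma integral_1Bcos_divsqr (a : R) :
  (\int[mu]_w ((1 - cos (a * w)) / w ^+ 2)%:E = (pi * `|a|)%:E)%E.
Proof.
have -> : (fun w => ((1 - cos (a * w)) / w ^+ 2)%:E) =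
    (fun w => ((1 - cos (`|a| * w)) / w ^+ 2)%:E) :> (R -> \bar R).
  apply/funext => w.
  by case: (ger0P a) => // _; rewrite mulNr cosN.
have [->|a0] := eqVneq a 0.
  rewrite normr0 mulr0 integral0_eq// => w _.
  by rewrite mul0r cos0 subrr mul0r.
have : 0 < `|a| by rewrite normr_gt0.
move: (`|a| : R) => {a0} {}a a0.
have cnorm (c : R) : continuous (fun x : R => `|x| * expR (- (c * `|x|))).
  move=> x; apply: cvgM; first exact: norm_continuous.
  apply: continuous_comp; last exact: continuous_expR.
  apply: cvgN; apply: cvgM; first exact: cvg_cst.
  exact: norm_continuous.
have Kw w : (\int[mu]_s (K a (w, s))%:E = (2 * ((1 - cos (a * w)) / w ^+ 2))%:E)%E.
  have [->|w0] := eqVneq w 0.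
    rewrite mulr0 cos0 subrr mul0r mulr0 integral0_eq// => s _.
    by rewrite /K/= mulr0 cos0 subrr mul0r.
  rewrite /K/=; apply: ge0_even_integralT.
  - by move=> s; exact: (K_ge0 a (w, s)).
  - move=> s; apply: cvgM; first exact: cvg_cst.
    exact: cnorm.
  - by move=> x; rewrite normrN.
  - rewrite ge0_integralZl_real; [|by []
      |by apply: measurable_funTS; meas|by move=> x; rewrite mulr_ge0// expR_ge0
      |by rewrite subr_ge0 cos_le1].
    rewrite EFinM; congr (_ * _)%E.
    have := @integral0y_expRM R `|w|; rewrite normr_gt0 => /(_ w0).
    rewrite real_normK ?num_real// => <-.
    by apply: eq_integral => s; rewrite inE/= in_itv/= andbT => s0; rewrite (ger0_norm s0).
have Ks (s : R) : s != 0 ->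
    (\int[mu]_w (K a (w, s))%:E = (2 * (a ^+ 2 / (s ^+ 2 + a ^+ 2)))%:E)%E.
  move=> s0; rewrite /K/=; apply: ge0_even_integralT.
  - by move=> w; exact: (K_ge0 a (w, s)).
  - move=> w; apply: cvgM.
      apply: cvgB; first exact: cvg_cst.
      apply: continuous_comp; last exact: continuous_cos.
      by apply: cvgM; [exact: cvg_cst|exact: cvg_id].
    apply: cvgM; first exact: cvg_cst.
    apply: continuous_comp; last exact: continuous_expR.
    apply: cvgN; apply: cvgM; last exact: cvg_cst.
    exact: norm_continuous.
  - by move=> x; rewrite normrN mulrN cosN.
  - transitivity (\int[mu]_(w in `[0%R, +oo[) (`|s|%:E *
        ((1 - cos (a * w)) * expR (- (`|s| * w)))%:E))%E.
      apply: eq_integral => w; rewrite inE/= in_itv/= andbT => w0.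
      by rewrite -EFinM (ger0_norm w0) mulrCA (mulrC w).
    under eq_integral do rewrite -EFinM.
    rewrite ge0_integralZl_real; [|by []
      |by apply: measurable_funTS; meas
      |by move=> x; rewrite mulr_ge0 ?expR_ge0// subr_ge0 cos_le1|by []].
    rewrite integral0y_1Bcos_expR ?normr_gt0// -EFinM real_normK ?num_real//.
    congr (_%:E); field.
    by rewrite normr_eq0 s0 gt_eqF// ltr_wpDl ?sqr_ge0// exprn_gt0.
have := fubini_tonelli (m1 := mu) (m2 := mu) (EFin \o K a).
move=> /(_ (measurableT_comp (@EFin_measurable _ _) (measurable_K a))).
move=> /(_ (fun z => K_ge0 a z)) /=.
under eq_integral do rewrite Kw.
rewrite ge0_integralZl_real; [|by []|by meas
  |by move=> x; rewrite divr_ge0 ?sqr_ge0// subr_ge0 cos_le1|by []].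
move=> KK.
have : (2%:E * \int[mu]_x ((1 - cos (a * x)) / x ^+ 2)%:E = 2%:E * (pi * a)%:E)%E.
  rewrite KK.
  transitivity (\int[mu]_s (2 * (a ^+ 2 / (s ^+ 2 + a ^+ 2)))%:E)%E.
    apply: ae_eq_integral => //.
    - apply: (measurable_fun_fubini_tonelli_G (EFin \o K a)).
        exact: (measurableT_comp (@EFin_measurable _ _) (measurable_K a)).
      by move=> z; rewrite lee_fin.
    - by apply/measurable_EFinP; meas.
    - exists [set 0]; split => //; first exact: lebesgue_measure_set1.
      move=> s /= h; apply: contrapT => /eqP s0; apply: h => _.
      by rewrite Ks.
  rewrite ge0_integralZl_real; [|by []|by meas|by move=> x; rewrite divr_ge0 ?addr_ge0 ?sqr_ge0|by []].
  congr (_ * _)%E.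
  rewrite (ge0_even_integralT (l := a * (pi / 2))).
  - by congr (_%:E); field.
  - by move=> x; rewrite divr_ge0 ?addr_ge0 ?sqr_ge0.
  - apply: derivable_continuous => x.
    have d0 : x ^+ 2 + a ^+ 2 != 0 by rewrite gt_eqF// ltr_wpDl ?sqr_ge0 ?exprn_gt0.
    exact: ex_derive.
  - by move=> x; rewrite sqrrN.
  - exact: integral0y_Lorentz.
move/(congr1 (fun x => (2^-1)%:E * x)%E); rewrite !muleA -!EFinM mulVf ?mul1r//.
by rewrite !mul1e.
Qed.

End OneMinusCosIntegral.

(** * Squared integrals against a family of functions *)

Section Tensor.
Context d1 d2 (T1 : measurableType d1) (T2 : measurableType d2) (R : realType).
Variable m1 : {sigma_finite_measure set T1 -> \bar R}.
Variable m2 : {sigma_finite_measure set T2 -> \bar R}.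
Local Open Scope ereal_scope.

Lemma measurable_tensor (f : T1 -> R) (g : T2 -> R) :
  measurable_fun setT f -> measurable_fun setT g ->
  measurable_fun setT (fun z : T1 * T2 => f z.1 * g z.2)%R.
Proof.
move=> mf mg; apply: measurable_funM.
  exact: (measurableT_comp mf measurable_fst).
exact: (measurableT_comp mg measurable_snd).
Qed.

Lemma integrable_tensor (f : T1 -> R) (g : T2 -> R) :
  m1.-integrable setT (EFin \o f) -> m2.-integrable setT (EFin \o g) ->
  (m1 \x m2).-integrable setT (fun z => (f z.1 * g z.2)%:E).
Proof.
move=> /integrableP[/measurable_EFinP mf foo] /integrableP[/measurable_EFinP mg goo].
have mfg := measurable_tensor mf mg.
apply/integrable12ltyP; first exact/measurable_EFinP.
have -> : (fun x => \int[m2]_y `|(f x * g y)%:E|) =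
    (fun x => `|(f x)%:E| * \int[m2]_y `|(g y)%:E|).
  apply/funext => x; rewrite -ge0_integralZl//.
  - by apply: eq_integral => y _; rewrite EFinM abseM.
  - by apply: measurableT_comp => //; exact/measurable_EFinP.
rewrite ge0_integralZr//; last 2 first.
- by apply: measurableT_comp => //; exact/measurable_EFinP.
- exact: integral_ge0.
rewrite -ge0_fin_numE ?mule_ge0 ?integral_ge0//.
by rewrite fin_numM// ge0_fin_numE ?integral_ge0.
Qed.

Lemma integral_tensor (f : T1 -> R) (g : T2 -> R) :
  m1.-integrable setT (EFin \o f) -> m2.-integrable setT (EFin \o g) ->
  \int[m1 \x m2]_z (f z.1 * g z.2)%:E =
    (\int[m1]_x f x * \int[m2]_y g y)%R%:E.
Proof.
move=> fi gi; rewrite -integral12_prod_meas1; last exact: integrable_tensor.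
rewrite EFinM /Rintegral !fineK; [|exact: integrable_fin_num..].
transitivity (\int[m1]_x ((f x)%:E * \int[m2]_y (g y)%:E)).
  apply: eq_integral => x _ /=; rewrite /fubini_F/= -integralZl//.
have gfin : \int[m2]_y (g y)%:E \is a fin_num by exact: integrable_fin_num.
by rewrite -(fineK gfin) integralZr.
Qed.
End Tensor.

Section GramKernel.
Context d (S : measurableType d) (R : realType).
Variable nu : {sigma_finite_measure set S -> \bar R}.
Local Notation T := (measurableTypeR R).
Local Notation m := (@lebesgue_measure R).
Local Notation m2 := (@lebesgue2 R).
Variables (F : S * T -> R) (b : S -> R) (M : R) (D : T -> R).
Hypothesis mF : measurable_fun setT F.
Hypothesis Fb : forall s x, `|F (s, x)| <= b s.
Hypothesis FM : forall x, (\int[nu]_s (F (s, x) ^+ 2)%:E <= M%:E)%E.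
Hypothesis Di : m.-integrable setT (EFin \o D).
Local Open Scope ereal_scope.

Definition gram_kernel (z : T * T) : R := (\int[nu]_s (F (s, z.1) * F (s, z.2)))%R.

Let mD : measurable_fun setT D.
Proof. by move/integrableP : Di => -[/measurable_EFinP]. Qed.

Let mFs s : measurable_fun setT (fun x => F (s, x)).
Proof. exact: (measurableT_comp mF (pair1_measurable s)). Qed.

Let mFx x : measurable_fun setT (fun s => F (s, x)).
Proof. exact: (measurableT_comp mF (pair2_measurable x)). Qed.

Lemma integrable_feature s : m.-integrable setT (EFin \o (fun x => D x * F (s, x))%R).
Proof.
apply: (@le_integrable _ _ _ _ _ _ _ (fun x => (b s)%:E * (D x)%:E)) => //.
- by apply/measurable_EFinP; exact: measurable_funM.
- move=> x _ /=; rewrite lee_fin normrM mulrC normrM ler_wpM2r//.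
  by rewrite (le_trans (Fb s x))// ler_norm.
- exact: integrableZl.
Qed.

(** By [2 |u v| <= u^2 + v^2] the uniform bound [M] on squared norms bounds the kernel;
    this is the domination that Fubini's theorem needs. *)
Lemma integral_gram_abs x y : \int[nu]_s `|(F (s, x) * F (s, y))%:E| <= M%:E.
Proof.
apply: (@le_trans _ _ (\int[nu]_s ((2^-1 * F (s, x) ^+ 2)%:E + (2^-1 * F (s, y) ^+ 2)%:E))).
  apply: ge0_le_integral => //.
  - by apply: measurableT_comp => //; apply/measurable_EFinP; exact: measurable_funM.
  - apply: emeasurable_funD; apply/measurable_EFinP;
    by apply: measurable_funM => //; exact: measurable_funX.
  - move=> s _; rewrite -EFinD /= lee_fin normrM.
    rewrite -(real_normK (num_real (F (s, x)))) -(real_normK (num_real (F (s, y)))).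
    set u := `|_|%R; set v := `|_|%R.
    have := sqr_ge0 (u - v); nra.
rewrite ge0_integralD//; last 4 first.
- by move=> s _; rewrite lee_fin mulr_ge0 ?sqr_ge0.
- by apply/measurable_EFinP; apply: measurable_funM => //; exact: measurable_funX.
- by move=> s _; rewrite lee_fin mulr_ge0 ?sqr_ge0.
- by apply/measurable_EFinP; apply: measurable_funM => //; exact: measurable_funX.
rewrite !ge0_integralZl_real//; [|exact: measurable_funX|by move=> s; exact: sqr_ge0
  |exact: measurable_funX|by move=> s; exact: sqr_ge0].
have h : (M = 2^-1 * M + 2^-1 * M)%R by lra.
by rewrite [leRHS](_ : _ = 2^-1%:E * M%:E + 2^-1%:E * M%:E) ?leeD ?lee_pmul2l// -EFinM -EFinD -h.
Qed.

Lemma integrable_gram x y : nu.-integrable setT (fun s => (F (s, x) * F (s, y))%:E).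
Proof.
apply/integrableP; split; first by apply/measurable_EFinP; exact: measurable_funM.
exact: (le_lt_trans (integral_gram_abs x y) (ltry M)).
Qed.

Let H (p : S * (T * T)) : R := (D p.2.1 * F (p.1, p.2.1) * (D p.2.2 * F (p.1, p.2.2)))%R.

Let mH : measurable_fun setT H.
Proof.
have m1 : measurable_fun setT (fun p : S * (T * T) => p.2.1).
  exact: (measurableT_comp measurable_fst measurable_snd).
have ms2 : measurable_fun setT (fun p : S * (T * T) => p.2.2).
  exact: (measurableT_comp measurable_snd measurable_snd).
apply: measurable_funM; apply: measurable_funM.
- exact: (measurableT_comp mD m1).
- by apply: (measurableT_comp mF); exact: measurable_fun_pair.
- exact: (measurableT_comp mD ms2).
- by apply: (measurableT_comp mF); exact: measurable_fun_pair.
Qed.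

Let Hi : (nu \x m2).-integrable setT (EFin \o H).
Proof.
have M0 : (0 <= M)%R.
  by rewrite -lee_fin; apply: le_trans (integral_gram_abs point point); exact: integral_ge0.
apply/(integrable21ltyP nu m2); first exact/measurable_EFinP.
have /integrableP[mDD DDoo] := integrable_tensor Di Di.
apply: (@le_lt_trans _ _ (\int[m2]_z (M%:E * `|(D z.1 * D z.2)%:E|))).
  apply: ge0_le_integral => //.
  - by move=> z _; exact: integral_ge0.
  - apply: (measurable_fun_fubini_tonelli_G (abse \o (EFin \o H))) => //=.
    by apply: measurableT_comp => //; exact/measurable_EFinP.
  - by apply: measurable_funeM; exact: measurableT_comp.
  - move=> z _ /=; rewrite /H/=.
    have -> : (fun s => (`|D z.1 * F (s, z.1) * (D z.2 * F (s, z.2))|)%:E) =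
        (fun s => (`|D z.1 * D z.2| * `|F (s, z.1) * F (s, z.2)|)%:E).
      by apply/funext => s; rewrite -normrM mulrACA.
    rewrite ge0_integralZl_real//; last first.
      by apply: measurable_fun_norm; exact: measurable_funM.
    rewrite muleC lee_wpmul2r//; exact: integral_gram_abs.
by rewrite ge0_integralZl// ?lte_mul_pinfty//; exact: measurableT_comp.
Qed.

Let HE z : \int[nu]_s (H (s, z))%:E = (D z.1 * D z.2 * gram_kernel z)%:E.
Proof.
rewrite EFinM /gram_kernel /Rintegral fineK; last first.
  by apply: integrable_fin_num => //; exact: integrable_gram.
rewrite -integralZl//; last exact: integrable_gram.
by apply: eq_integral => s _; rewrite -EFinM /H/= mulrACA.
Qed.

Lemma integrable_gram_kernel :
  m2.-integrable setT (fun z => (D z.1 * D z.2 * gram_kernel z)%:E).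
Proof.
have mG : measurable_fun setT (fun z => (D z.1 * D z.2 * gram_kernel z)%:E).
  have -> : (fun z => (D z.1 * D z.2 * gram_kernel z)%:E) =
    fubini_G nu (EFin \o H) by apply/funext => z; rewrite -HE.
  exact: measurable_fubini_G Hi.
apply: (le_integrable _ mG (g := fun z => M%:E * (D z.1 * D z.2)%:E)) => //.
- move=> z _; rewrite EFinM !abseM muleC lee_wpmul2r//.
  rewrite -[leLHS]/((`|gram_kernel z|%R)%:E).
  rewrite /gram_kernel EFin_normr_Rintegral//; last exact: integrable_gram.
  apply: le_trans.
    by apply: le_abse_integral => //; apply/measurable_EFinP; exact: measurable_funM.
  by apply: (le_trans (integral_gram_abs _ _)); rewrite lee_fin ler_norm.
- by apply: integrableZl => //; exact: integrable_tensor Di Di.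
Qed.

(** Expanding the square and exchanging the integrals leaves a quadratic form in [D]
    which sees [F] only through [gram_kernel]: two families of functions with the same
    Gram kernel give equal squared integrals. *)
Lemma integral_feature_sqr :
  \int[nu]_s ((\int[m]_x (D x * F (s, x))) ^+ 2)%R%:E =
  \int[m2]_z (D z.1 * D z.2 * gram_kernel z)%:E.
Proof.
transitivity (\int[nu]_s \int[m2]_z (H (s, z))%:E).
  apply: eq_integral => s _; rewrite expr2 -integral_tensor//;
  exact: integrable_feature.
rewrite (Fubini Hi); apply: eq_integral => z _; exact: HE.
Qed.

End GramKernel.

(** * Plancherel's inequality on the line *)

Section MeasurabilityAndLimits.
Local Open Scope ereal_scope.

(** No integrability of the slices is needed: the integral is [fine] of a difference of
    two extended-valued integrals, each measurable by Tonelli's theorem. *)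
Lemma measurable_Rintegral_snd d1 d2 (T1 : measurableType d1)
    (T2 : measurableType d2) (R : realType)
    (m2 : {sigma_finite_measure set T2 -> \bar R}) (f : T1 * T2 -> R) :
  measurable_fun setT f ->
  measurable_fun setT (fun x => \int[m2]_y f (x, y))%R.
Proof.
move=> /measurable_EFinP mf.
apply: (@measurableT_comp _ _ _ _ _ _ fine); first exact: fine_measurable.
have -> : (fun x => \int[m2]_y (f (x, y))%:E) =
    (fubini_F m2 (EFin \o f)^\+) \- (fubini_F m2 (EFin \o f)^\-).
  apply/funext => x; rewrite integralE /fubini_F/=.
  under eq_integral do rewrite (funepos_comp (EFin \o f) (pair x))/=.
  by under [X in _ - X = _]eq_integral do rewrite (funeneg_comp (EFin \o f) (pair x))/=.
apply: emeasurable_funB.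
- by apply: measurable_fun_fubini_tonelli_F => //; exact: measurable_funepos.
- by apply: measurable_fun_fubini_tonelli_F => //; exact: measurable_funeneg.
Qed.

Lemma ge0_integrable d (T : measurableType d) (R : realType)
    (m : {measure set T -> \bar R}) (f : T -> R) :
  measurable_fun setT f -> (forall x, 0 <= f x)%R ->
  \int[m]_x (f x)%:E < +oo -> m.-integrable setT (EFin \o f).
Proof.
move=> mf f0 foo; apply/integrableP; split; first exact/measurable_EFinP.
by under eq_integral do rewrite gee0_abs ?lee_fin//=.
Qed.

Lemma ae_imply d (T : measurableType d) (R : realType)
    (m : {measure set T -> \bar R}) (P Q : T -> Prop) :
  (forall x, P x -> Q x) -> {ae m, forall x, P x} -> {ae m, forall x, Q x}.
Proof.
move=> PQ [N [mN N0 PN]]; exists N; split => // x nQx.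
by apply: PN => Px; exact/nQx/PQ.
Qed.

Lemma integrableM_bounded d (T : measurableType d) (R : realType)
    (m : {measure set T -> \bar R}) (f k : T -> R) :
  m.-integrable setT (EFin \o f) -> measurable_fun setT k ->
  (forall x, `|k x| <= 1)%R ->
  m.-integrable setT (EFin \o (fun x => f x * k x)%R).
Proof.
move=> fi mk k1; apply: (le_integrable measurableT _ _ fi).
  apply/measurable_EFinP; apply: measurable_funM => //.
  by move/integrableP : fi => -[/measurable_EFinP].
by move=> x _ /=; rewrite lee_fin normrM ler_piMr.
Qed.

(** Fatou's lemma in the form in which a uniform bound on the integrals passes to an
    almost everywhere limit. *)
Lemma fatou_ae_le d (T : measurableType d) (R : realType)
    (m : {measure set T -> \bar R}) (g_ : nat -> T -> \bar R) (g : T -> \bar R)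
    (c : \bar R) :
  (forall n, measurable_fun setT (g_ n)) -> (forall n x, 0 <= g_ n x) ->
  measurable_fun setT g -> (forall x, 0 <= g x) ->
  {ae m, forall x, g_ n x @[n --> \oo] --> g x} ->
  (forall n, \int[m]_x g_ n x <= c) -> \int[m]_x g x <= c.
Proof.
move=> mg_ g_0 mg g0 [N [mN N0 gN]] gc.
rewrite (ge0_negligible_integral mN)//.
have mTN : measurable (setT `\` N) by exact: measurableD.
have -> : \int[m]_(x in setT `\` N) g x =
    \int[m]_(x in setT `\` N) limn_einf (g_ ^~ x).
  apply: eq_integral => x; rewrite inE => -[_ Nx].
  have gx : g_ n x @[n --> \oo] --> g x by apply: contrapT => h; exact: Nx (gN _ h).
  by rewrite is_cvg_limn_einfE ?(cvg_lim _ gx)//; apply/cvg_ex; exists (g x).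
apply: le_trans.
  apply: fatou => //; first by move=> n; exact: measurable_funTS.
rewrite limn_einf_lim; apply: lime_le; first exact: is_cvg_einfs.
apply: nearW => n; apply: le_trans (gc n).
rewrite [leRHS](ge0_negligible_integral mN)//.
by apply: ereal_inf_lbound; exists n => /=.
Qed.

End MeasurabilityAndLimits.

Lemma normr_sin_le (R : realType) (x : R) : `|sin x| <= `|x|.
Proof.
have h (y : R) : 0 < y -> `|sin y| <= y.
  move=> y0.
  have [|c _] := @MVT R sin cos 0 y y0 (fun z _ => is_derive_sin z).
    by apply: continuous_subspaceT; exact: continuous_sin.
  rewrite sin0 !subr0 => ->; rewrite normrM (gtr0_norm y0) ler_piMl ?(ltW y0)//.
  by rewrite norm_cos_le1.
have [x0|x0|<-] := ltgtP 0 x; last by rewrite sin0.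
  by rewrite (gtr0_norm x0) h.
by rewrite (ltr0_norm x0) -normrN -sinN h// oppr_gt0.
Qed.

Section BoxSincKernel.
Context {R : realType}.
Local Notation mu := (@lebesgue_measure R).
Variables (r : R).
Hypothesis r0 : 0 < r.

(** The second difference of [|z|] with step [2 * r]: the tent supported in [[-2 r, 2 r]],
    in a form that matches the integral of [(1 - cos (a w)) / w^2]. *)
Definition triangle (z : R) : R :=
  (`|z + 2 * r| + `|z - 2 * r| - 2 * `|z|) / (8 * r ^+ 2).

Definition box (p : plane R) : R := if `|p.1 - p.2| < r then (2 * r)^-1 else 0.

Lemma measurable_box : measurable_fun setT box.
Proof.
apply: measurable_fun_ifT => //.
by apply: measurable_fun_ltr; meas.
Qed.

(** The integrand is constant on the intersection of the intervals of radius [r] around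
    [x] and [y], whose length is a tent function of [x - y]. *)
Lemma integral_box2 (x y : R) :
  (\int[mu]_s (box (s, x) * box (s, y))%:E = (triangle (x - y))%:E)%E.
Proof.
(* the points at distance less than [r] from both [x] and [y] *)
pose A : set (measurableTypeR R) := `](Num.max x y - r), (Num.min x y + r)[%classic.
have r1 := r0.
transitivity (\int[mu]_s ((4 * r ^+ 2)^-1 * \1_A s)%:E)%E.
  apply: eq_integral => s _; congr (_%:E).
  rewrite /box/= indicE /A mem_setE in_itv/=.
  have -> : (Num.max x y - r < s < Num.min x y + r) = (`|s - x| < r) && (`|s - y| < r).
    rewrite !ltr_distl; case: (leP x y) => xy; apply/idP/idP.
    - by move=> /andP[h1 h2]; rewrite h1 h2 !andbT /=; lra.
    - by move=> /andP[/andP[h1 h2] /andP[h3 h4]]; apply/andP; split; lra.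
    - by move=> /andP[h1 h2]; rewrite h1 h2 /= ?andbT; lra.
    - by move=> /andP[/andP[h1 h2] /andP[h3 h4]]; apply/andP; split; lra.
  case: ifPn => _; case: ifPn => _ /=; rewrite ?(mulr0, mul0r, mulr1)//.
  by field; rewrite gt_eqF.
have mA : measurable A by exact: measurable_itv.
rewrite ge0_integralZl_real; [|by []|exact: measurable_indic|by []
  |by rewrite invr_ge0 mulr_ge0 ?sqr_ge0].
rewrite integral_indic// setIT /A/= lebesgue_measure_itv/= lte_fin /triangle.
case: (leP x y) => xy; case: ltP => h; rewrite -?EFinD -?EFinM ?mule0; congr (_%:E).
- rewrite (ger0_norm (_ : 0 <= x - y + 2 * r)); last by lra.
  rewrite (ler0_norm (_ : x - y - 2 * r <= 0)); last by lra.
  rewrite (ler0_norm (_ : x - y <= 0)); last by lra.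
  by field; rewrite gt_eqF.
- rewrite (ler0_norm (_ : x - y + 2 * r <= 0)); last by lra.
  rewrite (ler0_norm (_ : x - y - 2 * r <= 0)); last by lra.
  rewrite (ler0_norm (_ : x - y <= 0)); last by lra.
  by field; rewrite gt_eqF.
- rewrite (ger0_norm (_ : 0 <= x - y + 2 * r)); last by lra.
  rewrite (ler0_norm (_ : x - y - 2 * r <= 0)); last by lra.
  rewrite (ger0_norm (_ : 0 <= x - y)); last by lra.
  by field; rewrite gt_eqF.
- rewrite (ger0_norm (_ : 0 <= x - y + 2 * r)); last by lra.
  rewrite (ger0_norm (_ : 0 <= x - y - 2 * r)); last by lra.
  rewrite (ger0_norm (_ : 0 <= x - y)); last by lra.
  by field; rewrite gt_eqF.
Qed.

Variable beta : R.
Hypothesis beta0 : beta != 0.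

Definition sincf (w : R) : R := sin (r * beta * w) / (r * beta * w).

Lemma measurable_sincf : measurable_fun setT sincf.
Proof. by rewrite /sincf; meas. Qed.

Lemma sincf_norm_le1 w : `|sincf w| <= 1.
Proof.
rewrite /sincf normrM normfV; set t := r * beta * w.
have [->|t0] := eqVneq t 0; first by rewrite normr0 invr0 mulr0.
rewrite ler_pdivrMr ?normr_gt0// mul1r.
exact: normr_sin_le.
Qed.

Lemma integrable_1Bcos_divsqr (a : R) :
  mu.-integrable setT (fun w => ((1 - cos (a * w)) / w ^+ 2)%:E).
Proof.
apply/integrableP; split; first by apply/measurable_EFinP; meas.
rewrite (_ : (fun _ => _) = (fun w => ((1 - cos (a * w)) / w ^+ 2)%:E)).
  by rewrite integral_1Bcos_divsqr ltry.
apply/funext => w; rewrite gee0_abs// lee_fin.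
by rewrite divr_ge0 ?sqr_ge0// subr_ge0 cos_le1.
Qed.

(** Product-to-sum formulas reduce the squared cardinal sine to second differences of
    [(1 - cos (a w)) / w^2] in [a]. *)
Lemma sincf2_cos (z w : R) : sincf w ^+ 2 * cos (beta * z * w) =
  ((1 - cos (beta * (z + 2 * r) * w)) / w ^+ 2 +
   (1 - cos (beta * (z - 2 * r) * w)) / w ^+ 2 -
   2 * ((1 - cos (beta * z * w)) / w ^+ 2)) / (4 * (r * beta) ^+ 2).
Proof.
rewrite /sincf; have [->|w0] := eqVneq w 0.
  by rewrite !mulr0 !cos0 !subrr !mul0r sin0 !mul0r expr0n/= mulr0 !mul0r addr0 subr0 mul0r.
have -> : beta * (z + 2 * r) * w = beta * z * w + (r * beta * w) *+ 2 by ring.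
have -> : beta * (z - 2 * r) * w = beta * z * w - (r * beta * w) *+ 2 by ring.
rewrite cosD cosB cos_mulr2n.
have -> : cos (r * beta * w) ^+ 2 = 1 - sin (r * beta * w) ^+ 2 by rewrite cos2sin2.
field; rewrite beta0 w0 gt_eqF//.
Qed.

Let Ji a : mu.-integrable setT (EFin \o (fun w => (1 - cos (a * w)) / w ^+ 2)).
Proof. exact: integrable_1Bcos_divsqr. Qed.

Let Ji2 a : mu.-integrable setT (EFin \o (fun w => 2 * ((1 - cos (a * w)) / w ^+ 2))).
Proof. exact: (integrableZl _ 2 (Ji a)). Qed.

Let Ji3 a b : mu.-integrable setT
  (EFin \o (fun w => (1 - cos (a * w)) / w ^+ 2 + (1 - cos (b * w)) / w ^+ 2)).
Proof. exact: (integrableD _ (Ji a) (Ji b)). Qed.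

Lemma integrable_sincf2_cos (z : R) :
  mu.-integrable setT (fun w => (sincf w ^+ 2 * cos (beta * z * w))%:E).
Proof.
under eq_fun do rewrite sincf2_cos mulrC EFinM.
by apply: integrableZl => //; exact: (integrableB _ (Ji3 _ _) (Ji2 _)).
Qed.

(** Together with [integral_box2], this says that the box means and the damped Fourier
    transform have proportional Gram kernels. *)
Lemma Rintegral_sincf2_cos (z : R) :
  \int[mu]_w (sincf w ^+ 2 * cos (beta * z * w)) = 2 * pi / `|beta| * triangle z.
Proof.
under eq_Rintegral do rewrite sincf2_cos.
have J a : \int[mu]_w ((1 - cos (a * w)) / w ^+ 2) = pi * `|a|.
  by rewrite /Rintegral integral_1Bcos_divsqr.
rewrite RintegralZr//; last first.
  exact: (integrableB _ (Ji3 _ _) (Ji2 _)).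
rewrite RintegralB// RintegralD// RintegralZl// !J /triangle !normrM.
have : `|beta| ^+ 2 = beta ^+ 2 by rewrite real_normK ?num_real.
have : `|beta| != 0 by rewrite normr_eq0.
rewrite exprMn; move=> b0 <-; field.
by rewrite b0 gt_eqF.
Qed.

End BoxSincKernel.

Section ScalarPlancherel.
Context {R : realType}.
Local Notation mu := (@lebesgue_measure R).

Definition cos_transform (beta : R) (D : R -> R) (w : R) : R :=
  \int[mu]_x (D x * cos (beta * x * w)).
Definition sin_transform (beta : R) (D : R -> R) (w : R) : R :=
  \int[mu]_x (D x * sin (beta * x * w)).

Lemma integrable_cos_kernel (beta : R) (D : R -> R) (w : R) :
  mu.-integrable setT (EFin \o D) ->
  mu.-integrable setT (EFin \o (fun x => D x * cos (beta * x * w))).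
Proof.
move=> Di; apply: integrableM_bounded => //; first by meas.
by move=> x; exact: norm_cos_le1.
Qed.

Lemma integrable_sin_kernel (beta : R) (D : R -> R) (w : R) :
  mu.-integrable setT (EFin \o D) ->
  mu.-integrable setT (EFin \o (fun x => D x * sin (beta * x * w))).
Proof.
move=> Di; apply: integrableM_bounded => //; first by meas.
by move=> x; exact: norm_sin_le1.
Qed.

Variables (beta : R) (D : R -> R).
Hypothesis beta0 : beta != 0.
Hypothesis Di : mu.-integrable setT (EFin \o D).

Let mD : measurable_fun setT D.
Proof. by move/integrableP : Di => -[/measurable_EFinP]. Qed.

Lemma measurable_cos_transform : measurable_fun setT (cos_transform beta D).
Proof.
apply: (@measurable_Rintegral_snd _ _ (measurableTypeR R) (measurableTypeR R) R mu
  (fun p => D p.2 * cos (beta * p.2 * p.1))).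
apply: measurable_funM; first exact: (measurableT_comp mD measurable_snd).
by meas.
Qed.

Lemma measurable_sin_transform : measurable_fun setT (sin_transform beta D).
Proof.
apply: (@measurable_Rintegral_snd _ _ (measurableTypeR R) (measurableTypeR R) R mu
  (fun p => D p.2 * sin (beta * p.2 * p.1))).
apply: measurable_funM; first exact: (measurableT_comp mD measurable_snd).
by meas.
Qed.

Definition box_mean (r s : R) : R := \int[mu]_x (D x * box r (s, x)).

(** Both sides are quadratic forms in [D].  The Gram kernels of the damped cosine and sine
    families add up to the integral of [sincf^2 * cos (beta * (x - y) * w)], which is
    proportional to the tent function, the Gram kernel of the boxes. *)
Lemma integral_box_mean_sqr (r : R) : 0 < r ->
  (\int[mu]_s ((box_mean r s) ^+ 2)%:E = (`|beta| / (2 * pi))%:E *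
   \int[mu]_w (sincf r beta w ^+ 2 *
     (cos_transform beta D w ^+ 2 + sin_transform beta D w ^+ 2))%:E)%E.
Proof.
move=> r0.
pose Fc (p : plane R) := sincf r beta p.1 * cos (beta * p.2 * p.1).
pose Fs (p : plane R) := sincf r beta p.1 * sin (beta * p.2 * p.1).
have ms : measurable_fun setT (fun p : plane R => sincf r beta p.1).
  exact: (measurableT_comp (measurable_sincf r beta) measurable_fst).
have mFc : measurable_fun setT Fc by apply: measurable_funM => //; meas.
have mFs : measurable_fun setT Fs by apply: measurable_funM => //; meas.
have Fcb s x : `|Fc (s, x)| <= `|sincf r beta s|.
  by rewrite /Fc/= normrM ler_piMr// norm_cos_le1.
have Fsb s x : `|Fs (s, x)| <= `|sincf r beta s|.
  by rewrite /Fs/= normrM ler_piMr// norm_sin_le1.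
pose M := 2 * pi / `|beta| * triangle r 0.
have sinc2 : (\int[mu]_w (sincf r beta w ^+ 2)%:E = M%:E)%E.
  rewrite /M -Rintegral_sincf2_cos// /Rintegral fineK.
    by apply: eq_integral => w _; rewrite mulr0 mul0r cos0 mulr1.
  by apply: integrable_fin_num => //; exact: integrable_sincf2_cos.
have FcM x : (\int[mu]_s (Fc (s, x) ^+ 2)%:E <= M%:E)%E.
  rewrite -sinc2; apply: ge0_le_integral => //.
  - by move=> s _; rewrite lee_fin sqr_ge0.
  - apply/measurable_EFinP/measurable_funX.
    exact: (measurableT_comp mFc (pair2_measurable x)).
  - by apply/measurable_EFinP/measurable_funX; exact: measurable_sincf.
  - by move=> s _; rewrite lee_fin -(real_normK (num_real (Fc _)))
      -(real_normK (num_real (sincf _ _ _))) lerXn2r ?nnegrE.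
have FsM x : (\int[mu]_s (Fs (s, x) ^+ 2)%:E <= M%:E)%E.
  rewrite -sinc2; apply: ge0_le_integral => //.
  - by move=> s _; rewrite lee_fin sqr_ge0.
  - apply/measurable_EFinP/measurable_funX.
    exact: (measurableT_comp mFs (pair2_measurable x)).
  - by apply/measurable_EFinP/measurable_funX; exact: measurable_sincf.
  - by move=> s _; rewrite lee_fin -(real_normK (num_real (Fs _)))
      -(real_normK (num_real (sincf _ _ _))) lerXn2r ?nnegrE.
have boxb s x : `|box r (s, x)| <= (2 * r)^-1.
  rewrite /box; case: ifPn => _; first by rewrite ger0_norm// invr_ge0 mulr_ge0// ltW.
  by rewrite normr0 invr_ge0 mulr_ge0// ltW.
have boxM x : (\int[mu]_s (box r (s, x) ^+ 2)%:E <= (triangle r 0)%:E)%E.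
  by have := integral_box2 r0 x x; rewrite subrr => <-.
rewrite (integral_feature_sqr (@measurable_box _ r) boxb boxM Di).
transitivity ((`|beta| / (2 * pi))%:E *
    (\int[@lebesgue2 R]_z (D z.1 * D z.2 * gram_kernel mu Fc z)%:E +
     \int[@lebesgue2 R]_z (D z.1 * D z.2 * gram_kernel mu Fs z)%:E))%E; last first.
  congr (_ * _)%E.
  rewrite -(integral_feature_sqr mFc Fcb FcM Di) -(integral_feature_sqr mFs Fsb FsM Di).
  have cE (w : R) : \int[mu]_x (D x * Fc (w, x)) = sincf r beta w * cos_transform beta D w.
    rewrite /cos_transform -RintegralZl//; last exact: integrable_cos_kernel.
    by apply: eq_Rintegral => x _; rewrite /Fc mulrCA.
  have sE (w : R) : \int[mu]_x (D x * Fs (w, x)) = sincf r beta w * sin_transform beta D w.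
    rewrite /sin_transform -RintegralZl//; last exact: integrable_sin_kernel.
    by apply: eq_Rintegral => x _; rewrite /Fs mulrCA.
  under eq_integral do rewrite cE.
  under [X in (_ + X)%E]eq_integral do rewrite sE.
  have msf := measurable_sincf r beta.
  have mc := measurable_cos_transform. have msn := measurable_sin_transform.
  rewrite -ge0_integralD//.
  - by apply: eq_integral => w _; rewrite -EFinD mulrDr !exprMn.
  - by move=> w _; rewrite lee_fin sqr_ge0.
  - by apply/measurable_EFinP/measurable_funX; exact: measurable_funM.
  - by move=> w _; rewrite lee_fin sqr_ge0.
  - by apply/measurable_EFinP/measurable_funX; exact: measurable_funM.
have ic := integrable_gram_kernel mFc FcM Di.
have is_ := integrable_gram_kernel mFs FsM Di.
rewrite -integralD// -integralZl//; last exact: integrableD.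
apply: eq_integral => z _.
rewrite -EFinD -EFinM; congr (_%:E).
rewrite -mulrDr mulrCA; congr (_ * _).
have igc x y := integrable_gram mFc FcM x y.
have igs x y := integrable_gram mFs FsM x y.
rewrite /gram_kernel -RintegralD; [|by []|exact: igc|exact: igs].
transitivity (`|beta| / (2 * pi) *
    \int[mu]_w (sincf r beta w ^+ 2 * cos (beta * (z.1 - z.2) * w))); last first.
  congr (_ * _); apply: eq_Rintegral => w _; rewrite /Fc /Fs/=.
  have -> : beta * (z.1 - z.2) * w = beta * z.1 * w - beta * z.2 * w by ring.
  by rewrite cosB; ring.
rewrite Rintegral_sincf2_cos// /Rintegral integral_box2//=.
have pi0 : pi != 0 :> R by rewrite gt_eqF// pi_gt0.
by move: (pi : R) pi0 => p p0; field; rewrite normr_eq0 beta0 p0.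
Qed.

Lemma box_mean_average (r s : R) : 0 < r ->
  ((box_mean r s)%:E = (mu (ball s r))^-1 * \int[mu]_(x in ball s r) (D x)%:E)%E.
Proof.
move=> r0; rewrite lebesgue_measure_ball ?ltW// inver mulrn_eq0/= gt_eqF//.
have mB : measurable (ball s r : set (measurableTypeR R)) by exact: measurable_ball.
rewrite [in RHS]integral_mkcond -integralZl//; last first.
  by apply/(integrable_mkcond _ mB); exact: (integrableS measurableT mB _ Di).
rewrite /box_mean /Rintegral fineK; last first.
  apply: integrable_fin_num => //.
  apply: (le_integrable measurableT _ _ (integrableZl measurableT (2 * r)^-1 Di)).
    apply/measurable_EFinP; apply: measurable_funM => //.
    exact: (measurableT_comp (@measurable_box _ r) (pair1_measurable s)).
  move=> x _ /=; rewrite lee_fin mulrC !normrM ler_wpM2r// /box; case: ifPn => // _.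
  by rewrite normr0.
apply: eq_integral => x _; rewrite patchE /box/=.
have -> : (x \in (ball s r : set R)) = (`|s - x| < r).
  by apply/idP/idP; rewrite inE.
case: ifPn => _; last by rewrite mulr0 mule0.
by rewrite -EFinM mulrC mulr_natl.
Qed.

(** Let [r] tend to [0] in [integral_box_mean_sqr]: the means of [D] converge to [D] almost
    everywhere and [sincf^2 <= 1].  Only the inequality survives Fatou's lemma. *)
Lemma scalar_plancherel :
  (\int[mu]_x (D x ^+ 2)%:E <= (`|beta| / (2 * pi))%:E *
   \int[mu]_w (cos_transform beta D w ^+ 2 + sin_transform beta D w ^+ 2)%:E)%E.
Proof.
have r0 n : 0 < (n.+1%:R^-1 : R) by rewrite invr_gt0.
have mc := measurable_cos_transform. have msn := measurable_sin_transform.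
apply: (@fatou_ae_le _ _ _ mu (fun n x => (box_mean n.+1%:R^-1 x ^+ 2)%:E)).
- move=> n; apply/measurable_EFinP/measurable_funX.
  apply: (@measurable_Rintegral_snd _ _ (measurableTypeR R) (measurableTypeR R) R mu
    (fun p => D p.2 * box n.+1%:R^-1 p)).
  apply: measurable_funM; first exact: (measurableT_comp mD measurable_snd).
  exact: measurable_box.
- by move=> n x; rewrite lee_fin sqr_ge0.
- by apply/measurable_EFinP/measurable_funX.
- by move=> x; rewrite lee_fin sqr_ge0.
- have locD : locally_integrable setT D by exact: open_integrable_locally openT Di.
  pose E (x : R) (n : nat) := ball x (n.+1%:R^-1 : R).
  have hE x : nicely_shrinking x (E x).
    split; first by move=> n; exact: measurable_ball.
    exists (1, fun n => PosNum (r0 n)); split => /=;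
      [by []|exact: cvg_harmonic|by move=> n y|by move=> n; rewrite mul1e].
  apply: ae_imply (lebesgue_differentiation locD) => x Dx.
  have := nice_lebesgue_differentiation hE locD Dx.
  under eq_fun do rewrite -box_mean_average//.
  move=> /fine_cvgP[_] /= h; apply: cvg_EFin; first exact: nearW.
  by rewrite /comp/= expr2; under eq_fun do rewrite expr2; exact: cvgM.
- move=> n; rewrite integral_box_mean_sqr//; apply: lee_wpmul2l.
    by rewrite lee_fin divr_ge0 ?mulr_ge0 ?pi_ge0.
  apply: ge0_le_integral => //.
  + by move=> w _; rewrite lee_fin mulr_ge0 ?addr_ge0 ?sqr_ge0.
  + apply/measurable_EFinP/measurable_funM.
      by apply: measurable_funX; exact: measurable_sincf.
    by apply: measurable_funD; exact: measurable_funX.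
  + by apply/measurable_EFinP/measurable_funD; exact: measurable_funX.
  + move=> w _; rewrite lee_fin ler_piMl ?addr_ge0 ?sqr_ge0//.
    rewrite -(real_normK (num_real (sincf _ _ _))) expr_le1//.
    exact: sincf_norm_le1.
Qed.

End ScalarPlancherel.

Section ComplexTransform.
Context {R : realType}.
Local Notation mu := (@lebesgue_measure R).

Lemma Rintegral_translate (c : R) (f : R -> R) : measurable_fun setT f ->
  \int[mu]_x f (x + c) = \int[mu]_x f x.
Proof.
move=> mf; rewrite /Rintegral.
by rewrite (integral_translate c (f := EFin \o f))//; exact/measurable_EFinP.
Qed.

Lemma cos_transformN (beta : R) (D : R -> R) (w : R) :
  cos_transform beta D (- w) = cos_transform beta D w.
Proof. by apply: eq_Rintegral => x _; rewrite mulrN cosN. Qed.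

Lemma sin_transformN (beta : R) (D : R -> R) (w : R) :
  mu.-integrable setT (EFin \o D) ->
  sin_transform beta D (- w) = - sin_transform beta D w.
Proof.
move=> Di; rewrite -[RHS]mulN1r /sin_transform -RintegralZl//.
  by apply: eq_Rintegral => x _; rewrite mulrN sinN; ring.
exact: integrable_sin_kernel.
Qed.

(** Real and imaginary parts of the transform of [p + i q] against [e^(-i beta x w)]. *)
Definition fourier_re (beta : R) (p q : R -> R) (w : R) : R :=
  cos_transform beta p w + sin_transform beta q w.
Definition fourier_im (beta : R) (p q : R -> R) (w : R) : R :=
  cos_transform beta q w - sin_transform beta p w.
Definition power_spectrum (beta : R) (p q : R -> R) (w : R) : R :=
  fourier_re beta p q w ^+ 2 + fourier_im beta p q w ^+ 2.

Lemma power_spectrum_ge0 beta p q w : 0 <= power_spectrum beta p q w.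
Proof. by rewrite addr_ge0 ?sqr_ge0. Qed.

Section Pair.
Variables (beta : R) (p q : R -> R).
Hypothesis pi_ : mu.-integrable setT (EFin \o p).
Hypothesis qi_ : mu.-integrable setT (EFin \o q).

Lemma measurable_power_spectrum : measurable_fun setT (power_spectrum beta p q).
Proof.
have mcp := measurable_cos_transform beta pi_.
have msp := measurable_sin_transform beta pi_.
have mcq := measurable_cos_transform beta qi_.
have msq := measurable_sin_transform beta qi_.
apply: measurable_funD; apply: measurable_funX.
  exact: measurable_funD.
exact: measurable_funB.
Qed.

(** The cross terms of the power spectrum of [p + i q] are odd in [w].  Averaging over
    [w] and [- w] removes them and leaves the power spectra of [p] and of [q]. *)
Lemma plancherel_ineq : beta != 0 ->
  (\int[mu]_x (p x ^+ 2 + q x ^+ 2)%:E <=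
   (`|beta| / (2 * pi))%:E * \int[mu]_w (power_spectrum beta p q w)%:E)%E.
Proof.
move=> beta0.
have mcp := measurable_cos_transform beta pi_.
have msp := measurable_sin_transform beta pi_.
have mcq := measurable_cos_transform beta qi_.
have msq := measurable_sin_transform beta qi_.
have mS := measurable_power_spectrum.
have mp : measurable_fun setT p by move/integrableP : pi_ => -[/measurable_EFinP].
have mq : measurable_fun setT q by move/integrableP : qi_ => -[/measurable_EFinP].
pose Ep w := cos_transform beta p w ^+ 2 + sin_transform beta p w ^+ 2.
pose Eq w := cos_transform beta q w ^+ 2 + sin_transform beta q w ^+ 2.
have mEp : measurable_fun setT Ep by apply: measurable_funD; exact: measurable_funX.
have mEq : measurable_fun setT Eq by apply: measurable_funD; exact: measurable_funX.
have Ep0 w : 0 <= Ep w by rewrite addr_ge0 ?sqr_ge0.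
have Eq0 w : 0 <= Eq w by rewrite addr_ge0 ?sqr_ge0.
have -> : (\int[mu]_w (power_spectrum beta p q w)%:E =
    \int[mu]_w (Ep w)%:E + \int[mu]_w (Eq w)%:E)%E.
  have h : (\int[mu]_w (power_spectrum beta p q w)%:E =
      \int[mu]_w (2^-1 * power_spectrum beta p q w)%:E +
      \int[mu]_w (2^-1 * power_spectrum beta p q (- w))%:E)%E.
    rewrite (ge0_integral_reflect (f := fun w => (2^-1 * power_spectrum beta p q w)%:E)).
    - rewrite -ge0_integralD//.
      + by apply: eq_integral => w _; rewrite -EFinD; congr (_%:E); lra.
      + by move=> w _; rewrite lee_fin mulr_ge0 ?power_spectrum_ge0.
      + by apply/measurable_EFinP; exact: measurable_funM.
      + by move=> w _; rewrite lee_fin mulr_ge0 ?power_spectrum_ge0.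
      + by apply/measurable_EFinP; exact: measurable_funM.
    - by apply/measurable_EFinP; exact: measurable_funM.
    - by move=> w; rewrite lee_fin mulr_ge0 ?power_spectrum_ge0.
  rewrite h -!ge0_integralD//.
  - apply: eq_integral => w _; rewrite -!EFinD; congr (_%:E).
    rewrite /power_spectrum /fourier_re /fourier_im !cos_transformN !sin_transformN//.
    by rewrite /Ep /Eq; field.
  - by move=> w _; rewrite lee_fin.
  - exact/measurable_EFinP.
  - by move=> w _; rewrite lee_fin.
  - exact/measurable_EFinP.
  - by move=> w _; rewrite lee_fin mulr_ge0 ?power_spectrum_ge0.
  - by apply/measurable_EFinP; exact: measurable_funM.
  - by move=> w _; rewrite lee_fin mulr_ge0 ?power_spectrum_ge0.
  - apply/measurable_EFinP; apply: measurable_funM => //.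
    by apply: (measurableT_comp mS); exact: measurable_funN.
under eq_integral do rewrite EFinD.
rewrite ge0_integralD//; last 4 first.
- by move=> x _; rewrite lee_fin sqr_ge0.
- by apply/measurable_EFinP/measurable_funX.
- by move=> x _; rewrite lee_fin sqr_ge0.
- by apply/measurable_EFinP/measurable_funX.
rewrite ge0_muleDr; [|by apply: integral_ge0 => w _; rewrite lee_fin..].
by apply: leeD; exact: scalar_plancherel.
Qed.

End Pair.

Lemma transform_translate (beta t : R) (D : R -> R) (w : R) :
  mu.-integrable setT (EFin \o D) ->
  cos_transform beta (fun x => D (x + t)) w =
    cos (beta * t * w) * cos_transform beta D w + sin (beta * t * w) * sin_transform beta D w /\
  sin_transform beta (fun x => D (x + t)) w =
    cos (beta * t * w) * sin_transform beta D w - sin (beta * t * w) * cos_transform beta D w.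
Proof.
move=> Di.
have mD : measurable_fun setT D by move/integrableP : Di => -[/measurable_EFinP].
have ci := integrable_cos_kernel beta w Di.
have si := integrable_sin_kernel beta w Di.
rewrite /cos_transform /sin_transform -!RintegralZl// -RintegralD//; last 2 first.
- exact: (integrableZl _ _ ci).
- exact: (integrableZl _ _ si).
rewrite -RintegralB//; last 2 first.
- exact: (integrableZl _ _ si).
- exact: (integrableZl _ _ ci).
split.
- rewrite -(Rintegral_translate (- t)) => [|]; last first.
    apply: measurable_funM; last by meas.
    by apply: (measurableT_comp mD); meas.
  apply: eq_Rintegral => x _; rewrite subrK.
  have -> : beta * (x - t) * w = beta * x * w - beta * t * w by ring.
  by rewrite cosB; ring.
- rewrite -(Rintegral_translate (- t)) => [|]; last first.
    apply: measurable_funM; last by meas.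
    by apply: (measurableT_comp mD); meas.
  apply: eq_Rintegral => x _; rewrite subrK.
  have -> : beta * (x - t) * w = beta * x * w - beta * t * w by ring.
  by rewrite sinB; ring.
Qed.

Lemma transformD (beta : R) (D E : R -> R) (w : R) :
  mu.-integrable setT (EFin \o D) -> mu.-integrable setT (EFin \o E) ->
  cos_transform beta (fun x => D x + E x) w =
    cos_transform beta D w + cos_transform beta E w /\
  sin_transform beta (fun x => D x + E x) w =
    sin_transform beta D w + sin_transform beta E w.
Proof.
move=> Di Ei; split; rewrite -RintegralD//;
  try exact: integrable_cos_kernel; try exact: integrable_sin_kernel;
  by apply: eq_Rintegral => x _; rewrite mulrDl.
Qed.

Lemma transformB (beta : R) (D E : R -> R) (w : R) :
  mu.-integrable setT (EFin \o D) -> mu.-integrable setT (EFin \o E) ->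
  cos_transform beta (fun x => D x - E x) w =
    cos_transform beta D w - cos_transform beta E w /\
  sin_transform beta (fun x => D x - E x) w =
    sin_transform beta D w - sin_transform beta E w.
Proof.
move=> Di Ei; split; rewrite -RintegralB//;
  try exact: integrable_cos_kernel; try exact: integrable_sin_kernel;
  by apply: eq_Rintegral => x _; rewrite mulrBl.
Qed.

(** A translation multiplies the transform by a phase, and
    [|1 - e^(i y)|^2 = 2 * (1 - cos y)]. *)
Lemma power_spectrum_difference (beta t : R) (p q : R -> R) (w : R) :
  mu.-integrable setT (EFin \o p) -> mu.-integrable setT (EFin \o q) ->
  power_spectrum beta (fun x => p x - p (x + t)) (fun x => q x - q (x + t)) w =
  2 * (1 - cos (beta * t * w)) * power_spectrum beta p q w.
Proof.
move=> pi_ qi_.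
have pti := integrable_translate t pi_.
have qti := integrable_translate t qi_.
rewrite /power_spectrum /fourier_re /fourier_im.
have [-> ->] := transformB beta w pi_ pti.
have [-> ->] := transformB beta w qi_ qti.
have [-> ->] := transform_translate beta t w pi_.
have [-> ->] := transform_translate beta t w qi_.
set P := cos_transform _ _ _; set Q := cos_transform _ _ _.
set P' := sin_transform _ _ _; set Q' := sin_transform _ _ _.
have := cos2Dsin2 (beta * t * w).
move: (cos _) (sin _) => c s cs.
have -> : 2 * (1 - c) = (1 - c) ^+ 2 + s ^+ 2 by lra.
by ring.
Qed.

Lemma onem_cos_le (y : R) : 2 * (1 - cos y) <= y ^+ 2.
Proof.
have -> : y = (y / 2) *+ 2 by field.
rewrite cos_mulr2n cos2sin2.
set z := y / 2.
have h : sin z ^+ 2 <= z ^+ 2.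
  rewrite -(real_normK (num_real (sin z))) -(real_normK (num_real z)).
  by rewrite lerXn2r ?nnegrE// normr_sin_le.
nra.
Qed.
End ComplexTransform.

(** * The uncertainty principle on the line *)

Section Heisenberg1D.
Context {R : realType}.
Local Notation mu := (@lebesgue_measure R).

Lemma le0_of_le_mul (a K : R) : (forall t, 0 < t -> t <= 1 -> a <= t * K) -> a <= 0.
Proof.
move=> h; rewrite leNgt; apply/negP => a0.
have K0 : 0 < K by have := h 1 ltr01 (lexx 1); rewrite mul1r; exact: lt_le_trans.
have := h (Num.min 1 (a / (2 * K))); rewrite lt_min ltr01 divr_gt0 ?mulr_gt0//.
rewrite ge_min lexx => /(_ isT isT); apply/negP; rewrite -ltNge.
apply: (@le_lt_trans _ _ (a / (2 * K) * K)); first by rewrite ler_pM2r// ge_min lexx orbT.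
by have -> : a / (2 * K) * K = a / 2 by [field; rewrite gt_eqF|]; lra.
Qed.

Variables (beta : R) (p q : R -> R).
Hypothesis beta0 : beta != 0.
Hypothesis pi_ : mu.-integrable setT (EFin \o p).
Hypothesis qi_ : mu.-integrable setT (EFin \o q).

Let n (x : R) : R := p x ^+ 2 + q x ^+ 2.

Let n_ge0 x : 0 <= n x. Proof. by rewrite addr_ge0 ?sqr_ge0. Qed.

Let mp : measurable_fun setT p.
Proof. by move/integrableP : pi_ => -[/measurable_EFinP]. Qed.
Let mq : measurable_fun setT q.
Proof. by move/integrableP : qi_ => -[/measurable_EFinP]. Qed.
Let mn : measurable_fun setT n.
Proof. by apply: measurable_funD; exact: measurable_funX. Qed.

Let ni_of : (\int[mu]_x (n x)%:E < +oo)%E -> mu.-integrable setT (EFin \o n).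
Proof. exact: ge0_integrable. Qed.

Let x2ni_of : (\int[mu]_x (x ^+ 2 * n x)%:E < +oo)%E ->
  mu.-integrable setT (EFin \o (fun x => x ^+ 2 * n x)).
Proof.
move=> noo; apply: ge0_integrable => //.
  by apply: measurable_funM => //; meas.
by move=> x; rewrite mulr_ge0 ?sqr_ge0.
Qed.

Section Shift.
Hypothesis ni : mu.-integrable setT (EFin \o n).
Hypothesis x2ni : mu.-integrable setT (EFin \o (fun x => x ^+ 2 * n x)).
Let N := \int[mu]_x n x.
Let Y := \int[mu]_x (x * n x).
Let X := \int[mu]_x (x ^+ 2 * n x).

Let xni : mu.-integrable setT (EFin \o (fun x => x * n x)).
Proof.
apply: (le_integrable measurableT _ _ (integrableD measurableT ni x2ni)).
  by apply/measurable_EFinP; apply: measurable_funM => //; meas.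
move=> x _ /=; rewrite lee_fin normrM (ger0_norm (n_ge0 x)).
have h : 0 <= n x + x ^+ 2 * n x.
  by apply: addr_ge0 => //; apply: mulr_ge0 => //; exact: sqr_ge0.
rewrite (ger0_norm h) -[X in X + _]mul1r -mulrDl ler_wpM2r//.
rewrite -(real_normK (num_real x)); move: `|x| => a.
have := sqr_ge0 (a - 2^-1); nra.
Qed.

Let d (t x : R) : R := (p x - p (x + t)) ^+ 2 + (q x - q (x + t)) ^+ 2.

(** With [n x - n (x + t) = <g x - g (x + t), g x + g (x + t)>], this is the weighted
    inequality between the two means; the difference of the sides is a sum of squares. *)
Let shift_bound (t m x : R) : 0 < m ->
  x * (n x - n (x + t)) <= m * (x ^+ 2 * n x + x ^+ 2 * n (x + t)) + d t x / (2 * m).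
Proof.
move=> m0; rewrite /n /d.
set a := p x; set b := p (x + t); set a' := q x; set b' := q (x + t).
rewrite -subr_ge0.
have -> : m * (x ^+ 2 * (a ^+ 2 + a' ^+ 2) + x ^+ 2 * (b ^+ 2 + b' ^+ 2)) +
  ((a - b) ^+ 2 + (a' - b') ^+ 2) / (2 * m) - x * (a ^+ 2 + a' ^+ 2 - (b ^+ 2 + b' ^+ 2)) =
  ((m * x * (a + b) - (a - b)) ^+ 2 + (m * x * (a' + b') - (a' - b')) ^+ 2) / (2 * m) +
  m / 2 * x ^+ 2 * ((a - b) ^+ 2 + (a' - b') ^+ 2).
  by field; rewrite gt_eqF.
have sq2 u v : 0 <= u ^+ 2 + v ^+ 2 :> R by rewrite addr_ge0 ?sqr_ge0.
have m1 : 0 <= 2 * m by rewrite mulr_ge0// ltW.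
have m2 : 0 <= m / 2 by rewrite divr_ge0// ltW.
apply: addr_ge0; first exact: divr_ge0.
by apply: mulr_ge0 => //; apply: mulr_ge0 => //; exact: sqr_ge0.
Qed.

Let nti t : mu.-integrable setT (EFin \o (fun x => n (x + t))).
Proof. exact: integrable_translate ni. Qed.

Let ntE t : \int[mu]_x n (x + t) = N.
Proof. exact: Rintegral_translate. Qed.

Let xnt t (x : R) : x * n (x + t) = (x + t) * n (x + t) - t * n (x + t).
Proof. by ring. Qed.

Let xnti0 t : mu.-integrable setT (EFin \o (fun x => (x + t) * n (x + t))).
Proof. exact: (integrable_translate t xni). Qed.

Let tnti t : mu.-integrable setT (EFin \o (fun x => t * n (x + t))).
Proof. exact: (integrableZl measurableT t (nti t)). Qed.

Let xnti t : mu.-integrable setT (EFin \o (fun x => x * n (x + t))).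
Proof.
rewrite (_ : (fun x => x * n (x + t)) = (fun x => (x + t) * n (x + t) - t * n (x + t))).
  exact: (integrableB measurableT (xnti0 t) (tnti t)).
by apply/funext => x; rewrite xnt.
Qed.

Let xntE t : \int[mu]_x (x * n (x + t)) = Y - t * N.
Proof.
under eq_Rintegral do rewrite xnt.
rewrite RintegralB// RintegralZl// ntE.
rewrite (Rintegral_translate t (f := fun y => y * n y))//.
by apply: measurable_funM => //; meas.
Qed.

Let x2nt t (x : R) : x ^+ 2 * n (x + t) =
  (x + t) ^+ 2 * n (x + t) - (2 * t * ((x + t) * n (x + t)) - t ^+ 2 * n (x + t)).
Proof. by ring. Qed.

Let x2nti0 t : mu.-integrable setT (EFin \o (fun x => (x + t) ^+ 2 * n (x + t))).
Proof. exact: (integrable_translate t x2ni). Qed.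

Let txnti t : mu.-integrable setT
  (EFin \o (fun x => 2 * t * ((x + t) * n (x + t)) - t ^+ 2 * n (x + t))).
Proof.
exact: (integrableB measurableT (integrableZl measurableT (2 * t) (xnti0 t))
  (integrableZl measurableT (t ^+ 2) (nti t))).
Qed.

Let x2nti t : mu.-integrable setT (EFin \o (fun x => x ^+ 2 * n (x + t))).
Proof.
rewrite (_ : (fun x => x ^+ 2 * n (x + t)) =
  (fun x => (x + t) ^+ 2 * n (x + t) - (2 * t * ((x + t) * n (x + t)) - t ^+ 2 * n (x + t)))).
  exact: (integrableB measurableT (x2nti0 t) (txnti t)).
by apply/funext => x; rewrite x2nt.
Qed.

Let x2ntE t : \int[mu]_x (x ^+ 2 * n (x + t)) = X - 2 * t * Y + t ^+ 2 * N.
Proof.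
under eq_Rintegral do rewrite x2nt.
rewrite RintegralB// RintegralB//; last 2 first.
- exact: (integrableZl measurableT (2 * t) (xnti0 t)).
- exact: (integrableZl measurableT (t ^+ 2) (nti t)).
rewrite !RintegralZl// ntE.
rewrite (Rintegral_translate t (f := fun y => y * n y)); last first.
  by apply: measurable_funM => //; meas.
rewrite (Rintegral_translate t (f := fun y => y ^+ 2 * n y)); last first.
  by apply: measurable_funM => //; meas.
by rewrite -/X -/Y; ring.
Qed.

Let mpt t : measurable_fun setT (fun x : R => p (x + t)).
Proof. by apply: (measurableT_comp mp); meas. Qed.
Let mqt t : measurable_fun setT (fun x : R => q (x + t)).
Proof. by apply: (measurableT_comp mq); meas. Qed.

Let di t : mu.-integrable setT (EFin \o (d t)).
Proof.
apply: (le_integrable measurableT _ _ (integrableZl measurableT 2 (integrableD measurableT ni (nti t)))).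
  apply/measurable_EFinP; apply: measurable_funD; apply: measurable_funX.
    exact: (measurable_funB mp (mpt t)).
  exact: (measurable_funB mq (mqt t)).
move=> x _ /=; rewrite lee_fin /d /n !ger0_norm.
- have := sqr_ge0 (p x + p (x + t)); have := sqr_ge0 (q x + q (x + t)); lra.
- by rewrite mulr_ge0 ?addr_ge0 ?sqr_ge0.
- by rewrite addr_ge0 ?sqr_ge0.
Qed.

Variables (W : R).
Hypothesis WE : (\int[mu]_w (w ^+ 2 * power_spectrum beta p q w)%:E <= W%:E)%E.

(** Plancherel for the difference [g x - g (x + t)], whose power spectrum carries the
    factor [2 * (1 - cos (beta * t * w)) <= (beta * t * w)^2]. *)
Let dE t : \int[mu]_x d t x <= t ^+ 2 * (beta ^+ 2 * (`|beta| / (2 * pi)) * W).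
Proof.
rewrite -lee_fin /Rintegral fineK; last by apply: integrable_fin_num => //; exact: di.
have pti := integrable_translate t pi_.
have qti := integrable_translate t qi_.
have dpi : mu.-integrable setT (EFin \o (fun x => p x - p (x + t))).
  exact: (integrableB measurableT pi_ pti).
have dqi : mu.-integrable setT (EFin \o (fun x => q x - q (x + t))).
  exact: (integrableB measurableT qi_ qti).
apply: (le_trans (plancherel_ineq dpi dqi beta0)).
have ms := measurable_power_spectrum beta pi_ qi_.
apply: (@le_trans _ _ ((`|beta| / (2 * pi))%:E *
    ((beta * t) ^+ 2 * W)%:E)%E); last first.
  by rewrite -EFinM lee_fin le_eqVlt; apply/orP; left; apply/eqP; ring.
apply: lee_wpmul2l; first by rewrite lee_fin divr_ge0 ?mulr_ge0 ?pi_ge0.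
apply: (@le_trans _ _ (\int[mu]_w ((beta * t) ^+ 2 * (w ^+ 2 * power_spectrum beta p q w))%:E)%E).
  apply: ge0_le_integral => //.
  - by move=> w _; rewrite lee_fin power_spectrum_ge0.
  - apply/measurable_EFinP; exact: (measurable_power_spectrum beta dpi dqi).
  - apply/measurable_EFinP; apply: measurable_funM; first by meas.
    by apply: measurable_funM => //; meas.
  - move=> w _; rewrite lee_fin power_spectrum_difference// mulrA -exprMn.
    by rewrite ler_wpM2r ?power_spectrum_ge0// onem_cos_le.
rewrite ge0_integralZl_real; [|by []|by apply: measurable_funM => //; meas
  |by move=> w; rewrite mulr_ge0 ?sqr_ge0 ?power_spectrum_ge0|exact: sqr_ge0].
by rewrite [leRHS]EFinM lee_wpmul2l// lee_fin sqr_ge0.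
Qed.

(** Integrate [shift_bound] with a weight [m] proportional to [t], so that every term of
    the bound on [t * N] is of order [t]; after division by [t] the error terms are of
    order [t]. *)
Lemma heisenberg_real (lam : R) : 0 < lam ->
  N <= lam * X + lam^-1 * (beta ^+ 2 * (`|beta| / (2 * pi)) * W).
Proof.
move=> lam0; rewrite -subr_le0.
set W' := beta ^+ 2 * _ * W.
apply: (@le0_of_le_mul _ (lam * (`|Y| + N / 2))) => t t0 t1.
have N0 : 0 <= N by exact: Rintegral_ge0.
(* makes the second-moment term [t * lam * X] up to higher order, so that the last
   term becomes [t * lam^-1 * W'] *)
pose m := t * lam / 2.
have m0 : 0 < m by rewrite divr_gt0 ?mulr_gt0.
have key : t * N <= m * (X + (X - 2 * t * Y + t ^+ 2 * N)) + (t ^+ 2 * W') / (2 * m).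
  have -> : t * N = Y - (Y - t * N) by ring.
  rewrite -(xntE t) -(x2ntE t).
  apply: (@le_trans _ _ (m * (X + \int[mu]_x (x ^+ 2 * n (x + t))) +
    (\int[mu]_x d t x) / (2 * m))); last first.
    by rewrite lerD2l ler_wpM2r ?dE// invr_ge0 mulr_ge0 ?ltW.
  have i1 := integrableD measurableT x2ni (x2nti t).
  have i2 := integrableZl measurableT m i1.
  have i3 := integrableZr measurableT (2 * m)^-1 (di t).
  rewrite -RintegralB// -RintegralD// -RintegralZr// -RintegralZl//.
  rewrite -RintegralD//; apply: le_Rintegral => //.
  - exact: (integrableB measurableT xni (xnti t)).
  - exact: (integrableD measurableT i2 i3).
  - by move=> x _; rewrite -mulrBr; exact: shift_bound.
have e : (t ^+ 2 * W') / (2 * m) = t * (lam^-1 * W').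
  by rewrite /m; field; rewrite !gt_eqF.
rewrite e in key.
have key2 : N <= lam / 2 * (X + (X - 2 * t * Y + t ^+ 2 * N)) + lam^-1 * W'.
  rewrite -(ler_pM2l t0); apply: (le_trans key).
  by rewrite le_eqVlt; apply/orP; left; apply/eqP; rewrite /m; field; rewrite gt_eqF.
have hY : - Y <= `|Y| by rewrite -normrN ler_norm.
have h1 : - (t * lam) * Y <= t * lam * `|Y|.
  by rewrite mulNr -mulrN ler_wpM2l// ltW// mulr_gt0.
have h2 : t ^+ 2 * N * lam <= t * N * lam.
  by rewrite ler_wpM2r ?(ltW lam0)// ler_wpM2r// expr2 ler_piMl ?(ltW t0).
by nra.
Qed.

End Shift.

(** If one of the second moments is infinite there is nothing to prove; both enter with
    positive coefficients. *)
Lemma heisenberg_ineq (lam : R) : 0 < lam ->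
  (\int[mu]_x (n x)%:E < +oo)%E ->
  (\int[mu]_x (n x)%:E <= lam%:E * \int[mu]_x (x ^+ 2 * n x)%:E +
     (lam^-1 * (beta ^+ 2 * (`|beta| / (2 * pi))))%:E *
     \int[mu]_w (w ^+ 2 * power_spectrum beta p q w)%:E)%E.
Proof.
move=> lam0 noo.
have pig : 0 < pi :> R by exact: pi_gt0.
have c0 : 0 < lam^-1 * (beta ^+ 2 * (`|beta| / (2 * pi))).
  by rewrite mulr_gt0 ?invr_gt0// mulr_gt0 ?exprn_even_gt0// divr_gt0 ?normr_gt0 ?mulr_gt0.
have X0 : (0 <= \int[mu]_x (x ^+ 2 * n x)%:E)%E.
  by apply: integral_ge0 => x _; rewrite lee_fin mulr_ge0 ?sqr_ge0.
have W0 : (0 <= \int[mu]_w (w ^+ 2 * power_spectrum beta p q w)%:E)%E.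
  by apply: integral_ge0 => x _; rewrite lee_fin mulr_ge0 ?sqr_ge0 ?power_spectrum_ge0.
have [Xoo|] := ltP (\int[mu]_x (x ^+ 2 * n x)%:E)%E +oo%E; last first.
  rewrite leye_eq => /eqP ->; rewrite gt0_muley ?lte_fin// addye ?leey//.
  by rewrite gt_eqF// (lt_le_trans ltNy0)// mule_ge0// lee_fin ltW.
have [Woo|] := ltP (\int[mu]_w (w ^+ 2 * power_spectrum beta p q w)%:E)%E +oo%E; last first.
  rewrite leye_eq => /eqP ->; rewrite gt0_muley ?lte_fin// addey ?leey//.
  by rewrite gt_eqF// (lt_le_trans ltNy0)// mule_ge0// lee_fin ltW.
have ni := ni_of noo; have x2ni := x2ni_of Xoo.
have Wfin : (\int[mu]_w (w ^+ 2 * power_spectrum beta p q w)%:E \is a fin_num)%E.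
  by rewrite ge0_fin_numE.
have := heisenberg_real ni x2ni
  (W := fine (\int[mu]_w (w ^+ 2 * power_spectrum beta p q w)%:E)%E) _ lam0.
rewrite fineK// => /(_ (lexx _)).
have Nfin : (\int[mu]_x (n x)%:E)%E \is a fin_num.
  by rewrite ge0_fin_numE//; apply: integral_ge0 => x _; rewrite lee_fin.
have Xfin : (\int[mu]_x (x ^+ 2 * n x)%:E)%E \is a fin_num by rewrite ge0_fin_numE.
rewrite -lee_fin EFinD !EFinM /Rintegral (fineK Nfin) (fineK Xfin) (fineK Wfin).
by rewrite !muleA.
Qed.

End Heisenberg1D.

(** * Slices of the plane *)

Section IteratedIntegrals.
Context {R : realType}.
Local Notation mu := (@lebesgue_measure R).
Local Notation mu2 := (@lebesgue2 R).
Local Open Scope ereal_scope.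

Lemma measurable_Rintegral_fst (f : plane R -> R) : measurable_fun setT f ->
  measurable_fun setT (fun y => \int[mu]_x f (x, y))%R.
Proof.
move=> mf; apply: (@measurable_Rintegral_snd _ _ (measurableTypeR R) (measurableTypeR R) R mu
  (fun p => f (p.2, p.1))).
by apply: (measurableT_comp mf); exact: measurable_fun_pair.
Qed.

Lemma lee_fine_abs (e : \bar R) : `|(fine e)%:E| <= `|e|.
Proof. by case: e => [r||] //=; rewrite normr0 ?leey. Qed.

Lemma integrable_Rintegral_fst (f : plane R -> R) :
  mu2.-integrable setT (EFin \o f) ->
  mu.-integrable setT (EFin \o (fun y => \int[mu]_x f (x, y)))%R.
Proof.
move=> fi; have /integrableP[mf _] := fi.
have mfr : measurable_fun setT f by exact/measurable_EFinP.
apply/integrableP; split.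
  by apply/measurable_EFinP; exact: measurable_Rintegral_fst.
apply: le_lt_trans ((integrable21ltyP mu mu mf).1 fi).
apply: ge0_le_integral => //.
- apply: measurableT_comp => //; apply/measurable_EFinP.
  exact: measurable_Rintegral_fst.
- apply: (measurable_fun_fubini_tonelli_G (abse \o (EFin \o f))) => //=.
  exact: measurableT_comp.
- move=> y _ /=; apply: (le_trans (lee_fine_abs _)).
  apply: le_abse_integral => //.
  exact: (measurableT_comp mf (pair2_measurable y)).
Qed.

Lemma Rintegral_iterated (f : plane R -> R) :
  mu2.-integrable setT (EFin \o f) ->
  (\int[mu]_y \int[mu]_x f (x, y) = \int[mu2]_z f z)%R.
Proof.
move=> fi; have /integrableP[mf _] := fi.
have mfr : measurable_fun setT f by exact/measurable_EFinP.
rewrite {1 3}/Rintegral -(integral21_prod_meas1 fi); congr fine.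
apply: ae_eq_integral => //.
- by apply/measurable_EFinP; exact: measurable_Rintegral_fst.
- exact: measurable_fubini_G fi.
- apply: ae_imply (ae_integrable2 fi) => y yi _; rewrite /Rintegral fineK//.
  exact: integrable_fin_num.
Qed.

(** Fubini's theorem for kernels of product type.  The inner integral may be undefined on
    a null set of slices, where it takes a default value; hence the almost everywhere
    comparison. *)
Lemma Rintegral_kernel2 (p : plane R -> R) (k1 k2 : R -> R) :
  mu2.-integrable setT (EFin \o p) ->
  measurable_fun setT k1 -> (forall x, `|k1 x| <= 1)%R ->
  measurable_fun setT k2 -> (forall x, `|k2 x| <= 1)%R ->
  (\int[mu]_y ((\int[mu]_x (p (x, y) * k1 x)) * k2 y) =
   \int[mu2]_z (p z * k1 z.1 * k2 z.2))%R.
Proof.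
move=> pi_ mk1 k11 mk2 k21.
have i1 : mu2.-integrable setT (EFin \o (fun z => p z * k1 z.1)%R).
  apply: integrableM_bounded => //; exact: (measurableT_comp mk1 measurable_fst).
have i2 : mu2.-integrable setT (EFin \o (fun z => p z * k1 z.1 * k2 z.2)%R).
  apply: integrableM_bounded => //; exact: (measurableT_comp mk2 measurable_snd).
have /integrableP[/measurable_EFinP m1 _] := i1.
have /integrableP[/measurable_EFinP m2 _] := i2.
rewrite -(Rintegral_iterated i2) /Rintegral; congr fine.
apply: ae_eq_integral => //.
- apply/measurable_EFinP; apply: measurable_funM => //.
  exact: (measurable_Rintegral_fst m1).
- by apply/measurable_EFinP; exact: (measurable_Rintegral_fst m2).
- by apply: ae_imply (ae_integrable2 i1) => y yi _; congr (_%:E);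
  exact: (esym (RintegralZr (k2 y) measurableT yi)).
Qed.

End IteratedIntegrals.

Section PartialTransform.
Context {R : realType}.
Local Notation mu := (@lebesgue_measure R).
Local Notation mu2 := (@lebesgue2 R).
Local Open Scope ereal_scope.

Variables (beta : R) (p q : plane R -> R).
Hypothesis pi_ : mu2.-integrable setT (EFin \o p).
Hypothesis qi_ : mu2.-integrable setT (EFin \o q).

Definition slice (f : plane R -> R) (y x : R) : R := f (x, y).

Let mp : measurable_fun setT p.
Proof. by move/integrableP : pi_ => -[/measurable_EFinP]. Qed.
Let mq : measurable_fun setT q.
Proof. by move/integrableP : qi_ => -[/measurable_EFinP]. Qed.

Lemma measurable_partial_cos (f : plane R -> R) : measurable_fun setT f ->
  measurable_fun setT (fun z : plane R => cos_transform beta (slice f z.2) z.1).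
Proof.
move=> mf; apply: (@measurable_Rintegral_snd _ _ (plane R) (measurableTypeR R) R mu
  (fun t => f (t.2, t.1.2) * cos (beta * t.2 * t.1.1))%R).
apply: measurable_funM; last by meas.
by apply: (measurableT_comp mf); apply: measurable_fun_pair => //; meas.
Qed.

Lemma measurable_partial_sin (f : plane R -> R) : measurable_fun setT f ->
  measurable_fun setT (fun z : plane R => sin_transform beta (slice f z.2) z.1).
Proof.
move=> mf; apply: (@measurable_Rintegral_snd _ _ (plane R) (measurableTypeR R) R mu
  (fun t => f (t.2, t.1.2) * sin (beta * t.2 * t.1.1))%R).
apply: measurable_funM; last by meas.
by apply: (measurableT_comp mf); apply: measurable_fun_pair => //; meas.
Qed.

Lemma measurable_partial_spectrum : measurable_fun setT
  (fun z : plane R => power_spectrum beta (slice p z.2) (slice q z.2) z.1).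
Proof.
have mcp := measurable_partial_cos mp. have msp := measurable_partial_sin mp.
have mcq := measurable_partial_cos mq. have msq := measurable_partial_sin mq.
apply: measurable_funD; apply: measurable_funX.
  exact: measurable_funD.
exact: measurable_funB.
Qed.

Variables (lam : R) (sigma : R -> R).
Hypothesis lam0 : (0 <= lam)%R.
Hypothesis sigma0 : (forall w, 0 <= sigma w)%R.
Hypothesis msigma : measurable_fun setT sigma.

Hypothesis ineq1D : forall p q : R -> R,
  mu.-integrable setT (EFin \o p) -> mu.-integrable setT (EFin \o q) ->
  \int[mu]_x (p x ^+ 2 + q x ^+ 2)%:E < +oo ->
  \int[mu]_x (p x ^+ 2 + q x ^+ 2)%:E <=
    lam%:E * \int[mu]_x (x ^+ 2 * (p x ^+ 2 + q x ^+ 2))%:E +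
    \int[mu]_w (sigma w * power_spectrum beta p q w)%:E.

Hypothesis pq_fin : \int[mu2]_x (p x ^+ 2 + q x ^+ 2)%:E < +oo.

Let n x : R := (p x ^+ 2 + q x ^+ 2)%R.
Let n_ge0 x : (0 <= n x)%R. Proof. by rewrite addr_ge0 ?sqr_ge0. Qed.
Let mn : measurable_fun setT n.
Proof. by apply: measurable_funD; exact: measurable_funX. Qed.

(** Almost every slice of [p + i q] is integrable with finite mass, so that the inequality
    on the line can be integrated over the slices.  It is kept abstract, with spectral
    weight [sigma], because both the uncertainty principle and Plancherel's inequality
    (the case [lam = 0]) are used. *)
Lemma partial_transform_ineq :
  \int[mu2]_x (p x ^+ 2 + q x ^+ 2)%:E <=
    lam%:E * \int[mu2]_x (x.1 ^+ 2 * (p x ^+ 2 + q x ^+ 2))%:E +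
    \int[mu]_w \int[mu]_y
      (sigma w * power_spectrum beta (slice p y) (slice q y) w)%:E.
Proof.
have ni : mu2.-integrable setT (EFin \o n) by exact: ge0_integrable.
have mx2n : measurable_fun setT (fun x : plane R => x.1 ^+ 2 * n x)%R.
  by apply: measurable_funM => //; meas.
have x2n0 (x : plane R) : (0 <= x.1 ^+ 2 * n x)%R by apply: mulr_ge0 => //; exact: sqr_ge0.
have msp : measurable_fun setT (fun z : plane R =>
    sigma z.1 * power_spectrum beta (slice p z.2) (slice q z.2) z.1)%R.
  apply: measurable_funM; last exact: measurable_partial_spectrum.
  exact: (measurableT_comp msigma measurable_fst).
have sp0 (z : plane R) : (0 <= sigma z.1 * power_spectrum beta (slice p z.2) (slice q z.2) z.1)%R.
  by apply: mulr_ge0 => //; exact: power_spectrum_ge0.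
rewrite -[leLHS]/(\int[mu \x mu]_x (n x)%:E).
rewrite -[X in _ * X]/(\int[mu \x mu]_x (x.1 ^+ 2 * n x)%:E).
rewrite (fubini_tonelli2 (EFin \o n)); [|exact/measurable_EFinP|by move=> x; rewrite lee_fin].
rewrite (fubini_tonelli2 (fun x : plane R => (x.1 ^+ 2 * n x)%:E));
  [|exact/measurable_EFinP|by move=> x; rewrite lee_fin].
rewrite (fubini_tonelli (fun z : plane R =>
    (sigma z.1 * power_spectrum beta (slice p z.2) (slice q z.2) z.1)%:E));
  [|exact/measurable_EFinP|by move=> x; rewrite lee_fin].
have mX : measurable_fun setT (fubini_G mu (fun x : plane R => (x.1 ^+ 2 * n x)%:E)).
  apply: measurable_fun_fubini_tonelli_G; [exact/measurable_EFinP|by move=> x; rewrite lee_fin].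
have mW : measurable_fun setT (fun y => \int[mu]_w
    (sigma w * power_spectrum beta (slice p y) (slice q y) w)%:E).
  apply: (measurable_fun_fubini_tonelli_G (fun z : plane R =>
    (sigma z.1 * power_spectrum beta (slice p z.2) (slice q z.2) z.1)%:E));
  [exact/measurable_EFinP|by move=> x; rewrite lee_fin].
have X0 y : 0 <= fubini_G mu (fun x : plane R => (x.1 ^+ 2 * n x)%:E) y.
  by apply: integral_ge0 => x _; rewrite lee_fin.
have W0 y : 0 <= \int[mu]_w (sigma w * power_spectrum beta (slice p y) (slice q y) w)%:E.
  by apply: integral_ge0 => w _; rewrite lee_fin; exact: (sp0 (w, y)).
rewrite -ge0_integralZl//.
rewrite -ge0_integralD; [|by []|by move=> y _; apply: mule_ge0 => //; rewrite lee_fin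
  |exact: measurable_funeM|by move=> y _; exact: W0|exact: mW].
have [Np [mNp Np0 Npi]] := ae_integrable2 pi_.
have [Nq [mNq Nq0 Nqi]] := ae_integrable2 qi_.
have [Nn [mNn Nn0 Nni]] := ae_integrable2 ni.
apply: ae_ge0_le_integral => //.
- by move=> y _; apply: integral_ge0 => x _; rewrite lee_fin.
- apply: (measurable_fun_fubini_tonelli_G (EFin \o n));
  [exact/measurable_EFinP|by move=> x; rewrite lee_fin].
- by move=> y _; apply: adde_ge0; [apply: mule_ge0 => //; rewrite lee_fin|exact: W0].
- by apply: emeasurable_funD; [exact: measurable_funeM|exact: mW].
exists (Np `|` Nq `|` Nn); split.
- by apply: measurableU => //; exact: measurableU.
- by apply: null_set_setU => //; [exact: measurableU|exact: null_set_setU].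
move=> y /= h; apply: contrapT => /not_orP[/not_orP[yp yq] yn]; apply: h => _.
have ypi : mu.-integrable setT (EFin \o slice p y) by apply: contrapT => h; exact: yp (Npi _ h).
have yqi : mu.-integrable setT (EFin \o slice q y) by apply: contrapT => h; exact: yq (Nqi _ h).
have yni : mu.-integrable setT (EFin \o slice n y) by apply: contrapT => h; exact: yn (Nni _ h).
apply: (ineq1D ypi yqi).
move/integrableP : yni => -[_]; apply: le_lt_trans.
rewrite le_eqVlt; apply/orP; left; apply/eqP.
by apply: eq_integral => x _; rewrite gee0_abs// lee_fin; exact: n_ge0.
Qed.

End PartialTransform.

(** * The two-sided quaternion Fourier transform *)

Section QuaternionFourier.
Context {R : realType}.
Local Notation H := (quaternion R).
Local Notation mu := (@lebesgue_measure R).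
Local Notation mu2 := (@lebesgue2 R).

(** The squared modulus as a polynomial, without the square root of [qnorm]. *)
Definition nsq (q : H) : R := qre q ^+ 2 + qi q ^+ 2 + qj q ^+ 2 + qk q ^+ 2.

Lemma nsq_ge0 q : 0 <= nsq q.
Proof. by rewrite !addr_ge0 ?sqr_ge0. Qed.

Lemma qnorm_sqr (q : H) : qnorm q ^+ 2 = nsq q.
Proof. by rewrite /qnorm mulq_conj /= sqr_sqrtr// nsq_ge0. Qed.

Lemma nsqM (p q : H) : nsq (p * q) = nsq p * nsq q.
Proof. by case: p => a b c d; case: q => a' b' c' d'; rewrite /nsq /=; ring. Qed.

Definition qintegrable (g : plane R -> H) : Prop :=
  [/\ mu2.-integrable setT (EFin \o (fun x => qre (g x))),
      mu2.-integrable setT (EFin \o (fun x => qi (g x))),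
      mu2.-integrable setT (EFin \o (fun x => qj (g x))) &
      mu2.-integrable setT (EFin \o (fun x => qk (g x)))].

Definition qft (b1 b2 : R) (g : plane R -> H) (w : plane R) : H :=
  qintegral (fun x => expi (- (b1 * x.1 * w.1)) * g x * expj (- (b2 * x.2 * w.2))).

Lemma integral_lin4 (f1 f2 f3 f4 : plane R -> R) (e1 e2 e3 e4 : R) :
  mu2.-integrable setT (EFin \o f1) -> mu2.-integrable setT (EFin \o f2) ->
  mu2.-integrable setT (EFin \o f3) -> mu2.-integrable setT (EFin \o f4) ->
  mu2.-integrable setT
    (EFin \o (fun z => e1 * f1 z + e2 * f2 z + e3 * f3 z + e4 * f4 z)) /\
  \int[mu2]_z (e1 * f1 z + e2 * f2 z + e3 * f3 z + e4 * f4 z) =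
  e1 * \int[mu2]_z f1 z + e2 * \int[mu2]_z f2 z +
  e3 * \int[mu2]_z f3 z + e4 * \int[mu2]_z f4 z.
Proof.
move=> i1 i2 i3 i4.
have z1 := integrableZl measurableT e1 i1.
have z2 := integrableZl measurableT e2 i2.
have z3 := integrableZl measurableT e3 i3.
have z4 := integrableZl measurableT e4 i4.
have s2 := integrableD measurableT z1 z2.
have s3 := integrableD measurableT s2 z3.
have s4 := integrableD measurableT s3 z4.
by split=> //; rewrite RintegralD// RintegralD// RintegralD// !RintegralZl.
Qed.

Section Spectrum.
Variables (b1 b2 : R) (g : plane R -> H).
Hypothesis gi : qintegrable g.

Let a x := qre (g x).
Let b x := qi (g x).
Let c x := qj (g x).
Let d x := qk (g x).
Let ai : mu2.-integrable setT (EFin \o a). Proof. by case: gi. Qed.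
Let bi : mu2.-integrable setT (EFin \o b). Proof. by case: gi. Qed.
Let ci : mu2.-integrable setT (EFin \o c). Proof. by case: gi. Qed.
Let di : mu2.-integrable setT (EFin \o d). Proof. by case: gi. Qed.

Let integrable_cos_slice p w1 : mu2.-integrable setT (EFin \o p) ->
  mu.-integrable setT (EFin \o (fun y => cos_transform b1 (slice p y) w1)).
Proof.
move=> pint.
apply: (integrable_Rintegral_fst (f := fun z => p z * cos (b1 * z.1 * w1))).
apply: integrableM_bounded => //; first by meas.
by move=> z; exact: norm_cos_le1.
Qed.

Let integrable_sin_slice p w1 : mu2.-integrable setT (EFin \o p) ->
  mu.-integrable setT (EFin \o (fun y => sin_transform b1 (slice p y) w1)).
Proof.
move=> pint.
apply: (integrable_Rintegral_fst (f := fun z => p z * sin (b1 * z.1 * w1))).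
apply: integrableM_bounded => //; first by meas.
by move=> z; exact: norm_sin_le1.
Qed.

Lemma integrable_fourier_re_slice p q w1 :
  mu2.-integrable setT (EFin \o p) -> mu2.-integrable setT (EFin \o q) ->
  mu.-integrable setT (EFin \o (fun y => fourier_re b1 (slice p y) (slice q y) w1)).
Proof.
move=> pint qint.
exact: (integrableD measurableT (integrable_cos_slice w1 pint) (integrable_sin_slice w1 qint)).
Qed.

Lemma integrable_fourier_im_slice p q w1 :
  mu2.-integrable setT (EFin \o p) -> mu2.-integrable setT (EFin \o q) ->
  mu.-integrable setT (EFin \o (fun y => fourier_im b1 (slice p y) (slice q y) w1)).
Proof.
move=> pint qint.
exact: (integrableB measurableT (integrable_cos_slice w1 qint) (integrable_sin_slice w1 pint)).
Qed.

Let I (p : plane R -> R) (k1 k2 : R -> R) (w : plane R) : R :=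
  \int[mu2]_z (p z * k1 (b1 * z.1 * w.1) * k2 (b2 * z.2 * w.2)).

Let mk_cos beta (w : R) : measurable_fun setT (fun x : R => cos (beta * x * w)).
Proof. by meas. Qed.
Let mk_sin beta (w : R) : measurable_fun setT (fun x : R => sin (beta * x * w)).
Proof. by meas. Qed.

Let CC p w : mu2.-integrable setT (EFin \o p) ->
  cos_transform b2 (fun y => cos_transform b1 (slice p y) w.1) w.2 = I p cos cos w.
Proof.
move=> pint; apply: (Rintegral_kernel2 pint (mk_cos b1 w.1) _ (mk_cos b2 w.2)) => x;
exact: norm_cos_le1.
Qed.
Let SC p w : mu2.-integrable setT (EFin \o p) ->
  cos_transform b2 (fun y => sin_transform b1 (slice p y) w.1) w.2 = I p sin cos w.
Proof.
move=> pint; apply: (Rintegral_kernel2 pint (mk_sin b1 w.1) _ (mk_cos b2 w.2)) => x;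
[exact: norm_sin_le1|exact: norm_cos_le1].
Qed.
Let CS p w : mu2.-integrable setT (EFin \o p) ->
  sin_transform b2 (fun y => cos_transform b1 (slice p y) w.1) w.2 = I p cos sin w.
Proof.
move=> pint; apply: (Rintegral_kernel2 pint (mk_cos b1 w.1) _ (mk_sin b2 w.2)) => x;
[exact: norm_cos_le1|exact: norm_sin_le1].
Qed.
Let SS p w : mu2.-integrable setT (EFin \o p) ->
  sin_transform b2 (fun y => sin_transform b1 (slice p y) w.1) w.2 = I p sin sin w.
Proof.
move=> pint; apply: (Rintegral_kernel2 pint (mk_sin b1 w.1) _ (mk_sin b2 w.2)) => x;
exact: norm_sin_le1.
Qed.

Let Ii (p : plane R -> R) (k1 k2 : R -> R) w : mu2.-integrable setT (EFin \o p) ->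
  (k1 = cos \/ k1 = sin) -> (k2 = cos \/ k2 = sin) ->
  mu2.-integrable setT (EFin \o (fun z => p z * k1 (b1 * z.1 * w.1) * k2 (b2 * z.2 * w.2))).
Proof.
move=> pint h1 h2.
have i1 : mu2.-integrable setT (EFin \o (fun z => p z * k1 (b1 * z.1 * w.1))).
  apply: integrableM_bounded => //; first by case: h1 => ->; meas.
  by move=> z; case: h1 => ->; rewrite ?norm_cos_le1 ?norm_sin_le1.
apply: integrableM_bounded => //; first by case: h2 => ->; meas.
by move=> z; case: h2 => ->; rewrite ?norm_cos_le1 ?norm_sin_le1.
Qed.

Let RE p q w : mu2.-integrable setT (EFin \o p) -> mu2.-integrable setT (EFin \o q) ->
  cos_transform b2 (fun y => fourier_re b1 (slice p y) (slice q y) w.1) w.2 =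
    I p cos cos w + I q sin cos w /\
  sin_transform b2 (fun y => fourier_re b1 (slice p y) (slice q y) w.1) w.2 =
    I p cos sin w + I q sin sin w.
Proof.
move=> pint qint.
have [h1 h2] := transformD b2 w.2 (integrable_cos_slice w.1 pint) (integrable_sin_slice w.1 qint).
by rewrite -CC// -SC// -CS// -SS.
Qed.

Let IM p q w : mu2.-integrable setT (EFin \o p) -> mu2.-integrable setT (EFin \o q) ->
  cos_transform b2 (fun y => fourier_im b1 (slice p y) (slice q y) w.1) w.2 =
    I q cos cos w - I p sin cos w /\
  sin_transform b2 (fun y => fourier_im b1 (slice p y) (slice q y) w.1) w.2 =
    I q cos sin w - I p sin sin w.
Proof.
move=> pint qint.
have [h1 h2] := transformB b2 w.2 (integrable_cos_slice w.1 qint) (integrable_sin_slice w.1 pint).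
by rewrite -CC// -SC// -CS// -SS.
Qed.

Lemma qft_components w :
  [/\ qre (qft b1 b2 g w) = I a cos cos w + I b sin cos w + I c cos sin w + I d sin sin w,
      qi (qft b1 b2 g w) = I b cos cos w - I a sin cos w + I d cos sin w - I c sin sin w,
      qj (qft b1 b2 g w) = I c cos cos w + I d sin cos w - I a cos sin w - I b sin sin w &
      qk (qft b1 b2 g w) = I d cos cos w - I c sin cos w - I b cos sin w + I a sin sin w].
Proof.
have hc : @cos R = cos \/ @cos R = sin by left.
have hs : @sin R = cos \/ @sin R = sin by right.
have icc p (h : mu2.-integrable setT (EFin \o p)) := Ii w h hc hc.
have isc p (h : mu2.-integrable setT (EFin \o p)) := Ii w h hs hc.
have ics p (h : mu2.-integrable setT (EFin \o p)) := Ii w h hc hs.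
have iss p (h : mu2.-integrable setT (EFin \o p)) := Ii w h hs hs.
split.
- transitivity (1 * I a cos cos w + 1 * I b sin cos w + 1 * I c cos sin w + 1 * I d sin sin w);
    last by ring.
  rewrite /I -(integral_lin4 1 1 1 1 (icc _ ai) (isc _ bi) (ics _ ci) (iss _ di)).2.
  by apply: eq_Rintegral => x _ /=; rewrite /a /b /c /d !(cosN, sinN); ring.
- transitivity (1 * I b cos cos w + (-1) * I a sin cos w + 1 * I d cos sin w + (-1) * I c sin sin w);
    last by ring.
  rewrite /I -(integral_lin4 1 (-1) 1 (-1) (icc _ bi) (isc _ ai) (ics _ di) (iss _ ci)).2.
  by apply: eq_Rintegral => x _ /=; rewrite /a /b /c /d !(cosN, sinN); ring.
- transitivity (1 * I c cos cos w + 1 * I d sin cos w + (-1) * I a cos sin w + (-1) * I b sin sin w);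
    last by ring.
  rewrite /I -(integral_lin4 1 1 (-1) (-1) (icc _ ci) (isc _ di) (ics _ ai) (iss _ bi)).2.
  by apply: eq_Rintegral => x _ /=; rewrite /a /b /c /d !(cosN, sinN); ring.
- transitivity (1 * I d cos cos w + (-1) * I c sin cos w + (-1) * I b cos sin w + 1 * I a sin sin w);
    last by ring.
  rewrite /I -(integral_lin4 1 (-1) (-1) 1 (icc _ di) (isc _ ci) (ics _ bi) (iss _ ai)).2.
  by apply: eq_Rintegral => x _ /=; rewrite /a /b /c /d !(cosN, sinN); ring.
Qed.

(** The left kernel turns [(a + i b) + (c + i d) j] into [(Re + i Im) + (Re' + i Im') j],
    which is [(Re + Re' j) + i (Im + Im' j)]; the right kernel acts separately on these
    two complex numbers in [j]. *)
Lemma nsq_qft w : nsq (qft b1 b2 g w) =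
  power_spectrum b2 (fun y => fourier_re b1 (slice a y) (slice b y) w.1)
    (fun y => fourier_re b1 (slice c y) (slice d y) w.1) w.2 +
  power_spectrum b2 (fun y => fourier_im b1 (slice a y) (slice b y) w.1)
    (fun y => fourier_im b1 (slice c y) (slice d y) w.1) w.2.
Proof.
have [h1 h2 h3 h4] := qft_components w.
rewrite /nsq h1 h2 h3 h4.
have [ab1 ab2] := RE w ai bi; have [cd1 cd2] := RE w ci di.
have [ab3 ab4] := IM w ai bi; have [cd3 cd4] := IM w ci di.
rewrite /power_spectrum /(fourier_re b2) /(fourier_im b2).
rewrite ab1 ab2 ab3 ab4 cd1 cd2 cd3 cd4.
by ring.
Qed.

Let measurable_I p k1 k2 : mu2.-integrable setT (EFin \o p) ->
  measurable_fun setT k1 -> measurable_fun setT k2 -> measurable_fun setT (I p k1 k2).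
Proof.
move=> /integrableP[/measurable_EFinP mp _] mk1 mk2.
apply: (@measurable_Rintegral_snd _ _ (plane R) (plane R) R mu2
  (fun t => p t.2 * k1 (b1 * t.2.1 * t.1.1) * k2 (b2 * t.2.2 * t.1.2))).
apply: measurable_funM; first apply: measurable_funM.
- exact: (measurableT_comp mp measurable_snd).
- by apply: (measurableT_comp mk1); meas.
- by apply: (measurableT_comp mk2); meas.
Qed.

Lemma measurable_nsq_qft : measurable_fun setT (fun w => nsq (qft b1 b2 g w)).
Proof.
have mc : measurable_fun setT (@cos R) by apply: continuous_measurable_fun; exact: continuous_cos.
have ms : measurable_fun setT (@sin R) by apply: continuous_measurable_fun; exact: continuous_sin.
have -> : (fun w => nsq (qft b1 b2 g w)) = (fun w =>
  (I a cos cos w + I b sin cos w + I c cos sin w + I d sin sin w) ^+ 2 +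
  (I b cos cos w - I a sin cos w + I d cos sin w - I c sin sin w) ^+ 2 +
  (I c cos cos w + I d sin cos w - I a cos sin w - I b sin sin w) ^+ 2 +
  (I d cos cos w - I c sin cos w - I b cos sin w + I a sin sin w) ^+ 2).
  apply/funext => w; have [h1 h2 h3 h4] := qft_components w.
  by rewrite /nsq h1 h2 h3 h4.
have J p (pint : mu2.-integrable setT (EFin \o p)) :
    [/\ measurable_fun setT (I p cos cos), measurable_fun setT (I p sin cos),
        measurable_fun setT (I p cos sin) & measurable_fun setT (I p sin sin)].
  by split; exact: measurable_I.
have [? ? ? ?] := J _ ai. have [? ? ? ?] := J _ bi.
have [? ? ? ?] := J _ ci. have [? ? ? ?] := J _ di.
by meas.
Qed.

Variables (lam : R) (sigma : R -> R).
Hypothesis lam0 : 0 <= lam.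
Hypothesis sigma0 : forall w, 0 <= sigma w.
Hypothesis msigma : measurable_fun setT sigma.
Hypothesis b2_neq0 : b2 != 0.
Local Open Scope ereal_scope.
Hypothesis ineq1D : forall p q : R -> R,
  mu.-integrable setT (EFin \o p) -> mu.-integrable setT (EFin \o q) ->
  \int[mu]_x (p x ^+ 2 + q x ^+ 2)%:E < +oo ->
  \int[mu]_x (p x ^+ 2 + q x ^+ 2)%:E <=
    lam%:E * \int[mu]_x (x ^+ 2 * (p x ^+ 2 + q x ^+ 2))%:E +
    \int[mu]_w (sigma w * power_spectrum b1 p q w)%:E.
Hypothesis g_fin : \int[mu2]_x (nsq (g x))%:E < +oo.

Let ma : measurable_fun setT a. Proof. by case/integrableP : ai => /measurable_EFinP. Qed.
Let mb : measurable_fun setT b. Proof. by case/integrableP : bi => /measurable_EFinP. Qed.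
Let mc : measurable_fun setT c. Proof. by case/integrableP : ci => /measurable_EFinP. Qed.
Let md : measurable_fun setT d. Proof. by case/integrableP : di => /measurable_EFinP. Qed.

Let sq2_ge0 (u v : R) : (0 <= u ^+ 2 + v ^+ 2)%R.
Proof. by rewrite addr_ge0 ?sqr_ge0. Qed.

Let mab : measurable_fun setT (fun x => a x ^+ 2 + b x ^+ 2)%R.
Proof. by apply: measurable_funD; exact: measurable_funX. Qed.
Let mcd : measurable_fun setT (fun x => c x ^+ 2 + d x ^+ 2)%R.
Proof. by apply: measurable_funD; exact: measurable_funX. Qed.

Let nsqE x : nsq (g x) = ((a x ^+ 2 + b x ^+ 2) + (c x ^+ 2 + d x ^+ 2))%R.
Proof. by rewrite /nsq addrA. Qed.

Let ge0_integral_nsq (k : plane R -> R) : measurable_fun setT k -> (forall x, 0 <= k x)%R ->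
  \int[mu2]_x (k x * nsq (g x))%:E =
  \int[mu2]_x (k x * (a x ^+ 2 + b x ^+ 2))%:E + \int[mu2]_x (k x * (c x ^+ 2 + d x ^+ 2))%:E.
Proof.
move=> mk k0; rewrite -ge0_integralD//.
- by apply: eq_integral => x _; rewrite -EFinD -mulrDr nsqE.
- by move=> x _; rewrite lee_fin mulr_ge0.
- by apply/measurable_EFinP; exact: measurable_funM.
- by move=> x _; rewrite lee_fin mulr_ge0.
- by apply/measurable_EFinP; exact: measurable_funM.
Qed.

Let integral_nsq : \int[mu2]_x (nsq (g x))%:E =
  \int[mu2]_x (a x ^+ 2 + b x ^+ 2)%:E + \int[mu2]_x (c x ^+ 2 + d x ^+ 2)%:E.
Proof.
have := @ge0_integral_nsq (cst 1%R) (measurable_cst _) (fun=> ler01).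
by under eq_integral do rewrite mul1r; move=> ->; congr (_ + _);
  apply: eq_integral => x _; rewrite mul1r.
Qed.

Let abS w1 y := power_spectrum b1 (slice a y) (slice b y) w1.
Let cdS w1 y := power_spectrum b1 (slice c y) (slice d y) w1.

Let mabS : measurable_fun setT (fun z : plane R => abS z.1 z.2).
Proof. exact: measurable_partial_spectrum. Qed.
Let mcdS : measurable_fun setT (fun z : plane R => cdS z.1 z.2).
Proof. exact: measurable_partial_spectrum. Qed.

Let kappa : R := (`|b2| / (2 * pi))%R.
Let kappa0 : (0 <= kappa)%R. Proof. by rewrite divr_ge0 ?mulr_ge0 ?pi_ge0. Qed.

(** Plancherel in the second variable for the two pairs of [nsq_qft], at a fixed first
    frequency. *)
Let second_variable w1 :
  \int[mu]_y (abS w1 y + cdS w1 y)%:E <=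
  kappa%:E * \int[mu]_w2 (nsq (qft b1 b2 g (w1, w2)))%:E.
Proof.
pose u y := fourier_re b1 (slice a y) (slice b y) w1.
pose v y := fourier_im b1 (slice a y) (slice b y) w1.
pose s y := fourier_re b1 (slice c y) (slice d y) w1.
pose t y := fourier_im b1 (slice c y) (slice d y) w1.
have ui : mu.-integrable setT (EFin \o u) by exact: integrable_fourier_re_slice.
have vi : mu.-integrable setT (EFin \o v) by exact: integrable_fourier_im_slice.
have si : mu.-integrable setT (EFin \o s) by exact: integrable_fourier_re_slice.
have ti : mu.-integrable setT (EFin \o t) by exact: integrable_fourier_im_slice.
have mu_ : measurable_fun setT u by case/integrableP : ui => /measurable_EFinP.
have mv : measurable_fun setT v by case/integrableP : vi => /measurable_EFinP.
have ms : measurable_fun setT s by case/integrableP : si => /measurable_EFinP.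
have mt : measurable_fun setT t by case/integrableP : ti => /measurable_EFinP.
have m1 : measurable_fun setT (fun y => u y ^+ 2 + s y ^+ 2)%R.
  by apply: measurable_funD; exact: measurable_funX.
have m2 : measurable_fun setT (fun y => v y ^+ 2 + t y ^+ 2)%R.
  by apply: measurable_funD; exact: measurable_funX.
have mS1 := measurable_power_spectrum b2 ui si.
have mS2 := measurable_power_spectrum b2 vi ti.
have -> : \int[mu]_w2 (nsq (qft b1 b2 g (w1, w2)))%:E =
    \int[mu]_w (power_spectrum b2 u s w)%:E + \int[mu]_w (power_spectrum b2 v t w)%:E.
  rewrite -ge0_integralD//.
  - by apply: eq_integral => w _; rewrite -EFinD nsq_qft.
  - by move=> w _; rewrite lee_fin power_spectrum_ge0.
  - exact/measurable_EFinP.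
  - by move=> w _; rewrite lee_fin power_spectrum_ge0.
  - exact/measurable_EFinP.
have -> : \int[mu]_y (abS w1 y + cdS w1 y)%:E =
    \int[mu]_y (u y ^+ 2 + s y ^+ 2)%:E + \int[mu]_y (v y ^+ 2 + t y ^+ 2)%:E.
  rewrite -ge0_integralD//.
  - by apply: eq_integral => y _; rewrite -EFinD /abS /cdS /power_spectrum
      -/(u y) -/(v y) -/(s y) -/(t y) addrACA.
  - by move=> y _; rewrite lee_fin.
  - exact/measurable_EFinP.
  - by move=> y _; rewrite lee_fin.
  - exact/measurable_EFinP.
rewrite ge0_muleDr; [|by apply: integral_ge0 => w _; rewrite lee_fin power_spectrum_ge0..].
by apply: leeD; exact: plancherel_ineq.
Qed.

(** Sum of the inequalities for [a + i b] and [c + i d], whose spectral terms are then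
    compared, frequency by frequency, to the full transform by [second_variable]. *)
Lemma qft_ineq :
  \int[mu2]_x (nsq (g x))%:E <= lam%:E * \int[mu2]_x (x.1 ^+ 2 * nsq (g x))%:E +
    kappa%:E * \int[mu2]_w (sigma w.1 * nsq (qft b1 b2 g w))%:E.
Proof.
have mx1 : measurable_fun setT (fun x : plane R => x.1 ^+ 2)%R by meas.
have ab0 : 0 <= \int[mu2]_x (a x ^+ 2 + b x ^+ 2)%:E.
  by apply: integral_ge0 => x _; rewrite lee_fin.
have cd0 : 0 <= \int[mu2]_x (c x ^+ 2 + d x ^+ 2)%:E.
  by apply: integral_ge0 => x _; rewrite lee_fin.
have abfin : \int[mu2]_x (a x ^+ 2 + b x ^+ 2)%:E < +oo.
  by apply: le_lt_trans g_fin; rewrite integral_nsq leeDl.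
have cdfin : \int[mu2]_x (c x ^+ 2 + d x ^+ 2)%:E < +oo.
  by apply: le_lt_trans g_fin; rewrite integral_nsq leeDr.
have := leeD (partial_transform_ineq ai bi lam0 sigma0 msigma ineq1D abfin)
             (partial_transform_ineq ci di lam0 sigma0 msigma ineq1D cdfin).
rewrite -integral_nsq => /le_trans; apply.
rewrite (ge0_integral_nsq mx1); last by move=> x; exact: sqr_ge0.
have x0 (f h : plane R -> R) : 0 <= \int[mu2]_x (x.1 ^+ 2 * (f x ^+ 2 + h x ^+ 2))%:E.
  by apply: integral_ge0 => x _; rewrite lee_fin mulr_ge0 ?sqr_ge0.
rewrite [leLHS]addeACA -ge0_muleDr//; apply: leeD; first exact: lexx.
have msab : measurable_fun setT (fun z : plane R => sigma z.1 * abS z.1 z.2)%R.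
  by apply: measurable_funM => //; exact: (measurableT_comp msigma measurable_fst).
have mscd : measurable_fun setT (fun z : plane R => sigma z.1 * cdS z.1 z.2)%R.
  by apply: measurable_funM => //; exact: (measurableT_comp msigma measurable_fst).
have msq : measurable_fun setT (fun w : plane R => sigma w.1 * nsq (qft b1 b2 g w))%R.
  apply: measurable_funM; last exact: measurable_nsq_qft.
  exact: (measurableT_comp msigma measurable_fst).
rewrite -ge0_integralD//; last 4 first.
- by move=> w _; apply: integral_ge0 => y _; rewrite lee_fin mulr_ge0 ?power_spectrum_ge0.
- apply: (measurable_fun_fubini_tonelli_F (fun z : plane R => (sigma z.1 * abS z.1 z.2)%:E)).
    exact/measurable_EFinP.
  by move=> z; rewrite lee_fin mulr_ge0 ?power_spectrum_ge0.
- by move=> w _; apply: integral_ge0 => y _; rewrite lee_fin mulr_ge0 ?power_spectrum_ge0.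
- apply: (measurable_fun_fubini_tonelli_F (fun z : plane R => (sigma z.1 * cdS z.1 z.2)%:E)).
    exact/measurable_EFinP.
  by move=> z; rewrite lee_fin mulr_ge0 ?power_spectrum_ge0.
rewrite -[X in _ * X]/(\int[mu \x mu]_w (sigma w.1 * nsq (qft b1 b2 g w))%:E).
rewrite (fubini_tonelli1 (fun w : plane R => (sigma w.1 * nsq (qft b1 b2 g w))%:E));
  [|exact/measurable_EFinP|by move=> w; rewrite lee_fin mulr_ge0 ?nsq_ge0].
rewrite -ge0_integralZl//; last 2 first.
- apply: measurable_fun_fubini_tonelli_F; first exact/measurable_EFinP.
  by move=> w; rewrite lee_fin mulr_ge0 ?nsq_ge0.
- by move=> w _; apply: integral_ge0 => y _; rewrite lee_fin mulr_ge0 ?nsq_ge0.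
have mab_w w1 : measurable_fun setT (abS w1).
  exact: (measurableT_comp mabS (pair1_measurable w1)).
have mcd_w w1 : measurable_fun setT (cdS w1).
  exact: (measurableT_comp mcdS (pair1_measurable w1)).
apply: ge0_le_integral => //.
- move=> w _; apply: adde_ge0; apply: integral_ge0 => y _;
  by rewrite lee_fin mulr_ge0 ?power_spectrum_ge0.
- apply: emeasurable_funD.
    apply: (measurable_fun_fubini_tonelli_F (fun z : plane R => (sigma z.1 * abS z.1 z.2)%:E)).
      exact/measurable_EFinP.
    by move=> z; rewrite lee_fin mulr_ge0 ?power_spectrum_ge0.
  apply: (measurable_fun_fubini_tonelli_F (fun z : plane R => (sigma z.1 * cdS z.1 z.2)%:E)).
    exact/measurable_EFinP.
  by move=> z; rewrite lee_fin mulr_ge0 ?power_spectrum_ge0.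
- apply: measurable_funeM; apply: measurable_fun_fubini_tonelli_F; first exact/measurable_EFinP.
  by move=> w; rewrite lee_fin mulr_ge0 ?nsq_ge0.
move=> w1 _; rewrite /fubini_F/=.
rewrite !ge0_integralZl_real//; last first.
- by move=> y; exact: power_spectrum_ge0.
- exact: mab_w.
- by move=> y; exact: power_spectrum_ge0.
- exact: mcd_w.
- by move=> w2; exact: nsq_ge0.
- exact: (measurableT_comp measurable_nsq_qft (pair1_measurable w1)).
rewrite -ge0_muleDr; [|by apply: integral_ge0 => y _; rewrite lee_fin power_spectrum_ge0..].
rewrite muleCA; apply: lee_wpmul2l; first by rewrite lee_fin.
apply: le_trans (second_variable w1).
rewrite le_eqVlt; apply/orP; left; apply/eqP.
rewrite -ge0_integralD//.
- by move=> y _; rewrite lee_fin power_spectrum_ge0.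
- by apply/measurable_EFinP; exact: mab_w.
- by move=> y _; rewrite lee_fin power_spectrum_ge0.
- by apply/measurable_EFinP; exact: mcd_w.
Qed.

End Spectrum.
End QuaternionFourier.

Section QuaternionMeasurability.
Context d (T : measurableType d) {R : realType}.
Local Notation H := (quaternion R).

Definition qmeas (f : T -> H) : Prop :=
  [/\ measurable_fun setT (fun x => qre (f x)),
      measurable_fun setT (fun x => qi (f x)),
      measurable_fun setT (fun x => qj (f x)) &
      measurable_fun setT (fun x => qk (f x))].

Lemma qmeas_cst (q : H) : qmeas (fun=> q).
Proof. by split; exact: measurable_cst. Qed.

Lemma qmeasM (f g : T -> H) : qmeas f -> qmeas g -> qmeas (fun x => f x * g x).
Proof. by move=> [? ? ? ?] [? ? ? ?]; split => /=; meas. Qed.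

Lemma qmeas_conj (f : T -> H) : qmeas f -> qmeas (fun x => qconj (f x)).
Proof. by move=> [? ? ? ?]; split => /=; meas. Qed.

Lemma qmeas_expi (t : T -> R) : measurable_fun setT t -> qmeas (fun x => expi (t x)).
Proof. by move=> mt; split => /=; meas. Qed.

Lemma qmeas_expj (t : T -> R) : measurable_fun setT t -> qmeas (fun x => expj (t x)).
Proof. by move=> mt; split => /=; meas. Qed.

Lemma measurable_nsq (f : T -> H) : qmeas f -> measurable_fun setT (fun x => nsq (f x)).
Proof. by move=> [? ? ? ?]; rewrite /nsq; meas. Qed.

End QuaternionMeasurability.

Lemma qmeas_comp d (T : measurableType d) d' (T' : measurableType d') (R : realType)
    (f : T -> quaternion R) (h : T' -> T) :
  measurable_fun setT h -> qmeas f -> qmeas (fun x => f (h x)).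
Proof.
by move=> mh [m1 m2 m3 m4]; split;
  [exact: (measurableT_comp m1 mh)|exact: (measurableT_comp m2 mh)
  |exact: (measurableT_comp m3 mh)|exact: (measurableT_comp m4 mh)].
Qed.

Lemma qintegrable_qmeas (R : realType) (g : plane R -> quaternion R) :
  qintegrable g -> qmeas g.
Proof.
move=> [/integrableP[/measurable_EFinP m1 _] /integrableP[/measurable_EFinP m2 _]
        /integrableP[/measurable_EFinP m3 _] /integrableP[/measurable_EFinP m4 _]].
by split.
Qed.

Section CoordinateSwap.
Context {R : realType}.
Local Notation H := (quaternion R).
Local Notation mu := (@lebesgue_measure R).
Local Notation mu2 := (@lebesgue2 R).
Local Open Scope ereal_scope.

Definition pswap (x : plane R) : plane R := (x.2, x.1).

Lemma measurable_pswap : measurable_fun setT pswap.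
Proof. by apply: measurable_fun_pair; [exact: measurable_snd|exact: measurable_fst]. Qed.

Lemma ge0_integral_pswap (f : plane R -> \bar R) : measurable_fun setT f ->
  (forall x, 0 <= f x) -> \int[mu2]_x f (pswap x) = \int[mu2]_x f x.
Proof.
move=> mf f0.
rewrite -[LHS]/(\int[mu \x mu]_x f (pswap x)) -[RHS]/(\int[mu \x mu]_x f x).
rewrite (fubini_tonelli1 (f \o pswap));
  [|exact: (measurableT_comp mf measurable_pswap)|by move=> x; exact: f0].
by rewrite (fubini_tonelli2 f).
Qed.

Lemma integral_pswap (f : plane R -> \bar R) : measurable_fun setT f ->
  \int[mu2]_x f (pswap x) = \int[mu2]_x f x.
Proof.
move=> mf; rewrite integralE [RHS]integralE.
under eq_integral do rewrite (funepos_comp f)/=.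
under [X in _ - X = _]eq_integral do rewrite (funeneg_comp f)/=.
congr (_ - _); apply: ge0_integral_pswap => //.
- exact: measurable_funepos.
- exact: measurable_funeneg.
Qed.

Lemma integrable_pswap (f : plane R -> \bar R) : mu2.-integrable setT f ->
  mu2.-integrable setT (fun x => f (pswap x)).
Proof.
move=> /integrableP[mf foo]; apply/integrableP; split.
  exact: (measurableT_comp mf measurable_pswap).
rewrite (ge0_integral_pswap (f := fun x => `|f x|))//.
exact: measurableT_comp.
Qed.

(** The linear map exchanging [i] and [j].  It fixes [k = i j] and reverses products, so it
    exchanges the left [i]-kernel and the right [j]-kernel of the two-sided transform. *)
Definition qtwist (q : H) : H := Quat (qre q) (qj q) (qi q) (qk q).

Lemma qtwistM (p q : H) : qtwist (p * q)%R = (qtwist q * qtwist p)%R.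
Proof.
by case: p => a b c d; case: q => a' b' c' d'; rewrite /qtwist; congr Quat => /=; ring.
Qed.

Lemma nsq_qtwist (q : H) : nsq (qtwist q) = nsq q.
Proof. by case: q => a b c d; rewrite /nsq /=; ring. Qed.

Lemma Rintegral_pswap (f : plane R -> R) : measurable_fun setT f ->
  (\int[mu2]_x f (pswap x) = \int[mu2]_x f x)%R.
Proof.
move=> mf; rewrite /Rintegral.
by rewrite (integral_pswap (f := EFin \o f))//; exact/measurable_EFinP.
Qed.

Lemma qft_qtwist (b1 b2 : R) (g : plane R -> H) (w : plane R) : qintegrable g ->
  nsq (qft b2 b1 (fun x => qtwist (g (pswap x))) (pswap w)) = nsq (qft b1 b2 g w).
Proof.
move=> /qintegrable_qmeas mg; rewrite -[RHS]nsq_qtwist; congr nsq.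
pose F x := (expi (- (b1 * x.1 * w.1)) * g x * expj (- (b2 * x.2 * w.2)))%R.
have [m1 m2 m3 m4] : qmeas F.
  apply: qmeasM; first apply: qmeasM => //.
    by apply: qmeas_expi; meas.
  by apply: qmeas_expj; meas.
have FE x : (expi (- (b2 * x.1 * (pswap w).1)) * qtwist (g (pswap x)) *
    expj (- (b1 * x.2 * (pswap w).2)) = qtwist (F (pswap x)))%R.
  by rewrite /F !qtwistM mulrA.
transitivity (qintegral (fun x => qtwist (F (pswap x)))).
  by congr qintegral; apply/funext => x; exact: FE.
rewrite [LHS]/qintegral [RHS]/qtwist; congr Quat.
- exact: (Rintegral_pswap m1).
- exact: (Rintegral_pswap m3).
- exact: (Rintegral_pswap m2).
- exact: (Rintegral_pswap m4).
Qed.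

Lemma qintegrable_qtwist (g : plane R -> H) : qintegrable g ->
  qintegrable (fun x => qtwist (g (pswap x))).
Proof.
by move=> [i1 i2 i3 i4]; split;
  [exact: (integrable_pswap i1)|exact: (integrable_pswap i3)
  |exact: (integrable_pswap i2)|exact: (integrable_pswap i4)].
Qed.

End CoordinateSwap.

Section QuaternionUncertainty.
Context {R : realType}.
Local Notation H := (quaternion R).
Local Notation mu := (@lebesgue_measure R).
Local Notation mu2 := (@lebesgue2 R).
Local Open Scope ereal_scope.

Definition qft_weight (b1 b2 : R) : R := (`|b1| / (2 * pi) * (`|b2| / (2 * pi)))%R.

Lemma qft_plancherel (b1 b2 : R) (g : plane R -> H) :
  (b1 != 0)%R -> (b2 != 0)%R -> qintegrable g -> \int[mu2]_x (nsq (g x))%:E < +oo ->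
  \int[mu2]_x (nsq (g x))%:E <=
    (qft_weight b1 b2)%:E * \int[mu2]_w (nsq (qft b1 b2 g w))%:E.
Proof.
move=> b10 b20 gi gfin.
have c0 : (0 <= `|b1| / (2 * pi))%R by rewrite divr_ge0 ?mulr_ge0 ?pi_ge0.
have mps p q : mu.-integrable setT (EFin \o p) -> mu.-integrable setT (EFin \o q) ->
    measurable_fun setT (power_spectrum b1 p q).
  exact: measurable_power_spectrum.
have := @qft_ineq R b1 b2 g gi 0 (cst (`|b1| / (2 * pi))%R)
  (lexx _) (fun=> c0) (measurable_cst _) b20 _ gfin.
move=> /(_ _)/le_trans; apply.
  move=> p q pint qint _; rewrite mul0e add0e.
  rewrite ge0_integralZl_real; [|by []|exact: mps|by move=> w; exact: power_spectrum_ge0|exact: c0].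
  exact: plancherel_ineq.
rewrite mul0e add0e.
rewrite ge0_integralZl_real; [|by []|exact: measurable_nsq_qft|by move=> w; exact: nsq_ge0|exact: c0].
by rewrite muleA -EFinM mulrC.
Qed.

Let qft_uncertainty1 (b1 b2 lam : R) (g : plane R -> H) :
  (0 < lam)%R -> (b1 != 0)%R -> (b2 != 0)%R -> qintegrable g -> \int[mu2]_x (nsq (g x))%:E < +oo ->
  \int[mu2]_x (nsq (g x))%:E <=
    lam%:E * \int[mu2]_x (x.1 ^+ 2 * nsq (g x))%:E +
    (lam^-1 * b1 ^+ 2 * qft_weight b1 b2)%:E *
      \int[mu2]_w (w.1 ^+ 2 * nsq (qft b1 b2 g w))%:E.
Proof.
move=> lam0 b10 b20 gi gfin.
pose c : R := (lam^-1 * (b1 ^+ 2 * (`|b1| / (2 * pi))))%R.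
have c0 : (0 <= c)%R.
  by rewrite mulr_ge0 ?invr_ge0 ?(ltW lam0)// mulr_ge0 ?sqr_ge0// divr_ge0 ?mulr_ge0 ?pi_ge0.
have mps p q : mu.-integrable setT (EFin \o p) -> mu.-integrable setT (EFin \o q) ->
    measurable_fun setT (power_spectrum b1 p q).
  exact: measurable_power_spectrum.
have msig : measurable_fun setT (fun w : R => c * w ^+ 2)%R by meas.
have sig0 (w : R) : (0 <= c * w ^+ 2)%R by rewrite mulr_ge0 ?sqr_ge0.
have := @qft_ineq R b1 b2 g gi lam (fun w => c * w ^+ 2)%R (ltW lam0) sig0 msig b20 _ gfin.
move=> /(_ _)/le_trans; apply.
  move=> p q pint qint fin.
  under [X in _ <= _ + X]eq_integral do rewrite -mulrA.
  rewrite ge0_integralZl_real; [|by []|by apply: measurable_funM; [meas|exact: mps]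
    |by move=> w; rewrite mulr_ge0 ?sqr_ge0 ?power_spectrum_ge0|exact: c0].
  exact: heisenberg_ineq.
apply: leeD; first exact: lexx.
under eq_integral do rewrite -mulrA.
rewrite ge0_integralZl_real; [|by []|by apply: measurable_funM; [meas|exact: measurable_nsq_qft]
  |by move=> w; rewrite mulr_ge0 ?sqr_ge0 ?nsq_ge0|exact: c0].
rewrite muleA -EFinM le_eqVlt; apply/orP; left; apply/eqP; congr (_%:E * _).
by rewrite /c /qft_weight; ring.
Qed.

(** For the second coordinate, exchange coordinates and twist the values; masses and
    moments are unchanged because [qtwist] preserves the modulus. *)
Lemma qft_uncertainty (b : 'I_2 -> R) (lam : R) (g : plane R -> H) (k : 'I_2) :
  (0 < lam)%R -> (forall k, b k != 0)%R -> qintegrable g -> \int[mu2]_x (nsq (g x))%:E < +oo ->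
  \int[mu2]_x (nsq (g x))%:E <=
    lam%:E * \int[mu2]_x (coord2 k x ^+ 2 * nsq (g x))%:E +
    (lam^-1 * b k ^+ 2 * qft_weight (b 0%R) (b 1%R))%:E *
      \int[mu2]_w (coord2 k w ^+ 2 * nsq (qft (b 0%R) (b 1%R) g w))%:E.
Proof.
move=> lam0 b0 gi gfin; rewrite /coord2.
have [->|k0] := eqVneq k 0%R; first exact: qft_uncertainty1.
have -> : k = 1%R by apply/val_inj; case: k k0 => -[|[|//]].
have mg := measurable_nsq (qintegrable_qmeas gi).
have mw := measurable_nsq_qft (b 0%R) (b 1%R) gi.
pose g' x := qtwist (g (pswap x)).
have e1 : \int[mu2]_x (nsq (g' x))%:E = \int[mu2]_x (nsq (g x))%:E.
  rewrite -[RHS]ge0_integral_pswap; [|exact/measurable_EFinP|by move=> x; rewrite lee_fin nsq_ge0].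
  by apply: eq_integral => x _; rewrite nsq_qtwist.
have e2 : \int[mu2]_x (x.1 ^+ 2 * nsq (g' x))%:E = \int[mu2]_x (x.2 ^+ 2 * nsq (g x))%:E.
  rewrite -[RHS]ge0_integral_pswap; last 2 first.
  - by apply/measurable_EFinP; apply: measurable_funM => //; meas.
  - by move=> x; rewrite lee_fin mulr_ge0 ?sqr_ge0 ?nsq_ge0.
  by apply: eq_integral => x _; rewrite nsq_qtwist.
have e3 : \int[mu2]_x (x.1 ^+ 2 * nsq (qft (b 1%R) (b 0%R) g' x))%:E =
    \int[mu2]_x (x.2 ^+ 2 * nsq (qft (b 0%R) (b 1%R) g x))%:E.
  rewrite -[RHS]ge0_integral_pswap; last 2 first.
  - by apply/measurable_EFinP; apply: measurable_funM => //; meas.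
  - by move=> x; rewrite lee_fin mulr_ge0 ?sqr_ge0 ?nsq_ge0.
  apply: eq_integral => -[x1 x2] _; rewrite -(qft_qtwist _ _ _ gi).
  by rewrite /pswap/=.
have := @qft_uncertainty1 (b 1%R) (b 0%R) lam g' lam0 (b0 _) (b0 _) (qintegrable_qtwist gi).
rewrite e1 e2 e3 => /(_ gfin).
by rewrite /qft_weight [in X in (_ * X)%R]mulrC.
Qed.

End QuaternionUncertainty.

(** * The windowed transform as a Fourier transform *)

Section KernelFactorization.
Context {R : realType}.
Local Notation H := (quaternion R).
Local Notation mu2 := (@lebesgue2 R).

Lemma expiD (s t : R) : expi (s + t) = expi s * expi t.
Proof. by rewrite /expi cosD sinD; congr Quat => /=; ring. Qed.

Lemma expjD (s t : R) : expj (s + t) = expj s * expj t.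
Proof. by rewrite /expj cosD sinD; congr Quat => /=; ring. Qed.

Lemma nsq_expi (t : R) : nsq (expi t) = 1.
Proof. by rewrite /nsq /= -(cos2Dsin2 t); ring. Qed.

Lemma nsq_expj (t : R) : nsq (expj t) = 1.
Proof. by rewrite /nsq /= -(cos2Dsin2 t); ring. Qed.

Lemma nsq_sqrti (t : R) : nsq (sqrti t) = `|t|.
Proof.
rewrite /sqrti /nsq; case: ifPn => [t0|]; rewrite /= !expr0n/= ?addr0 ?add0r.
  by rewrite sqr_sqrtr// ger0_norm.
by rewrite -ltNge => t0; rewrite sqr_sqrtr.
Qed.

Lemma nsq_sqrtj (t : R) : nsq (sqrtj t) = `|t|.
Proof.
rewrite /sqrtj /nsq; case: ifPn => [t0|]; rewrite /= !expr0n/= ?addr0 ?add0r.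
  by rewrite sqr_sqrtr// ger0_norm.
by rewrite -ltNge => t0; rewrite sqr_sqrtr.
Qed.

Lemma nsq0 : nsq (0 : H) = 0.
Proof. by rewrite /nsq /= !expr0n/= !addr0. Qed.

Lemma nsq1 : nsq (1 : H) = 1.
Proof. by rewrite /nsq /= expr1n !expr0n/= !addr0. Qed.

Lemma nsq_inv (q : H) : q != 0 -> nsq q^-1 = (nsq q)^-1.
Proof.
move=> q0.
have h : nsq q * nsq q^-1 = 1 by rewrite -nsqM mulrV ?nsq1.
have n0 : nsq q != 0 by apply/eqP => e; move/eqP: h; rewrite e mul0r eq_sym oner_eq0.
by apply: (mulfI n0); rewrite h mulfV.
Qed.

(** Both factors lie in the commutative plane [R + j R].  The normalising constant can thus
    be moved to the far right, out of the integral. *)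
Lemma comm_sqrtj_expj (s t : R) : (sqrtj s)^-1 * expj t = expj t * (sqrtj s)^-1.
Proof.
apply/commr_sym/commrV; rewrite /sqrtj /expj.
by case: ifPn => _; congr Quat => /=; ring.
Qed.

Lemma nsq_conj (q : H) : nsq (qconj q) = nsq q.
Proof. by rewrite /nsq /= !sqrrN. Qed.

Definition chirp (B : 'M[R]_2) (x : R) : R := B 0 0 / (2 * B 0 1) * x ^+ 2.
Definition phase_tail (B : 'M[R]_2) (w : R) : R := B 1 1 / (2 * B 0 1) * w ^+ 2 - pi / 4.

Lemma lct_phaseE (B : 'M[R]_2) (x w : R) :
  lct_phase B x w = phase_tail B w + - ((B 0 1)^-1 * x * w) + chirp B x.
Proof. by rewrite /lct_phase /phase_tail /chirp; ring. Qed.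

Variables (A1 A2 : 'M[R]_2) (phi f : plane R -> H).

Definition windowed (u x : plane R) : H :=
  f x * qconj (phi ((x.1 : R) - u.1, (x.2 : R) - u.2)).

Definition chirped (u x : plane R) : H :=
  expi (chirp A1 x.1) * windowed u x * expj (chirp A2 x.2).

Lemma nsq_chirped u x :
  nsq (chirped u x) = nsq (f x) * nsq (phi ((x.1 : R) - u.1, (x.2 : R) - u.2)).
Proof. by rewrite /chirped /windowed !nsqM nsq_expi nsq_expj mul1r mulr1 nsq_conj. Qed.

Lemma qwlct_integrand w u x :
  kerneli A1 x.1 w.1 * f x * qconj (phi ((x.1 : R) - u.1, (x.2 : R) - u.2)) * kernelj A2 x.2 w.2 =
  ((sqrti (2 * pi * A1 0 1))^-1 * expi (phase_tail A1 w.1)) *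
  (expi (- ((A1 0 1)^-1 * x.1 * w.1)) * chirped u x * expj (- ((A2 0 1)^-1 * x.2 * w.2))) *
  (expj (phase_tail A2 w.2) * (sqrtj (2 * pi * A2 0 1))^-1).
Proof.
rewrite /kerneli /kernelj /chirped /windowed comm_sqrtj_expj !lct_phaseE.
rewrite !expiD [in X in _ * (X * _)](addrC (_ + _)) [in X in _ * (X * _)](addrC (phase_tail _ _)).
by rewrite !addrA !expjD !mulrA.
Qed.

End KernelFactorization.

Section QuaternionLinearity.
Context {R : realType}.
Local Notation H := (quaternion R).
Local Notation mu2 := (@lebesgue2 R).

Lemma qintegralMl (p : H) (g : plane R -> H) : qintegrable g ->
  qintegrable (fun x => p * g x) /\ qintegral (fun x => p * g x) = p * qintegral g.
Proof.
move=> [ia ib ic id].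
case: p => p0 p1 p2 p3.
have [j1 e1] := integral_lin4 p0 (- p1) (- p2) (- p3) ia ib ic id.
have [j2 e2] := integral_lin4 p0 p1 p2 (- p3) ib ia id ic.
have [j3 e3] := integral_lin4 p0 (- p1) p2 p3 ic id ia ib.
have [j4 e4] := integral_lin4 p0 p1 (- p2) p3 id ic ib ia.
split.
- split.
  + by move: j1; congr (_.-integrable _ _); apply/funext => x /=; congr (_%:E); ring.
  + by move: j2; congr (_.-integrable _ _); apply/funext => x /=; congr (_%:E); ring.
  + by move: j3; congr (_.-integrable _ _); apply/funext => x /=; congr (_%:E); ring.
  + by move: j4; congr (_.-integrable _ _); apply/funext => x /=; congr (_%:E); ring.
- rewrite /qintegral; congr Quat => /=.
  + transitivity (p0 * \int[mu2]_x qre (g x) + - p1 * \int[mu2]_x qi (g x) +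
      - p2 * \int[mu2]_x qj (g x) + - p3 * \int[mu2]_x qk (g x)); last by ring.
    by rewrite -e1; apply: eq_Rintegral => x _; ring.
  + transitivity (p0 * \int[mu2]_x qi (g x) + p1 * \int[mu2]_x qre (g x) +
      p2 * \int[mu2]_x qk (g x) + - p3 * \int[mu2]_x qj (g x)); last by ring.
    by rewrite -e2; apply: eq_Rintegral => x _; ring.
  + transitivity (p0 * \int[mu2]_x qj (g x) + - p1 * \int[mu2]_x qk (g x) +
      p2 * \int[mu2]_x qre (g x) + p3 * \int[mu2]_x qi (g x)); last by ring.
    by rewrite -e3; apply: eq_Rintegral => x _; ring.
  + transitivity (p0 * \int[mu2]_x qk (g x) + p1 * \int[mu2]_x qj (g x) +
      - p2 * \int[mu2]_x qi (g x) + p3 * \int[mu2]_x qre (g x)); last by ring.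
    by rewrite -e4; apply: eq_Rintegral => x _; ring.
Qed.

Lemma qconjM (p q : H) : qconj (p * q) = qconj q * qconj p.
Proof. by case: p => a b c d; case: q => a' b' c' d'; congr Quat => /=; ring. Qed.

Lemma qconjK : involutive (@qconj R).
Proof. by case=> a b c d; rewrite /qconj /= !opprK. Qed.

Lemma qintegral_conj (g : plane R -> H) : qintegrable g ->
  qintegrable (fun x => qconj (g x)) /\ qintegral (fun x => qconj (g x)) = qconj (qintegral g).
Proof.
move=> [ia ib ic id].
have N (p : plane R -> R) : mu2.-integrable setT (EFin \o p) ->
    mu2.-integrable setT (EFin \o (fun x => - p x)).
  by move=> pint; exact: (integrableN pint).
have NE (p : plane R -> R) : mu2.-integrable setT (EFin \o p) ->
    \int[mu2]_x (- p x) = - \int[mu2]_x p x.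
  move=> pint; rewrite -mulN1r -RintegralZl//.
  by apply: eq_Rintegral => x _; rewrite mulN1r.
split; first by split => //; exact: N.
by rewrite /qintegral /qconj/=; congr Quat; exact: NE.
Qed.

(** Follows from multiplication on the left by conjugation, which reverses products. *)
Lemma qintegralMr (q : H) (g : plane R -> H) : qintegrable g ->
  qintegrable (fun x => g x * q) /\ qintegral (fun x => g x * q) = qintegral g * q.
Proof.
move=> /qintegral_conj[ig eg].
have [i e] := qintegralMl (qconj q) ig.
have [i' e'] := qintegral_conj i.
have E : (fun x => qconj (qconj q * qconj (g x))) = (fun x => g x * q).
  by apply/funext => x; rewrite -qconjM qconjK.
rewrite E in i' e'; split; first exact: i'.
by rewrite e' e eg -qconjM qconjK.
Qed.

Lemma nsq_qintegralM (p q : H) (g : plane R -> H) : qintegrable g ->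
  nsq (qintegral (fun x => p * g x * q)) = nsq p * nsq (qintegral g) * nsq q.
Proof.
move=> gi; have [i1 e1] := qintegralMl p gi; have [i2 e2] := qintegralMr q i1.
by rewrite e2 e1 !nsqM.
Qed.

End QuaternionLinearity.

(** * Integration over the positions of the window *)

Section PlaneInvariance.
Context {R : realType}.
Local Notation mu := (@lebesgue_measure R).
Local Notation mu2 := (@lebesgue2 R).
Local Open Scope ereal_scope.

Definition psub (x u : plane R) : plane R := ((x.1 : R) - u.1, (x.2 : R) - u.2)%R.

Lemma ge0_integral_subl (c : R) (f : R -> \bar R) :
  measurable_fun setT f -> (forall x, 0 <= f x) ->
  \int[mu]_x f (c - x)%R = \int[mu]_x f x.
Proof.
move=> mf f0.
have mN : measurable_fun setT (fun x : R => f (- x)%R).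
  by apply: (measurableT_comp mf); meas.
rewrite -(ge0_integral_reflect mf f0) -(ge0_integral_translate (- c) mN)//.
by apply: eq_integral => x _; rewrite opprD opprK addrC.
Qed.

Lemma ge0_integral_psubl (c : plane R) (f : plane R -> \bar R) :
  measurable_fun setT f -> (forall x, 0 <= f x) ->
  \int[mu2]_u f (psub c u) = \int[mu2]_u f u.
Proof.
move=> mf f0.
have mfc : measurable_fun setT (fun u => f (psub c u)).
  by apply: (measurableT_comp mf); apply: measurable_fun_pair; meas.
rewrite -[LHS]/(\int[mu \x mu]_u f (psub c u)) -[RHS]/(\int[mu \x mu]_u f u).
rewrite (fubini_tonelli1 (fun u => f (psub c u)))//.
rewrite (fubini_tonelli1 f)//.
have mF : measurable_fun setT (fubini_F mu f) by exact: measurable_fun_fubini_tonelli_F.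
have F0 x : 0 <= fubini_F mu f x by exact: integral_ge0.
rewrite -[RHS](ge0_integral_subl c.1 mF F0).
apply: eq_integral => x _; rewrite /fubini_F.
apply: (ge0_integral_subl c.2 (f := fun y => f ((c.1 : R) - x, y)%R)) => //.
exact: (measurableT_comp mf (pair1_measurable _)).
Qed.

Lemma ge0_integral_psubr (c : plane R) (f : plane R -> \bar R) :
  measurable_fun setT f -> (forall x, 0 <= f x) ->
  \int[mu2]_x f (psub x c) = \int[mu2]_x f x.
Proof.
move=> mf f0.
have mfc : measurable_fun setT (fun x => f (psub x c)).
  by apply: (measurableT_comp mf); apply: measurable_fun_pair; meas.
rewrite -[LHS]/(\int[mu \x mu]_u f (psub u c)) -[RHS]/(\int[mu \x mu]_u f u).
rewrite (fubini_tonelli1 (fun u => f (psub u c)))//.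
rewrite (fubini_tonelli1 f)//.
have mF : measurable_fun setT (fubini_F mu f) by exact: measurable_fun_fubini_tonelli_F.
have F0 x : 0 <= fubini_F mu f x by exact: integral_ge0.
rewrite -[RHS](ge0_integral_translate (- c.1) mF F0).
apply: eq_integral => x _; rewrite /fubini_F.
apply: (ge0_integral_translate (- c.2) (f := fun y => f ((x : R) - c.1, y)%R)) => //.
exact: (measurableT_comp mf (pair1_measurable _)).
Qed.

Lemma measurable_coord2 (k : 'I_2) : measurable_fun setT (fun x : plane R => coord2 k x).
Proof. by rewrite /coord2; case: (k == 0%R); meas. Qed.

Lemma coord2_null (k : 'I_2) : mu2.-negligible [set x : plane R | coord2 k x = 0%R].
Proof.
have m0 : measurable ([set 0%R] : set (measurableTypeR R)) by exact: measurable_set1.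
rewrite /coord2; case: (k == 0%R).
- exists ([set 0%R] `*` setT); split; first exact: measurableX.
    by rewrite -[LHS]/((mu \x mu) _) product_measure1E//= lebesgue_measure_set1 mul0e.
  by move=> x /= ->.
- exists (setT `*` [set 0%R]); split; first exact: measurableX.
    by rewrite -[LHS]/((mu \x mu) _) product_measure1E//= lebesgue_measure_set1 mule0.
  by move=> x /= ->.
Qed.

Lemma ge0_integral_eq0P d (T : measurableType d) (m : {measure set T -> \bar R}) (f : T -> R) :
  measurable_fun setT f -> (forall x, 0 <= f x)%R ->
  \int[m]_x (f x)%:E = 0 <-> {ae m, forall x, f x = 0%R}.
Proof.
move=> mf f0.
have -> : \int[m]_x (f x)%:E = \int[m]_x `|(f x)%:E|.
  by apply: eq_integral => x _; rewrite gee0_abs// lee_fin.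
rewrite (ae_eq_integral_abs m measurableT); last exact/measurable_EFinP.
by split; apply: ae_imply => x; [move=> /(_ I)[]|move=> -> _].
Qed.

(** The second moment can vanish only if [f] vanishes almost everywhere off a coordinate
    axis, which is a null set. *)
Lemma integral_coord2_eq0 (k : 'I_2) (f : plane R -> R) :
  measurable_fun setT f -> (forall x, 0 <= f x)%R ->
  \int[mu2]_x (coord2 k x ^+ 2 * f x)%:E = 0 -> \int[mu2]_x (f x)%:E = 0.
Proof.
move=> mf f0.
have mk := measurable_coord2 k.
rewrite ge0_integral_eq0P; last 2 first.
- by apply: measurable_funM => //; exact: measurable_funX.
- by move=> x; rewrite mulr_ge0 ?sqr_ge0.
move=> [N [mN N0 h]]; apply/ge0_integral_eq0P => //.
have [Z [mZ Z0 hZ]] := coord2_null k.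
exists (N `|` Z); split; [exact: measurableU|exact: null_set_setU|].
move=> x /= fx0; apply: contrapT => /not_orP[xN xZ].
have /eqP : (coord2 k x ^+ 2 * f x = 0)%R by apply: contrapT => hx; exact/xN/h.
rewrite mulf_eq0 sqrf_eq0 => /orP[/eqP c0|/eqP//].
by apply/xZ/hZ.
Qed.

End PlaneInvariance.

(** By [|h| <= F + P] whenever [|h|^2 <= F * P]: a product of two square-integrable
    functions is integrable. *)
Lemma qintegrable_mul_bound (R : realType) (h : plane R -> quaternion R) (F P : plane R -> R) :
  qmeas h -> (@lebesgue2 R).-integrable setT (EFin \o F) ->
  (@lebesgue2 R).-integrable setT (EFin \o P) ->
  (forall x, 0 <= F x) -> (forall x, 0 <= P x) ->
  (forall x, nsq (h x) <= F x * P x) -> qintegrable h.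
Proof.
move=> [m1 m2 m3 m4] Fi Pi F0 P0 hFP.
have bnd (c u v : R) : 0 <= u -> 0 <= v -> c ^+ 2 <= u * v -> `|c| <= u + v.
  move=> u0 v0 cuv; rewrite -(@ler_pXn2r _ 2)// ?nnegrE ?addr_ge0// real_normK ?num_real//.
  by apply: (le_trans cuv); nra.
have key (c : plane R -> R) : measurable_fun setT c ->
    (forall x, c x ^+ 2 <= nsq (h x)) -> (@lebesgue2 R).-integrable setT (EFin \o c).
  move=> mc hc; apply: (le_integrable measurableT _ _ (integrableD measurableT Fi Pi)).
    exact/measurable_EFinP.
  move=> x _ /=; rewrite lee_fin [leRHS]ger0_norm ?addr_ge0//.
  by apply: bnd => //; exact: le_trans (hc x) (hFP x).
by split; apply: key => // x; rewrite /nsq; move: (h x) => [p q r s] /=;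
  have := sqr_ge0 p; have := sqr_ge0 q; have := sqr_ge0 r; have := sqr_ge0 s; lra.
Qed.

Section WindowedTransform.
Context {R : realType}.
Local Notation H := (quaternion R).
Local Notation mu2 := (@lebesgue2 R).
Local Open Scope ereal_scope.

Variables (A : 'I_2 -> 'M[R]_2) (phi f : plane R -> H).
Hypothesis b_neq0 : (forall k, A k 0 1 != 0)%R.
Hypothesis mf : qmeas f.
Hypothesis mphi : qmeas phi.
Hypothesis f_fin : \int[mu2]_x (nsq (f x))%:E < +oo.
Hypothesis phi_fin : \int[mu2]_x (nsq (phi x))%:E < +oo.

Let b (k : 'I_2) : R := ((A k 0 1)^-1)%R.
Let b0 k : (b k != 0)%R. Proof. by rewrite invr_eq0. Qed.
Let g := chirped (A 0%R) (A 1%R) phi f.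
Let G (u w : plane R) : H := qwlct (A 0%R) (A 1%R) phi f w u.

Let mnf : measurable_fun setT (fun x => nsq (f x)). Proof. exact: measurable_nsq. Qed.
Let mnphi : measurable_fun setT (fun x => nsq (phi x)). Proof. exact: measurable_nsq. Qed.

Let mpsub_u u : measurable_fun setT (fun x : plane R => psub x u).
Proof. by apply: measurable_fun_pair; meas. Qed.

Let mchirped u : qmeas (g u).
Proof.
apply: qmeasM; first apply: qmeasM.
- by apply: qmeas_expi; rewrite /chirp; meas.
- apply: qmeasM => //; apply: qmeas_conj.
  exact: (qmeas_comp (h := fun x => psub x u)).
- by apply: qmeas_expj; rewrite /chirp; meas.
Qed.

Let fi : mu2.-integrable setT (EFin \o (fun x => nsq (f x))).
Proof. by apply: ge0_integrable => // x; exact: nsq_ge0. Qed.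

Let phii u : mu2.-integrable setT (EFin \o (fun x => nsq (phi (psub x u)))).
Proof.
apply: ge0_integrable.
- exact: (measurableT_comp mnphi (mpsub_u u)).
- by move=> x; exact: nsq_ge0.
- rewrite (ge0_integral_psubr u (f := fun x => (nsq (phi x))%:E))//.
  + exact/measurable_EFinP.
  + by move=> x; rewrite lee_fin nsq_ge0.
Qed.

Let chirped_integrable u : qintegrable (g u).
Proof.
apply: (qintegrable_mul_bound (mchirped u) fi (phii u)) => x; try exact: nsq_ge0.
by rewrite nsq_chirped.
Qed.

(** The factors that do not depend on [x] have constant modulus, and the moduli of the two
    square roots produce exactly the Plancherel constants of the two variables. *)
Let nsq_G u w : (nsq (G u w) = qft_weight (b 0) (b 1) * nsq (qft (b 0) (b 1) (g u) w))%R.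
Proof.
have pi0 : (0 < pi :> R)%R by exact: pi_gt0.
have nz k : (2 * pi * A k 0 1 != 0)%R by rewrite !mulf_neq0// gt_eqF.
have si k : (sqrti (2 * pi * A k 0 1) != 0)%R.
  by apply: contra_neq (nz k) => e; apply/eqP; rewrite -normr_eq0 -nsq_sqrti e nsq0.
have sj k : (sqrtj (2 * pi * A k 0 1) != 0)%R.
  by apply: contra_neq (nz k) => e; apply/eqP; rewrite -normr_eq0 -nsq_sqrtj e nsq0.
pose p := ((sqrti (2 * pi * A 0 0 1))^-1 * expi (phase_tail (A 0) w.1))%R.
pose q := (expj (phase_tail (A 1) w.2) * (sqrtj (2 * pi * A 1 0 1))^-1)%R.
have -> : G u w = qintegral (fun x =>
    p * (expi (- (b 0 * x.1 * w.1)) * g u x * expj (- (b 1 * x.2 * w.2))) * q)%R.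
  by congr qintegral; apply/funext => x; exact: qwlct_integrand.
rewrite nsq_qintegralM; last first.
  apply: (qintegrable_mul_bound _ fi (phii u)) => [|x|x|x]; try exact: nsq_ge0.
    apply: qmeasM; first apply: qmeasM; [|exact: mchirped|].
    - by apply: qmeas_expi; meas.
    - by apply: qmeas_expj; meas.
  by rewrite 2!nsqM nsq_expi nsq_expj mul1r mulr1 /g nsq_chirped.
have -> : nsq p = (`|2 * pi * A 0 0 1|^-1)%R by rewrite /p nsqM nsq_expi mulr1 nsq_inv// nsq_sqrti.
have -> : nsq q = (`|2 * pi * A 1 0 1|^-1)%R by rewrite /q nsqM nsq_expj mul1r nsq_inv// nsq_sqrtj.
rewrite mulrAC; congr (_ * _)%R.
rewrite /qft_weight /b !normrM !normfV ger0_norm// gtr0_norm//.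
have n0 k : (`|A k 0 1| != 0)%R by rewrite normr_eq0.
have pin : (pi != 0 :> R)%R by rewrite gt_eqF.
move: (pi : R) pin => c c0.
by field; rewrite !n0 c0.
Qed.

Let N u := \int[mu2]_x (nsq (f x) * nsq (phi (psub x u)))%:E.
Let X k u := \int[mu2]_x (coord2 k x ^+ 2 * nsq (f x) * nsq (phi (psub x u)))%:E.
Let W k u := \int[mu2]_w (coord2 k w ^+ 2 * nsq (G u w))%:E.

Let NE u : N u = \int[mu2]_x (nsq (g u x))%:E.
Proof. by apply: eq_integral => x _; rewrite nsq_chirped. Qed.

Let XE k u : X k u = \int[mu2]_x (coord2 k x ^+ 2 * nsq (g u x))%:E.
Proof. by apply: eq_integral => x _; rewrite nsq_chirped mulrA. Qed.

Let weight0 : (0 <= qft_weight (b 0) (b 1))%R.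
Proof. by rewrite mulr_ge0// divr_ge0 ?mulr_ge0 ?pi_ge0. Qed.

Let uncertainty_at k u (lam : R) : (0 < lam)%R -> N u < +oo ->
  N u <= lam%:E * X k u + (lam^-1 * b k ^+ 2)%:E * W k u.
Proof.
move=> lam0; rewrite NE XE => Nfin.
apply: (le_trans (qft_uncertainty k lam0 b0 (chirped_integrable u) Nfin)).
apply: leeD; first exact: lexx.
have mk := measurable_coord2 (R := R) k.
have mq := measurable_nsq_qft (b 0%R) (b 1%R) (chirped_integrable u).
rewrite /W; under [in leRHS]eq_integral do rewrite nsq_G mulrCA.
rewrite [in leRHS]ge0_integralZl_real; [|by []| | |exact: weight0].
- by rewrite muleA -EFinM.
- by apply: measurable_funM => //; exact: measurable_funX.
- by move=> w; rewrite mulr_ge0 ?sqr_ge0 ?nsq_ge0.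
Qed.

(** A vanishing spectral moment forces the transform to vanish almost everywhere, and then
    Plancherel forces the windowed function to vanish. *)
Let W_eq0 k u : N u < +oo -> W k u = 0 -> N u = 0.
Proof.
move=> Nfin Wu0.
have mq := measurable_nsq_qft (b 0%R) (b 1%R) (chirped_integrable u).
have mG : measurable_fun setT (fun w => nsq (G u w)).
  under eq_fun do rewrite nsq_G; exact: measurable_funM.
have G0 : \int[mu2]_w (nsq (G u w))%:E = 0.
  by apply: integral_coord2_eq0 Wu0 => // w; exact: nsq_ge0.
apply/eqP; rewrite eq_le; apply/andP; split; last first.
  by apply: integral_ge0 => x _; rewrite lee_fin mulr_ge0 ?nsq_ge0.
rewrite -G0 NE; rewrite NE in Nfin.
apply: (le_trans (qft_plancherel (b0 0%R) (b0 1%R) (chirped_integrable u) Nfin)).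
under [in leRHS]eq_integral do rewrite nsq_G.
by rewrite ge0_integralZl_real; [|by []|exact: mq|by move=> w; exact: nsq_ge0|exact: weight0].
Qed.

Let mjoint (k : plane R -> R) : measurable_fun setT k ->
  measurable_fun setT (fun p : plane R * plane R => k p.2 * nsq (f p.2) * nsq (phi (psub p.2 p.1)))%R.
Proof.
move=> mk; apply: measurable_funM; first apply: measurable_funM.
- exact: (measurableT_comp mk measurable_snd).
- exact: (measurableT_comp mnf measurable_snd).
- by apply: (measurableT_comp mnphi); apply: measurable_fun_pair; meas.
Qed.

Let joint_ge0 (k : plane R -> R) (p : plane R * plane R) : (forall x, 0 <= k x)%R ->
  (0 <= k p.2 * nsq (f p.2) * nsq (phi (psub p.2 p.1)))%R.
Proof. by move=> k0; rewrite !mulr_ge0 ?nsq_ge0. Qed.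

(** Tonelli's theorem followed by the substitution [u |-> x - u] in the window. *)
Let integral_joint (k : plane R -> R) : measurable_fun setT k -> (forall x, 0 <= k x)%R ->
  measurable_fun setT (fun u => \int[mu2]_x (k x * nsq (f x) * nsq (phi (psub x u)))%:E) /\
  \int[mu2]_u \int[mu2]_x (k x * nsq (f x) * nsq (phi (psub x u)))%:E =
  \int[mu2]_x (k x * nsq (f x))%:E * \int[mu2]_x (nsq (phi x))%:E.
Proof.
move=> mk k0.
have mJ : measurable_fun setT (fun p : plane R * plane R =>
    (k p.2 * nsq (f p.2) * nsq (phi (psub p.2 p.1)))%:E).
  by apply/measurable_EFinP; exact: mjoint.
have J0 (p : plane R * plane R) : 0 <= (k p.2 * nsq (f p.2) * nsq (phi (psub p.2 p.1)))%:E.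
  by rewrite lee_fin joint_ge0.
split.
  exact: (measurable_fun_fubini_tonelli_F (m2 := mu2) _ mJ J0).
rewrite (fubini_tonelli (m1 := mu2) (m2 := mu2) _ mJ J0)/=.
have mkf : measurable_fun setT (fun x => k x * nsq (f x))%R by exact: measurable_funM.
transitivity (\int[mu2]_x ((k x * nsq (f x))%:E * \int[mu2]_x (nsq (phi x))%:E)).
  apply: eq_integral => x _.
  rewrite ge0_integralZl_real; [|by []| | |by rewrite mulr_ge0 ?nsq_ge0].
  - congr (_ * _); apply: (ge0_integral_psubl x (f := fun y => (nsq (phi y))%:E)).
      exact/measurable_EFinP.
    by move=> y; rewrite lee_fin nsq_ge0.
  - by apply: (measurableT_comp mnphi); apply: measurable_fun_pair; meas.
  - by move=> u; exact: nsq_ge0.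
rewrite ge0_integralZr//.
- exact/measurable_EFinP.
- by move=> x _; rewrite lee_fin mulr_ge0 ?nsq_ge0.
- by apply: integral_ge0 => x _; rewrite lee_fin nsq_ge0.
Qed.

Let mN : measurable_fun setT N.
Proof.
have [m _] := @integral_joint (fun=> 1%R) (measurable_cst _) (fun=> ler01).
by move: m; congr measurable_fun; apply/funext => u; apply: eq_integral => x _; rewrite mul1r.
Qed.

Let integral_N : \int[mu2]_u N u = \int[mu2]_x (nsq (f x))%:E * \int[mu2]_x (nsq (phi x))%:E.
Proof.
have [_ e] := @integral_joint (fun=> 1%R) (measurable_cst _) (fun=> ler01).
transitivity (\int[mu2]_u \int[mu2]_x (1 * nsq (f x) * nsq (phi (psub x u)))%:E).
  by apply: eq_integral => u _; apply: eq_integral => x _; rewrite mul1r.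
by rewrite e; congr (_ * _); apply: eq_integral => x _; rewrite mul1r.
Qed.

(** Each component of the transform is a parametric integral of a jointly measurable
    function, so Tonelli's theorem applies to its square. *)
Let mW k : measurable_fun setT (W k).
Proof.
(* the full integrand, as a function of [((u, w), x)] *)
pose K (p : (plane R * plane R) * plane R) : H :=
  (kerneli (A 0) p.2.1 p.1.2.1 * f p.2 * qconj (phi (psub p.2 p.1.1)) *
   kernelj (A 1) p.2.2 p.1.2.2)%R.
have [m1 m2 m3 m4] : qmeas K.
  apply: qmeasM; first apply: qmeasM; first apply: qmeasM.
  - apply: qmeasM; first exact: qmeas_cst.
    by apply: qmeas_expi; rewrite /lct_phase; meas.
  - exact: (qmeas_comp measurable_snd mf).
  - apply: qmeas_conj; apply: (qmeas_comp _ mphi).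
    by apply: measurable_fun_pair; meas.
  - apply: qmeasM; first exact: qmeas_cst.
    by apply: qmeas_expj; rewrite /lct_phase; meas.
have mG : qmeas (fun t : plane R * plane R => G t.1 t.2).
  split.
  - exact: (@measurable_Rintegral_snd _ _ _ _ R mu2 _ m1).
  - exact: (@measurable_Rintegral_snd _ _ _ _ R mu2 _ m2).
  - exact: (@measurable_Rintegral_snd _ _ _ _ R mu2 _ m3).
  - exact: (@measurable_Rintegral_snd _ _ _ _ R mu2 _ m4).
apply: (measurable_fun_fubini_tonelli_F (m2 := mu2)
  (fun t : plane R * plane R => (coord2 k t.2 ^+ 2 * nsq (G t.1 t.2))%:E)).
  apply/measurable_EFinP; apply: measurable_funM; last exact: measurable_nsq.
  apply: measurable_funX; exact: (measurableT_comp (measurable_coord2 k) measurable_snd).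
by move=> t; rewrite lee_fin mulr_ge0 ?sqr_ge0 ?nsq_ge0.
Qed.

Let N0 u : 0 <= N u.
Proof. by apply: integral_ge0 => x _; rewrite lee_fin mulr_ge0 ?nsq_ge0. Qed.
Let X0 k u : 0 <= X k u.
Proof.
apply: integral_ge0 => x _; rewrite lee_fin -mulrA.
by apply: mulr_ge0; rewrite ?sqr_ge0// mulr_ge0 ?nsq_ge0.
Qed.

Let W0 k u : 0 <= W k u.
Proof. by apply: integral_ge0 => w _; rewrite lee_fin mulr_ge0 ?sqr_ge0 ?nsq_ge0. Qed.

(** The mass is finite for almost every [u] only through its integral over [u], which is
    the product of two finite squared norms. *)
Let N_fin_ae : {ae mu2, forall u, N u < +oo}.
Proof.
have Ni : mu2.-integrable setT N.
  apply/integrableP; split => //.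
  have -> : (fun u => `|N u|) = N by apply/funext => u; rewrite gee0_abs.
  rewrite integral_N lte_mul_pinfty//.
  - by apply: integral_ge0 => x _; rewrite lee_fin nsq_ge0.
  - by rewrite ge0_fin_numE//; apply: integral_ge0 => x _; rewrite lee_fin nsq_ge0.
have := integrable_ae measurableT Ni.
by apply: ae_imply => u /(_ I); rewrite ge0_fin_numE.
Qed.

(** The inequality at a fixed position holds for almost every [u], with constants that do
    not depend on [u]; integrate it in [u]. *)
Lemma window_uncertainty k (lam : R) : (0 < lam)%R ->
  \int[mu2]_x (nsq (f x))%:E * \int[mu2]_x (nsq (phi x))%:E <=
    lam%:E * (\int[mu2]_x (coord2 k x ^+ 2 * nsq (f x))%:E * \int[mu2]_x (nsq (phi x))%:E) +
    (lam^-1 * (A k 0 1)^-1 ^+ 2)%:E *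
    \int[mu2]_u \int[mu2]_w (coord2 k w ^+ 2 * nsq (qwlct (A 0%R) (A 1%R) phi f w u))%:E.
Proof.
move=> lam0; rewrite -integral_N.
rewrite -[X in _ <= _ + _ * X]/(\int[mu2]_u W k u) -[((A k 0 1)^-1)%R]/(b k).
have mk : measurable_fun setT (fun x : plane R => coord2 k x ^+ 2)%R.
  by apply: measurable_funX; exact: measurable_coord2.
have [mX eX] := integral_joint mk (fun x => sqr_ge0 _).
have c0 : 0 <= (lam^-1 * b k ^+ 2)%:E.
  by rewrite lee_fin mulr_ge0 ?sqr_ge0// invr_ge0 ltW.
have l0 : 0 <= lam%:E by rewrite lee_fin ltW.
rewrite -eX -ge0_integralZl//; last by move=> u _; exact: X0.
rewrite -ge0_integralZl//.
rewrite -ge0_integralD//; last 4 first.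
- by move=> u _; apply: mule_ge0 => //; exact: X0.
- exact: measurable_funeM.
- by move=> u _; apply: mule_ge0.
- exact: measurable_funeM.
apply: ae_ge0_le_integral => //.
- by move=> u _; apply: adde_ge0; apply: mule_ge0 => //; exact: X0.
- by apply: emeasurable_funD; exact: measurable_funeM.
by apply: ae_imply N_fin_ae => u Nu _; exact: uncertainty_at.
Qed.

Lemma window_spectrum_eq0 k :
  \int[mu2]_u \int[mu2]_w (coord2 k w ^+ 2 * nsq (qwlct (A 0%R) (A 1%R) phi f w u))%:E = 0 ->
  \int[mu2]_x (nsq (f x))%:E * \int[mu2]_x (nsq (phi x))%:E = 0.
Proof.
rewrite -integral_N -[X in X = 0 -> _]/(\int[mu2]_u W k u).
move=> IW; have := (ae_eq_integral_abs mu2 measurableT (mW k)).1.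
have -> : \int[mu2]_x `|W k x| = 0.
  by rewrite -IW; apply: eq_integral => u _; rewrite gee0_abs.
move=> /(_ erefl) [Z [mZ Z0 hZ]].
have [Y [mY Y0 hY]] := N_fin_ae.
apply/eqP; rewrite eq_le; apply/andP; split; last exact: integral_ge0.
rewrite -(integral0 mu2 setT); apply: ae_ge0_le_integral => //.
exists (Z `|` Y); split; [exact: measurableU|exact: null_set_setU|].
move=> u /= h; apply: contrapT => /not_orP[uZ uY]; apply: h => _.
have Nu : N u < +oo by apply: contrapT => h; exact/uY/hY.
have Wu : W k u = 0 by apply: contrapT => h; apply/uZ/hZ => /= /(_ I).
by rewrite (W_eq0 Nu Wu).
Qed.

End WindowedTransform.

(** * From the linear form to the product *)

Section Optimization.
Context {R : realType}.
Local Open Scope ereal_scope.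

(** The minimum over [lam] of [lam * X + W / lam] is [2 * sqrt (X * W)], reached at
    [sqrt W / sqrt X].  If [X] or [W] vanishes, [lam] tends to infinity or to [0]. *)
Lemma optimize_real (a X W : R) : (0 <= a)%R -> (0 <= X)%R -> (0 <= W)%R ->
  (forall lam, 0 < lam -> a <= lam * X + lam^-1 * W)%R ->
  (a / 2 <= Num.sqrt W * Num.sqrt X)%R.
Proof.
move=> a0 X0 W0 h.
have [X00|Xn] := eqVneq X 0%R.
  suff -> : a = 0%R by rewrite mul0r mulr_ge0 ?sqrtr_ge0.
  apply/eqP; rewrite eq_le a0 andbT; apply: (@le0_of_le_mul _ _ W) => t t0 _.
  by have := h t^-1%R; rewrite invr_gt0 => /(_ t0); rewrite X00 mulr0 add0r invrK.
have [W00|Wn] := eqVneq W 0%R.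
  suff -> : a = 0%R by rewrite mul0r mulr_ge0 ?sqrtr_ge0.
  apply/eqP; rewrite eq_le a0 andbT; apply: (@le0_of_le_mul _ _ X) => t t0 _.
  by have := h t t0; rewrite W00 mulr0 addr0.
have s0 : (0 < Num.sqrt X)%R by rewrite sqrtr_gt0 lt_neqAle eq_sym Xn.
have t0 : (0 < Num.sqrt W)%R by rewrite sqrtr_gt0 lt_neqAle eq_sym Wn.
have := h (Num.sqrt W / Num.sqrt X)%R; rewrite divr_gt0// => /(_ isT).
move: (esym (sqr_sqrtr X0)) (esym (sqr_sqrtr W0)).
move: (Num.sqrt X) (Num.sqrt W) s0 t0 => s t s0 t0 -> ->.
have -> : (t / s * s ^+ 2 + (t / s)^-1 * t ^+ 2 = 2 * (t * s))%R by field; rewrite !gt_eqF.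
by move=> ?; lra.
Qed.

Lemma sqrte_gt0 (x : \bar R) : 0 < x -> 0 < sqrte x.
Proof. by case: x => [r||] //=; rewrite !lte_fin sqrtr_gt0. Qed.

(** With [X] and [W] allowed to be infinite, the hypothesis carries no information when one
    of them is infinite; if the other is zero then the product of square roots is zero
    too.  Hence the two conditions on the vanishing of [X] and [W]. *)
Lemma optimize_ereal (b N P : R) (X W : \bar R) :
  (0 < b)%R -> (0 <= N)%R -> (0 <= P)%R -> 0 <= X -> 0 <= W ->
  (forall lam, (0 < lam)%R ->
     (b * (N * P))%:E <= lam%:E * (X * P%:E) + (lam^-1)%:E * W) ->
  (W = 0 -> (N * P = 0)%R) -> (X = 0 -> N = 0%R) ->
  (b / 2 * N * Num.sqrt P)%:E <= sqrte W * sqrte X.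
Proof.
move=> b0 N0 P0 X0 W0 h hW hX.
have RHS0 : 0 <= sqrte W * sqrte X by rewrite mule_ge0 ?sqrte_ge0.
have [P00|Pn] := eqVneq P 0%R; first by rewrite P00 sqrtr0 mulr0.
have Pp : (0 < P)%R by rewrite lt_neqAle eq_sym Pn.
have [N00|Nn] := eqVneq N 0%R; first by rewrite N00 mulr0 mul0r.
have {}hX : 0 < X by rewrite lt_neqAle X0 andbT eq_sym; apply: contra_neq Nn => /hX.
have {}hW : 0 < W.
  rewrite lt_neqAle W0 andbT eq_sym; apply: contra_neq Nn => /hW/eqP.
  by rewrite mulf_eq0 (negbTE Pn) orbF => /eqP.
case: X X0 h hX RHS0 => [x|_ _ _ _|//]; last first.
  by rewrite /= gt0_muley ?leey// sqrte_gt0.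
case: W W0 hW => [w|_ _|//]; last first.
  by move=> x0 _ xp _; rewrite /= gt0_mulye ?leey// lte_fin sqrtr_gt0 -lte_fin.
rewrite !lee_fin => w0 wp x0 h xp _.
have := @optimize_real (b * (N * P))%R (x * P)%R w _ _ w0.
rewrite !mulr_ge0// ?(ltW b0)// => /(_ isT isT).
have -> : (b / 2 * N * Num.sqrt P <= Num.sqrt w * Num.sqrt x)%R =
    (b * (N * P) / 2 <= Num.sqrt w * Num.sqrt (x * P))%R.
  have eP : (Num.sqrt P * Num.sqrt P = P)%R by rewrite -expr2 sqr_sqrtr.
  rewrite sqrtrM// -[LHS](ler_pM2r (_ : 0 < Num.sqrt P)%R) ?sqrtr_gt0//.
  by rewrite -[X in (X <= _)%R]mulrA eP; congr (_ <= _)%R; ring.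
by apply => lam lam0; rewrite -lee_fin !EFinD !EFinM; have := h lam lam0; rewrite !EFinM.
Qed.

End Optimization.

Theorem theorem8 (R : realType) (A : 'I_2 -> 'M[R]_2)
  (detA : forall k, \det (A k) = 1) (b_neq0 : forall k, A k 0 1 != 0)
  (phi : plane R -> quaternion R) (phi_L2 : inL2 phi)
  (phi_neq0 : ~ (\forall x \ae @lebesgue2 R, phi x = 0))
  (f : plane R -> quaternion R) (f_L2 : inL2 f)
  (G_L2 : forall u, inL2 (fun w => qwlct (A 0) (A 1) phi f w u))
  (k : 'I_2) :
  ((A k 0%R 1%R / 2)%:E * L2norm f ^+ 2 * L2norm phi <=
   sqrte (\int[@lebesgue2 R]_u \int[@lebesgue2 R]_w
            (coord2 k w ^+ 2 * qnorm (qwlct (A 0%R) (A 1%R) phi f w u) ^+ 2)%:E)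
   * sqrte (\int[@lebesgue2 R]_x (coord2 k x ^+ 2 * qnorm (f x) ^+ 2)%:E))%E.
Proof.
have qE (h : plane R -> quaternion R) :
    (\int[@lebesgue2 R]_x (qnorm (h x) ^+ 2)%:E = \int[@lebesgue2 R]_x (nsq (h x))%:E)%E.
  by apply: eq_integral => x _; rewrite qnorm_sqr.
have kE (h : plane R -> quaternion R) :
    (\int[@lebesgue2 R]_x (coord2 k x ^+ 2 * qnorm (h x) ^+ 2)%:E =
     \int[@lebesgue2 R]_x (coord2 k x ^+ 2 * nsq (h x))%:E)%E.
  by apply: eq_integral => x _; rewrite qnorm_sqr.
have [mf] := f_L2; have [mphi] := phi_L2.
rewrite /L2norm !qE kE => phi_fin f_fin.
under [X in (_ <= sqrte X * _)%E]eq_integral do rewrite kE.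
have mnf : measurable_fun setT (fun x => nsq (f x)) by exact: measurable_nsq.
have I0 (m : plane R -> R) (h : plane R -> quaternion R) :
    (forall x, 0 <= m x) -> (0 <= \int[@lebesgue2 R]_x (m x * nsq (h x))%:E)%E.
  by move=> m0; apply: integral_ge0 => x _; rewrite lee_fin mulr_ge0 ?nsq_ge0.
have hU := window_uncertainty b_neq0 mf mphi f_fin phi_fin k.
have hW := window_spectrum_eq0 b_neq0 mf mphi f_fin phi_fin (k := k).
have hX := integral_coord2_eq0 (k := k) mnf (fun x => nsq_ge0 (f x)).
have W0 : (0 <= \int[@lebesgue2 R]_u \int[@lebesgue2 R]_w
    (coord2 k w ^+ 2 * nsq (qwlct (A 0%R) (A 1%R) phi f w u))%:E)%E.
  by apply: integral_ge0 => u _; apply: I0 => w; exact: sqr_ge0.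
have X0 := I0 (fun x => coord2 k x ^+ 2) f (fun x => sqr_ge0 _).
have N0 : (0 <= \int[@lebesgue2 R]_x (nsq (f x))%:E)%E.
  by apply: integral_ge0 => x _; rewrite lee_fin nsq_ge0.
have P0 : (0 <= \int[@lebesgue2 R]_x (nsq (phi x))%:E)%E.
  by apply: integral_ge0 => x _; rewrite lee_fin nsq_ge0.
move: hU hW hX W0 X0 N0 P0 f_fin phi_fin.
set N := (\int[_]_x (nsq (f x))%:E)%E; set P := (\int[_]_x (nsq (phi x))%:E)%E.
set W := (\int[_]_u \int[_]_w _)%E; set X := (\int[_]_x _)%E.
move=> hU hW hX W0 X0 N0 P0 Nfin Pfin.
case: N N0 Nfin hU hW hX => [N|//|//] N0 _ hU hW hX.
case: P P0 Pfin hU hW => [P|//|//] P0 _ hU hW.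
rewrite lee_fin in N0; rewrite lee_fin in P0.
have -> : (sqrte N%:E ^+ 2 = N%:E)%E by rewrite sqr_sqrte ?lee_fin.
rewrite /= -!EFinM.
have [b0|b0] := ltP 0 (A k 0 1); last first.
  apply: (@le_trans _ _ 0%E); last by rewrite mule_ge0 ?sqrte_ge0.
  rewrite lee_fin mulr_le0_ge0 ?sqrtr_ge0// mulr_le0_ge0//.
  by rewrite pmulr_lle0 ?invr_gt0.
apply: optimize_ereal => //; last first.
- by move=> /hX[].
- by move=> /hW[].
move=> lam lam0.
(* [window_uncertainty] at [lam / b] multiplied by [b]: the spectral coefficient
   [b * (b / lam) * b^-2] is [lam^-1] *)
have := hU _ (divr_gt0 lam0 b0).
have bb : (0 < (A k 0 1)%:E)%E by rewrite lte_fin.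
rewrite -(lee_pmul2l _ bb)//.
rewrite ge0_muleDr; last 2 first.
- by rewrite mule_ge0// ?mule_ge0// lee_fin// divr_ge0// ltW.
- by rewrite mule_ge0// lee_fin mulr_ge0 ?sqr_ge0// invr_ge0 divr_ge0// ltW.
have e1 : A k 0 1 * (lam / A k 0 1) = lam by field; rewrite gt_eqF.
have e2 : A k 0 1 * ((lam / A k 0 1)^-1 * (A k 0 1)^-1 ^+ 2) = lam^-1.
  by field; rewrite !gt_eqF.
have m (p q : R) (x : \bar R) : (p%:E * (q%:E * x) = (p * q)%:E * x)%E by rewrite muleA EFinM.
by rewrite (m _ _ (X * P%:E)%E) (m _ _ W) e1 e2 -!EFinM.
Qed.
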